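(* Let $(M_1,\omega_1,\Phi_1)$ and $(M_2,\omega_2,\Phi_2)$ be faithful semitoric systems satisfying (F7) that are isomorphic as integrable systems, and suppose that $(M_1,\omega_1,\Phi_1)$ has at least one focus-focus point. Then the sets of complexity one cartographic images of $(M_1,\omega_1,\Phi_1)$ and of $(M_2,\omega_2,\Phi_2)$ (both sets of subsets of $\mathbb{R}^2$) are equal.
   Context: Conventions. $S^1=\mathbb{R}/2\pi\mathbb{Z}$, $\mathbb{T}^2=(S^1)^2$. Subsets carry the subspace topology. A map on a subset of $\mathbb{R}^n$ is smooth if locally it extends to a smooth map on an open subset of $\mathbb{R}^n$; a smooth embedding of a subset is a diffeomorphism onto its image. A map $f:X\to Y$ is proper onto its image if $f:X\to f(X)$ is proper. Hamiltonian vector fields: $\omega(X_F,\cdot)=dF$; $\{F,G\}=\omega(X_F,X_G)$. Integrable systems. An integrable system (with two degrees of freedom) is a triple $(M,\omega,\Phi=(J,H))$ with $(M,\omega)$ a 4-dimensional symplectic manifold and $\Phi:M\to\mathbb{R}^2$ smooth with $\{J,H\}=0$ and $\Phi$ a submersion on an open dense subset of $M$. Fibers are assumed compact, so $\Phi$ generates a Hamiltonian $\mathbb{R}^2$-action; ''orbit'' means orbit of this action. Two systems are isomorphic as integrable systems if there are a symplectomorphism $\Psi:(M_1,\omega_1)\to(M_2,\omega_2)$ and a diffeomorphism $\psi:\Phi_1(M_1)\to\Phi_2(M_2)$ with $\Phi_2\circ\Psi=\psi\circ\Phi_1$. Almost-toric orbits. A point $p$ is singular if $\operatorname{rk}D_p\Phi<2$;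 the rank $k$ of an orbit is $\operatorname{rk}D_p\Phi$ at any of its points. For a singular orbit $\mathcal{O}\ni p$, the linearized $\mathbb{R}^2$-action at $p$ on $(T_p\mathcal{O})^{\omega}/T_p\mathcal{O}\cong\mathbb{R}^{2(2-k)}$ induces a Lie algebra homomorphism $\mathbb{R}^2\to\mathfrak{sp}(2(2-k);\mathbb{R})$ with image $\mathfrak{h}_{\mathcal{O}}$; $\mathcal{O}$ is non-degenerate if $\mathfrak{h}_{\mathcal{O}}$ is a Cartan subalgebra. Identify $\mathfrak{sp}(2m;\mathbb{R})$ with quadratic forms on $\mathbb{R}^{2m}$. A singular orbit is almost-toric if it is compact, non-degenerate and, in suitable linear symplectic coordinates, $\mathfrak{h}_{\mathcal{O}}$ is spanned by: $\frac{x_1^2+y_1^2}{2},\frac{x_2^2+y_2^2}{2}$ (rank 0, elliptic-elliptic); or $x_1y_2-x_2y_1,\ x_1y_1+x_2y_2$ (rank 0, focus-focus); or $\frac{x^2+y^2}{2}$ (rank 1, elliptic-regular). Faithful semitoric system. An integrable system $(M,\omega,\Phi=(J,H))$ on a connected 4-dimensional symplectic manifold such that: (F1) $\Phi$ is proper onto its image; (F2) all singular orbits are almost-toric; (F3) $J$ is the moment map of an effective Hamiltonian $S^1$-action; (F4) every fiber of $J$ is connected; (F5) the set of critical values of $J$ has no limit points in $J(M)$; (F6) every fiber of $J$ contains at most finitely many isolated fixed points of the $S^1$-action. Fibers of $\Phi$ are then connected. Put $B=\Phi(M)$. Focus-focus values are the images of focus-focus points; they form a countable discrete set $B_{\mathrm{ff}}=\{c_i=(x_i,y_i)\}_{i\in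 I}\subset\operatorname{Int}(B)$. (F7): every fiber of $\Phi$ contains at most one focus-focus point. $\mathbb{Z}$-affine structure. Put $B_{\mathrm{wt}}=B\smallsetminus B_{\mathrm{ff}}$. Each point of $B_{\mathrm{wt}}$ has an open neighborhood $U\subset B_{\mathrm{wt}}$ with a diffeomorphism $\psi:U\to\psi(U)\subset\mathbb{R}^2$ such that $\psi\circ\Phi|_{\Phi^{-1}(U)}$ is the moment map of an effective Hamiltonian $\mathbb{T}^2$-action; such $(U,\psi)$ are the charts of a $\mathbb{Z}$-affine structure on $B_{\mathrm{wt}}$ (transition maps are locally restrictions of elements of $\mathrm{AGL}(2;\mathbb{Z})=\mathrm{GL}(2;\mathbb{Z})\ltimes\mathbb{R}^2$). A cartographic pair $(f,S)$ consists of a topological embedding $f:B\to\mathbb{R}^2$ and $S\subset B_{\mathrm{wt}}$ open and dense in $B$, such that $f|_S$ is a smooth embedding that is $\mathbb{Z}$-affine, i.e. for each chart $\psi$, $f\circ\psi^{-1}$ is locally (on $\psi(U\cap S)$) the restriction of an element of $\mathrm{AGL}(2;\mathbb{Z})$. Semitoric cartographic pairs. For $\boldsymbol{\epsilon}=(\epsilon_i)\in\{+1,-1\}^I$ set $l^{\epsilon_i}=\{(x,y)\mid x=x_i,\ \epsilon_iy\ge\epsilon_iy_i\}\cap B$, $l^{\boldsymbol{\epsilon}}=\bigcup_il^{\epsilon_i}$, $S_{\boldsymbol{\epsilon}}=B\smallsetminus l^{\boldsymbol{\epsilon}}$, and $j_{\boldsymbol{\epsilon}}(x,y)=\sum_{\{i\mid(x,y)\in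 l^{\epsilon_i}\}}\epsilon_i$ for $(x,y)\in B_{\mathrm{wt}}$. A semitoric cartographic pair is a cartographic pair of the form $(f_{\boldsymbol{\epsilon}},S_{\boldsymbol{\epsilon}})$ for some $\boldsymbol{\epsilon}$, with $f_{\boldsymbol{\epsilon}}(x,y)=(x,f^{(2)}_{\boldsymbol{\epsilon}}(x,y))$, such that (C1) $\operatorname{sgn}(f_{\boldsymbol{\epsilon}}):=\operatorname{sgn}\big(\frac{\partial f^{(2)}_{\boldsymbol{\epsilon}}}{\partial y}\big)$ is constant on $S_{\boldsymbol{\epsilon}}$, and (C2) for all $(\mathsf{x},\mathsf{y})\in B_{\mathrm{wt}}$ (with points of $B$ on both sides), $\lim_{(x,y)\to(\mathsf{x},\mathsf{y}),\,x<\mathsf{x}}Df_{\boldsymbol{\epsilon}}(x,y)=\begin{pmatrix}1&0\\ \operatorname{sgn}(f_{\boldsymbol{\epsilon}})j_{\boldsymbol{\epsilon}}(\mathsf{x},\mathsf{y})&1\end{pmatrix}\lim_{(x,y)\to(\mathsf{x},\mathsf{y}),\,x>\mathsf{x}}Df_{\boldsymbol{\epsilon}}(x,y)$. Complexity one cartographic pairs. Let $\mathsf{L}\subset\mathrm{AGL}(2;\mathbb{Z})$ be the set of maps $(x,y)\mapsto(\eta_1x+a,\ kx+\eta_2y+b)$ with $\eta_1,\eta_2\in\{+1,-1\}$, $k\in\mathbb{Z}$, $a,b\in\mathbb{R}$. A complexity one cartographic pair is a pair $(\mathsf{l}\circ f_{\boldsymbol{\epsilon}},S_{\boldsymbol{\epsilon}})$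 with $\mathsf{l}\in\mathsf{L}$ and $(f_{\boldsymbol{\epsilon}},S_{\boldsymbol{\epsilon}})$ a semitoric cartographic pair; its complexity one cartographic image is $\mathsf{l}(f_{\boldsymbol{\epsilon}}(B))\subset\mathbb{R}^2$. *)

(* Defs.v *)
From HB Require Import structures.
From mathcomp Require Import all_boot all_order all_algebra.
From mathcomp Require Import all_classical all_reals all_analysis.

Set Implicit Arguments.
Unset Strict Implicit.
Unset Printing Implicit Defensive.

Import Order.TTheory GRing.Theory Num.Theory.
Import numFieldNormedType.Exports.

Local Open Scope classical_set_scope.
Local Open Scope ring_scope.

Section Smooth.
Context {R : realType}.

Definition iter_derive (V W : normedModType R) (vs : seq V) (f : V -> W) : V -> W :=
  foldr (fun v g => 'D_v g) f vs.

(* For V of finite dimension and U open this is C^infinity: all iterated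
   directional derivatives exist and are continuous on U. *)
Definition smooth_on (V W : normedModType R) (U : set V) (f : V -> W) : Prop :=
  forall (vs : seq V) (x : V), U x ->
    {for x, continuous (iter_derive vs f)} /\
    forall v : V, derivable (iter_derive vs f) x v.

Definition smooth_sub (V W : normedModType R) (A : set V) (f : V -> W) : Prop :=
  forall x, A x -> exists (U : set V) (g : V -> W),
    [/\ open U, U x, smooth_on U g & forall y, A y -> U y -> g y = f y].

Definition smooth_emb (V W : normedModType R) (A : set V) (f : V -> W) : Prop :=
  smooth_sub A f /\
  exists g : W -> V, (forall x, A x -> g (f x) = x) /\ smooth_sub (f @` A) g.

(* D f (z) for f smooth on the subset A, as the usual matrix acting on columns
   (the library's 'J acts on rows).  It is computed from a local smooth
   extension, and does not depend on it when A is, near z, contained in the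
   closure of its interior. *)
Definition Dsub (m n : nat) (A : set 'rV[R]_m.+1) (f : 'rV[R]_m.+1 -> 'rV[R]_n.+1)
    (z : 'rV[R]_m.+1) : 'M[R]_(n.+1, m.+1) :=
  xget 0 [set D | exists (U : set 'rV[R]_m.+1) (g : 'rV[R]_m.+1 -> 'rV[R]_n.+1),
    [/\ open U, U z, smooth_on U g,
        forall y, A y -> U y -> g y = f y & D = ('J g z)^T]].

End Smooth.

Record chart (R : realType) (M : Type) := Chart {
  cdom : set M;
  cmap : M -> 'rV[R]_4;
  cinv : 'rV[R]_4 -> M }.

(* The 2-form is given by its matrices in the charts: in the chart c, at the
   point with coordinates x, w(u, v) = u *m omega c x *m v^T.  The chart
   [chart_at p] serves to write tangent vectors at p as elements of R^4;
   nothing below depends on its choice. *)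
Record symplectic4 (R : realType) (M : topologicalType) := Symplectic4 {
  atlas : set (chart R M);
  chart_at : M -> chart R M;
  omega : chart R M -> 'rV[R]_4 -> 'M[R]_4;
  sm_hausdorff : hausdorff_space M;
  sm_countable : @second_countable M;
  sm_open : forall c, atlas c -> open (cdom c) /\ open (cmap c @` cdom c);
  sm_cancel : forall c p, atlas c -> cdom c p -> cinv c (cmap c p) = p;
  sm_continuous : forall c, atlas c ->
    {within cdom c, continuous (cmap c)} /\
    {within cmap c @` cdom c, continuous (cinv c)};
  sm_chart_at : forall p, atlas (chart_at p) /\ cdom (chart_at p) p;
  sm_trans : forall c d, atlas c -> atlas d ->
    smooth_on (cmap c @` (cdom c `&` cdom d)) (cmap d \o cinv c);
  omega_smooth : forall c, atlas c -> smooth_on (cmap c @` cdom c) (omega c);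
  omega_trans : forall c d p, atlas c -> atlas d -> cdom c p -> cdom d p ->
    let T := 'J (cmap d \o cinv c) (cmap c p) in
    omega c (cmap c p) = T *m omega d (cmap d p) *m T^T;
  omega_skew : forall c p, atlas c -> cdom c p ->
    (omega c (cmap c p))^T = - omega c (cmap c p);
  omega_nondegenerate : forall c p, atlas c -> cdom c p ->
    omega c (cmap c p) \in unitmx;
  omega_closed : forall c p (i j k : 'I_4), atlas c -> cdom c p ->
    let d (a : 'I_4) (g : 'rV[R]_4 -> R) := 'D_(delta_mx 0 a) g (cmap c p) in
    d i (fun x => omega c x j k) + d j (fun x => omega c x k i)
      + d k (fun x => omega c x i j) = 0 }.

Section Manifold.
Context {R : realType}.
Variables (M : topologicalType) (w : symplectic4 R M).
Local Notation R2 := 'rV[R]_2.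
Local Notation R4 := 'rV[R]_4.

Definition smooth_map (W : normedModType R) (F : M -> W) : Prop :=
  forall c, atlas w c -> smooth_on (cmap c @` cdom c) (F \o cinv c).

Definition dloc (c : chart R M) (F : M -> R) (x : R4) : R4 :=
  \row_i 'D_(delta_mx 0 i) (F \o cinv c) x.

(* In the chart c, the solution X of X *m omega c x *m v^T = dF(v) for all v,
   i.e. of w(X_F, .) = dF. *)
Definition hamvec (c : chart R M) (F : M -> R) (x : R4) : R4 :=
  dloc c F x *m invmx (omega w c x).

Definition poisson (F G : M -> R) (p : M) : R :=
  let c := chart_at w p in let x := cmap c p in
  (hamvec c F x *m omega w c x *m (hamvec c G x)^T) 0 0.

Definition integral_curve (F : M -> R) (g : R -> M) : Prop :=
  continuous g /\
  forall t c, atlas w c -> cdom c (g t) ->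
    is_derive (t : R^o) (1 : R^o) (cmap c \o g : R^o -> R4)
      (hamvec c F (cmap c (g t))).

Definition component (n : nat) (mu : M -> 'rV[R]_n) (xi : 'rV[R]_n) (p : M) : R :=
  (mu p *m xi^T) 0 0.

(* An effective Hamiltonian action of (R/2piZ)^(n+1) on the open subset W with
   moment map mu, written as an action of R^(n+1) whose kernel is the lattice
   (2 pi Z)^(n+1). *)
Record effective_torus_action (n : nat) (W : set M) (mu : M -> 'rV[R]_n.+1)
    (rho : 'rV[R]_n.+1 -> M -> M) : Prop := {
  ta_stable : forall t p, W p -> W (rho t p);
  ta_zero : forall p, W p -> rho 0 p = p;
  ta_add : forall s t p, W p -> rho (s + t) p = rho s (rho t p);
  ta_continuous : forall t p, W p ->
    {for (t, p), continuous (fun z : 'rV[R]_n.+1 * M => rho z.1 z.2)};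
  ta_smooth : forall c d, atlas w c -> atlas w d ->
    smooth_on [set z : 'rV[R]_n.+1 * R4 | exists p,
                 [/\ W p, cdom c p, z.2 = cmap c p & cdom d (rho z.1 p)]]
              (fun z : 'rV[R]_n.+1 * R4 => cmap d (rho z.1 (cinv c z.2)));
  ta_moment : forall (xi : 'rV[R]_n.+1) p, W p ->
    integral_curve (component mu xi) (fun t : R => rho (t *: xi) p);
  ta_invariant : forall t p, W p -> mu (rho t p) = mu p;
  ta_effective : forall t,
    (forall p, W p -> rho t p = p) <->
    (forall i, exists k : int, t 0 i = k%:~R * (2 * pi)) }.

Variable Phi : M -> R2.

Definition J (p : M) : R := Phi p 0 0.
Definition H (p : M) : R := Phi p 0 1.

(* d Phi at p, acting on row vectors *)
Definition dPhi (p : M) : 'M[R]_(4, 2) :=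
  let c := chart_at w p in 'J (Phi \o cinv c) (cmap c p).

Definition rk (p : M) : nat := \rank (dPhi p).

Definition integrable_system : Prop :=
  [/\ smooth_map Phi,
      forall p, poisson J H p = 0,
      exists D : set M, [/\ open D, dense D & forall p, D p -> rk p = 2%N]
    & forall z, compact (Phi @^-1` [set z])].

Definition singular (p : M) : Prop := (rk p < 2)%N.

(* The orbit of p under the Hamiltonian R^2-action: the time-one flow of
   X_(xi.Phi) is the action of xi. *)
Definition orbit (p : M) : set M :=
  [set q | exists (xi : R2) (g : R -> M),
     [/\ integral_curve (component Phi xi) g, g 0 = p & g 1 = q]].

(* The rows span T_p O. *)
Definition orbit_tangent (p : M) : 'M[R]_(2, 4) :=
  let c := chart_at w p in
  \matrix_(i < 2) hamvec c (component Phi (delta_mx 0 i)) (cmap c p).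

(* Standard symplectic form on R^(2m), with coordinates
   (x_1, ..., x_m, y_1, ..., y_m): w(x_i, y_j) = delta_ij. *)
Definition std_form (m : nat) : 'M[R]_(m + m) := block_mx 0 1%:M (- 1%:M) 0.

(* The rows of E lie in (T_p O)^w and are a symplectic basis of
   (T_p O)^w / T_p O, provided m = 2 - rk p. *)
Definition slice_frame (m : nat) (p : M) (E : 'M[R]_(m + m, 4)) : Prop :=
  let c := chart_at w p in let Om := omega w c (cmap c p) in
  E *m Om *m (orbit_tangent p)^T = 0 /\ E *m Om *m E^T = std_form m.

(* The image h_O of the linearized action, as matrices a acting on rows of
   coordinates in the frame E.  It is the linear isotropy representation: xi
   ranges over the Lie algebra of the stabilizer of p (all of R^2 in rank 0),
   and 'J (hamvec ..) is the linearization at p of X_(xi.Phi). *)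
Definition slice_algebra (m : nat) (p : M) (E : 'M[R]_(m + m, 4)) :
    set 'M[R]_(m + m) :=
  let c := chart_at w p in let x := cmap c p in
  [set a | exists xi : R2, dloc c (component Phi xi) x = 0 /\
     (E *m 'J (hamvec c (component Phi xi)) x - a *m E <= orbit_tangent p)%MS].

Definition bracket (n : nat) (a b : 'M[R]_n) : 'M[R]_n := a *m b - b *m a.

Definition sp (m : nat) : set 'M[R]_(m + m) :=
  [set a | a *m std_form m + std_form m *m a^T = 0].

(* Cartan subalgebra of sp(2m): nilpotent and self-normalizing. *)
Definition cartan (m : nat) (h : set 'M[R]_(m + m)) : Prop :=
  [/\ h `<=` @sp m, h 0,
      forall (s : R) a b, h a -> h b -> h (s *: a + b) /\ h (bracket a b),
      exists N : nat, forall (s : seq 'M[R]_(m + m)) b, size s = N ->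
        (forall a, a \in s -> h a) -> h b -> foldr (@bracket (m + m)) b s = 0
    & forall a, sp a -> (forall b, h b -> h (bracket a b)) -> h a].

(* The quadratic form w(a u, u) / 2 attached to a in sp(2m). *)
Definition quad_form (m : nat) (a : 'M[R]_(m + m)) (u : 'rV[R]_(m + m)) : R :=
  (u *m a *m std_form m *m u^T) 0 0 / 2.

Definition xc (m : nat) (i : 'I_m) (u : 'rV[R]_(m + m)) : R := u 0 (lshift m i).
Definition yc (m : nat) (i : 'I_m) (u : 'rV[R]_(m + m)) : R := u 0 (rshift m i).

Definition elliptic_form (m : nat) (i : 'I_m) (u : 'rV[R]_(m + m)) : R :=
  (xc i u ^+ 2 + yc i u ^+ 2) / 2.
Definition ff_form1 (u : 'rV[R]_(2 + 2)) : R :=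
  xc 0 u * yc 1 u - xc 1 u * yc 0 u.
Definition ff_form2 (u : 'rV[R]_(2 + 2)) : R :=
  xc 0 u * yc 0 u + xc 1 u * yc 1 u.

Definition span1 (T : Type) (q : T -> R) : set (T -> R) :=
  [set f | exists s : R, f = fun u => s * q u].
Definition span2 (T : Type) (q1 q2 : T -> R) : set (T -> R) :=
  [set f | exists s t : R, f = fun u => s * q1 u + t * q2 u].

Definition slice_forms (m : nat) (p : M) (E : 'M[R]_(m + m, 4)) :=
  (@quad_form m) @` slice_algebra p E.

Definition nondegenerate (p : M) : Prop :=
  exists E : 'M[R]_((2 - rk p) + (2 - rk p), 4),
    slice_frame p E /\ cartan (slice_algebra p E).

Definition elliptic_elliptic (p : M) : Prop :=
  rk p = 0%N /\ exists E : 'M[R]_(2 + 2, 4), slice_frame p E /\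
    slice_forms p E = span2 (@elliptic_form 2 0) (@elliptic_form 2 1).

Definition focus_focus_type (p : M) : Prop :=
  rk p = 0%N /\ exists E : 'M[R]_(2 + 2, 4), slice_frame p E /\
    slice_forms p E = span2 ff_form1 ff_form2.

Definition elliptic_regular (p : M) : Prop :=
  rk p = 1%N /\ exists E : 'M[R]_(1 + 1, 4), slice_frame p E /\
    slice_forms p E = span1 (@elliptic_form 1 0).

Definition almost_toric (p : M) : Prop :=
  [/\ compact (orbit p), nondegenerate p
    & [\/ elliptic_elliptic p, focus_focus_type p | elliptic_regular p]].

Definition focus_focus (p : M) : Prop :=
  [/\ singular p, almost_toric p & focus_focus_type p].

Definition critical_values_J : set R :=
  J @` [set p | let c := chart_at w p in dloc c J (cmap c p) = 0].

Definition fixed_points (n : nat) (rho : 'rV[R]_n -> M -> M) : set M :=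
  [set p | forall t, rho t p = p].

Record faithful_semitoric : Prop := {
  fs_connected : connected [set: M];
  fs_integrable : integrable_system;
  fs_proper : forall K : set R2, K `<=` range Phi -> compact K ->
    compact (Phi @^-1` K);
  fs_almost_toric : forall p, singular p -> almost_toric p;
  fs_circle : exists rho : 'rV[R]_1 -> M -> M,
    effective_torus_action [set: M] (fun p => const_mx (J p)) rho /\
    forall x : R, finite_set (J @^-1` [set x] `&` isolated (fixed_points rho));
  fs_J_connected : forall x : R, connected (J @^-1` [set x]);
  fs_crit_discrete : limit_point critical_values_J `&` range J = set0 }.

Definition one_focus_focus_per_fiber : Prop :=
  forall p q, focus_focus p -> focus_focus q -> Phi p = Phi q -> p = q.

Definition base : set R2 := range Phi.
Definition Bff : set R2 := Phi @` focus_focus.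
Definition Bwt : set R2 := base `\` Bff.

(* AGL(2; Z), acting on row vectors *)
Definition AGL2Z : set (R2 -> R2) :=
  [set g | exists (A : 'M[int]_2) (b : R2), A \in unitmx /\
     g = fun z : R2 => z *m map_mx intr A + b].

(* U is required to be connected so that effectiveness of the action on
   Phi^-1(U) is a local condition; otherwise an action effective on only one
   component of U would be allowed, and transition maps need not be in
   AGL(2; Z). *)
Definition affine_chart (U : set R2) (psi : R2 -> R2) : Prop :=
  [/\ (exists O : set R2, open O /\ U = O `&` Bwt), connected U,
      smooth_emb U psi
    & exists rho : R2 -> M -> M,
        effective_torus_action (Phi @^-1` U) (psi \o Phi) rho].

Definition Z_affine_on (f : R2 -> R2) (S : set R2) : Prop :=
  forall U psi, affine_chart U psi ->
  forall q, (psi @` (U `&` S)) q ->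
  exists (N : set R2) (g : R2 -> R2), [/\ nbhs q N, AGL2Z g
    & forall z, U z -> S z -> N (psi z) -> f z = g (psi z)].

Definition topological_embedding (A : set R2) (f : R2 -> R2) : Prop :=
  {within A, continuous f} /\
  exists g : R2 -> R2, (forall z, A z -> g (f z) = z) /\
    {within f @` A, continuous g}.

Definition cartographic_pair (f : R2 -> R2) (S : set R2) : Prop :=
  [/\ topological_embedding base f, S `<=` Bwt,
      (exists O : set R2, open O /\ S = O `&` base) /\ base `<=` closure S,
      smooth_emb S f & Z_affine_on f S].

Definition is_sign (s : R) : Prop := s = 1 \/ s = -1.

(* The focus-focus values index themselves; the values of eps outside Bff are
   irrelevant. *)
Definition sign_choice (eps : R2 -> R) : Prop :=
  forall c, Bff c -> is_sign (eps c).

Definition cut (eps : R2 -> R) (c : R2) : set R2 :=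
  [set z | [/\ base z, z 0 0 = c 0 0 & eps c * c 0 1 <= eps c * z 0 1]].

Definition S_ (eps : R2 -> R) : set R2 := base `\` \bigcup_(c in Bff) cut eps c.

(* For a faithful semitoric system the index set is finite: it consists of
   images of isolated fixed points in one fiber of J. *)
Definition j_ (eps : R2 -> R) (z : R2) : R :=
  \sum_(c \in [set c | Bff c /\ cut eps c z]) eps c.

Definition shear (s : R) : 'M[R]_2 :=
  \matrix_(i, k) if i == k then 1 else if (i == 1) && (k == 0) then s else 0.

Definition wall_crossing (f : R2 -> R2) (eps : R2 -> R) (sgn : R) (z : R2) : Prop :=
  exists Dl Dr : 'M[R]_2,
    [/\ Dsub (S_ eps) f @ within [set u | S_ eps u /\ u 0 0 < z 0 0] (nbhs z) --> Dl,
        Dsub (S_ eps) f @ within [set u | S_ eps u /\ z 0 0 < u 0 0] (nbhs z) --> Dr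
      & Dl = shear (sgn * j_ eps z) *m Dr].

Definition semitoric_pair (f : R2 -> R2) (eps : R2 -> R) : Prop :=
  [/\ sign_choice eps, cartographic_pair f (S_ eps),
      forall z, base z -> f z 0 0 = z 0 0
    & exists2 sgn : R,
        forall z, S_ eps z -> Num.sg (Dsub (S_ eps) f z 1 1) = sgn
      & forall z, Bwt z ->
          closure (base `&` [set u | u 0 0 < z 0 0]) z ->
          closure (base `&` [set u | z 0 0 < u 0 0]) z ->
          wall_crossing f eps sgn z].

Definition L_group : set (R2 -> R2) :=
  [set l | exists (eta1 eta2 : R) (k : int) (a b : R),
     [/\ is_sign eta1, is_sign eta2
       & l = fun z : R2 => \row_(i < 2)
               if i == 0 then eta1 * z 0 0 + a
               else k%:~R * z 0 0 + eta2 * z 0 1 + b]].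

Definition complexity_one_pair (f : R2 -> R2) (S : set R2) : Prop :=
  exists (l f0 : R2 -> R2) (eps : R2 -> R),
    [/\ L_group l, semitoric_pair f0 eps, f = l \o f0 & S = S_ eps].

Definition complexity_one_images : set (set R2) :=
  [set f @` base | f in [set f | exists S, complexity_one_pair f S]].

End Manifold.

Section Isomorphism.
Context {R : realType}.
Variables (M1 M2 : topologicalType).
Variables (w1 : symplectic4 R M1) (w2 : symplectic4 R M2).

Definition smooth_between (F : M1 -> M2) : Prop :=
  continuous F /\
  forall c d, atlas w1 c -> atlas w2 d ->
    smooth_on (cmap c @` (cdom c `&` F @^-1` cdom d)) (cmap d \o F \o cinv c).

Definition preserves_form (F : M1 -> M2) : Prop :=
  forall p, let c := chart_at w1 p in let d := chart_at w2 (F p) in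
    let T := 'J (cmap d \o F \o cinv c) (cmap c p) in
    omega w1 c (cmap c p) = T *m omega w2 d (cmap d (F p)) *m T^T.

End Isomorphism.

Definition symplectomorphism (R : realType) (M1 M2 : topologicalType)
    (w1 : symplectic4 R M1) (w2 : symplectic4 R M2) (F : M1 -> M2) : Prop :=
  [/\ smooth_between w1 w2 F, preserves_form w1 w2 F
    & exists G : M2 -> M1,
        [/\ cancel F G, cancel G F & smooth_between w2 w1 G]].

Definition isomorphic_systems (R : realType) (M1 M2 : topologicalType)
    (w1 : symplectic4 R M1) (w2 : symplectic4 R M2)
    (Phi1 : M1 -> 'rV[R]_2) (Phi2 : M2 -> 'rV[R]_2) : Prop :=
  exists (F : M1 -> M2) (psi : 'rV[R]_2 -> 'rV[R]_2),
    [/\ symplectomorphism w1 w2 F,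
        smooth_emb (base Phi1) psi, psi @` base Phi1 = base Phi2
      & forall p, Phi2 (F p) = psi (Phi1 p)].

(* Main.v *)
Require Import Defs.
From HB Require Import structures.
From mathcomp Require Import all_boot all_order all_algebra.
From mathcomp Require Import all_classical all_reals all_analysis.
From mathcomp Require Import ring lra.
Set Implicit Arguments.
Unset Strict Implicit.
Unset Printing Implicit Defensive.
Import Order.TTheory GRing.Theory Num.Theory.
Import numFieldNormedType.Exports.
Local Open Scope classical_set_scope.
Local Open Scope ring_scope.

(* Let (F, psi) be an isomorphism.  Near a focus-focus point p, J1 and J' := J2 \o F
   both generate effective circle actions, they Poisson commute, and both vector
   fields vanish at p.  The linearization of either flow at p lies in the focus-focus
   Cartan subalgebra; being periodic and effective, it is the rotation by s t with
   s = 1 or s = -1.  Hence for a suitable sign eta the maps tau_t := rho'_t rho_(- eta t)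
   fix p with derivative 1.  For t = 2 pi / n they have finite order, and a map of finite
   order of a connected manifold with a fixed point where its derivative is 1 is the
   identity; letting n tend to infinity, X_(J') = eta X_(J1), so J' = eta J1 + a.  Thus
   psi = (eta x + a, psi2), where d psi2 / dy has a constant sign sigma, and psi maps the
   cut of c in the direction eps to the cut of psi(c) in the direction sigma eps.  If f
   is the map of a semitoric cartographic pair of the first system, then
   (x, y) |-> (eta x + a, y) composed with f \o psi^-1 is the map of one of the second,
   and the correction (x, y) |-> (eta x + a, y) belongs to L. *)

(** * Calculus in finite-dimensional normed spaces *)

(** The focus-focus point pins down the first coordinate: among the elements of its Cartan
    subalgebra only two, opposite to each other, generate effective circle actions of period 2 pi,
    because the second generator is hyperbolic; an elliptic-elliptic subalgebra contains infinitely
    many. Averaging a chart over a circle would require integrals with parameters; at the times 2 pi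
    / n the group generated by tau_t is finite and a finite sum suffices, and these times still
    accumulate at 0, which is enough to compare the two velocities. That tau_t has finite order uses
    that the flows commute: J' is locally a function of Phi1, so it Poisson commutes with J1. The
    base need not be open in the plane: derivatives on it are read off local extensions and are well
    defined because Phi is a submersion on a dense set. Under psi a factor sigma appears both in
    sgn(f) and in j, so their product in (C2) is unchanged. If eta = -1, left and right limits are
    exchanged, and conjugation of the shear by the reflection compensates this. *)

Section Lines.
Context {R : realType}.
Implicit Types V W : normedModType R.

Lemma growth_rate_line V W (f : V -> W) (x v : V) (t : R) :
  (fun h : R => h^-1 *: (((fun h : R => f (x + h *: v)) \o shift t) (h *: (1 : R)) -
     f (x + t *: v))) =
  (fun h : R => h^-1 *: ((f \o shift (x + t *: v)) (h *: v) - f (x + t *: v))).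
Proof.
by apply/funext => h /=; rewrite [h *: (1 : R)]mulr1 scalerDl addrCA.
Qed.

Lemma derive_line V W (f : V -> W) (x v : V) (t : R) :
  'D_1 (fun h : R => f (x + h *: v)) t = 'D_v f (x + t *: v).
Proof. by rewrite /derive growth_rate_line. Qed.

Lemma derivable_line V W (f : V -> W) (x v : V) (t : R) :
  derivable (fun h : R => f (x + h *: v)) t 1 <-> derivable f (x + t *: v) v.
Proof. by rewrite /derivable growth_rate_line. Qed.

(** Only the derivative in the direction [v] is assumed to exist. For [a] nonzero the difference
    quotient along [a *: v] is [a] times the quotient along [v] at [h * a], and [h * a] tends to 0
    in the punctured sense. *)
Lemma is_derive_scale V W (f : V -> W) (x v : V) (a : R) :
  derivable f x v -> is_derive x (a *: v) f (a *: 'D_v f x).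
Proof.
have [->|a0] := eqVneq a 0; first by move=> _; rewrite !scale0r; exact: is_derive0.
move=> fd; have cv : (h^-1 *: ((f \o shift x) (h *: v) - f x) @[h --> 0^'] --> 'D_v f x).
  exact: fd.
suff cv' : (h^-1 *: ((f \o shift x) (h *: (a *: v)) - f x) @[h --> 0^'] --> a *: 'D_v f x).
  split; first by apply/cvg_ex; exists (a *: 'D_v f x).
  exact: cvg_lim cv'.
have sc : (fun h : R => h * a) @ 0^' --> 0^'.
  move=> A [e /= e0 eA]; exists (e / `|a|) => /=; first by rewrite divr_gt0 ?normr_gt0.
  move=> h /=; rewrite sub0r normrN ltr_pdivlMr ?normr_gt0// => hlt h0.
  apply: eA => /=; first by rewrite sub0r normrN normrM.
  by rewrite mulf_neq0.
pose q (h : R) := h^-1 *: ((f \o shift x) (h *: v) - f x).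
have cv2 : a *: q h @[h --> 0^'] --> a *: 'D_v f x by apply: cvgZl_tmp; exact: cv.
have := @cvg_comp _ _ _ (fun h : R => h * a) (fun h => a *: q h) _ _ _ sc cv2.
apply: cvg_trans; apply: near_eq_cvg; near=> h.
by rewrite /= /q scalerA invfM mulrCA mulfV// mulr1 scalerA.
Unshelve. all: by end_near. Qed.

Lemma line_MVT V (f : V -> R) (x v : V) :
  (forall s : R, 0 <= s <= 1 -> derivable f (x + s *: v) v) ->
  exists2 s : R, 0 <= s <= 1 & f (x + v) - f x = 'D_v f (x + s *: v).
Proof.
move=> fd; pose g (h : R) := f (x + h *: v).
have gd (t : R) : 0 <= t <= 1 -> is_derive t 1 g ('D_v f (x + t *: v)).
  by move=> t01; split; [apply/derivable_line; exact: fd | exact: derive_line].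
have := @MVT_segment R g (fun t => 'D_v f (x + t *: v)) 0 1 ler01.
case.
- move=> t; rewrite in_itv /= => /andP[t0 t1]; apply: gd; rewrite !ltW//.
- apply: derivable_within_continuous => t; rewrite in_itv /= => t01.
  exact: (@ex_derive _ _ _ _ _ _ _ (gd t t01)).
- move=> c; rewrite in_itv /= => c01; rewrite subr0 mulr1 /g scale1r scale0r addr0.
  by exists c.
Qed.


(** The family [e] is only spanning, with continuous coordinate forms [l]. This reduces
    vector-valued statements to scalar ones and lets numbers, matrices and products such as time
    times space be treated alike. *)
Class findim (V : normedModType R) : Prop := findimP :
  exists (n : nat) (e : 'I_n -> V) (l : 'I_n -> V -> R),
    [/\ forall i, continuous (l i), forall i, linear (l i : V -> R)
      & forall v, v = \sum_i l i v *: e i].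

#[local] Instance findim_R : findim R.
Proof.
exists 1%N, (fun=> 1), (fun=> id); split=> [i x //|//|v].
by rewrite big_ord1 /=; apply/esym; exact: mulr1.
Qed.

#[local] Instance findim_mx m n : findim 'M[R]_(m, n).
Proof.
pose f (k : 'I_(#|{: 'I_m * 'I_n}|)) := enum_val k.
exists #|{: 'I_m * 'I_n}|, (fun k => delta_mx (f k).1 (f k).2),
  (fun k (M : 'M[R]_(m, n)) => M (f k).1 (f k).2).
split=> [k|k a M N|M]; [exact: coord_continuous|by rewrite !mxE|].
rewrite [LHS]matrix_sum_delta pair_big /=.
rewrite [LHS](reindex f) /=; first by apply: eq_bigr.
by apply: onW_bij; exact: enum_val_bij.
Qed.

#[local] Instance findim_prod V W (fV : findim V) (fW : findim W) :
  findim (V * W)%type.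
Proof.
move: fV fW => [n [e [l [lc ll le]]]] [m [e' [l' [lc' ll' le']]]].
exists (n + m)%N,
  (fun k : 'I_(n + m) => match fintype.split k with inl i => (e i, 0) | inr j => (0, e' j) end),
  (fun (k : 'I_(n + m)) (z : V * W) => match fintype.split k with inl i => l i z.1 | inr j => l' j z.2 end).
split=> [k|k a x y|[v w]].
- case: (fintype.split k) => i /= z.
    by apply: (@continuous_comp _ _ _ fst); [exact: cvg_fst|exact: lc].
  by apply: (@continuous_comp _ _ _ snd); [exact: cvg_snd|exact: lc'].
- by case: (fintype.split k) => i /=; [rewrite ll|rewrite ll'].
have fst_sum I (r : seq I) (F : I -> V * W) :
    (\sum_(j <- r) F j).1 = \sum_(j <- r) (F j).1.
  by elim/big_rec2 : _ => //= j a b _ <-.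
have snd_sum I (r : seq I) (F : I -> V * W) :
    (\sum_(j <- r) F j).2 = \sum_(j <- r) (F j).2.
  by elim/big_rec2 : _ => //= j a b _ <-.
apply: injective_projections; rewrite ?fst_sum ?snd_sum big_split_ord /=.
  under eq_bigr => i _ do rewrite (unsplitK (inl i)) /=.
  under [X in _ + X]eq_bigr => i _ do rewrite (unsplitK (inr i)) /= scaler0.
  by rewrite sumr_const mul0rn addr0.
under eq_bigr => i _ do rewrite (unsplitK (inl i)) /= scaler0.
under [X in _ + X]eq_bigr => i _ do rewrite (unsplitK (inr i)) /=.
by rewrite sumr_const mul0rn add0r.
Qed.

Lemma cvg_sumr V (I T : Type) (r : seq I) (P : pred I) (F : set_system T)
    (f : I -> T -> V) (a : I -> V) : Filter F ->
  (forall i, P i -> f i x @[x --> F] --> a i) ->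
  \sum_(i <- r | P i) f i x @[x --> F] --> \sum_(i <- r | P i) a i.
Proof. by move=> FF; apply: cvg_big; exact: add_continuous. Qed.

Lemma linear_differentiableP V W (f : V -> W) (x : V) (df : {linear V -> W}) :
  continuous df ->
  (forall e : R, 0 < e ->
     \forall h \near (0 : V), `|f (x + h) - f x - df h| <= e * `|h|) ->
  differentiable f x.
Proof.
move=> dfc fx.
have fE : f \o shift x = cst (f x) + df +o_ 0 id.
  apply/eqaddoP => e e0; near=> h; rewrite /= opprD.
  rewrite -![(_ + _ : _ -> _) _]/(_ + _) -![(- _ : _ -> _) _]/(- _) /= addrA addrC.
  rewrite -/(cst (f x) h) addrC [h + x]addrC; near: h; exact: fx.
by apply/diff_locallyP; rewrite (diff_unique dfc fE).
Unshelve. all: by end_near. Qed.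

(** The increment from [x] to [x + h] is split into steps along the [e i]; the mean value theorem on
    each step gives a partial derivative at a point near [x], and continuity of the partial
    derivatives controls the error. *)
Lemma C1_differentiable_scalar V (fV : findim V) (U : set V) (f : V -> R) (x : V) :
  nbhs x U -> (forall y v, U y -> derivable f y v) ->
  (forall v, {for x, continuous ('D_v f)}) -> differentiable f x.
Proof.
case: fV => n [e [l [lc ll le]]] Ux fd fc.
have [C C0 lC] : exists2 C : R, 0 < C & forall i h, `|l i h| <= C * `|h|.
  have /choice[c cP] i : exists c : R, 0 < c /\ forall h, `|l i h| <= c * `|h|.
    pose L : {linear V -> R} := HB.pack (l i) (GRing.isLinear.Build _ _ _ _ _ (ll i)).
    by have [c c0 cP] := @linear_lipschitz R V R L (lc i); exists c.
  exists (1 + \sum_i c i).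
    by rewrite ltr_pwDl// sumr_ge0// => i _; case: (cP i) => /ltW.
  move=> i h; have [ci /(_ h)/le_trans] := cP i; apply.
  apply: ler_wpM2r => //; rewrite (bigD1 i)//= addrCA lerDl addr_ge0//.
  by rewrite sumr_ge0// => j _; case: (cP j) => /ltW.
pose D (h : V) := \sum_i l i h * 'D_(e i) f x.
have D_lin : linear (D : V -> R).
  move=> a u v; rewrite /D scaler_sumr -big_split/=; apply: eq_bigr => i _.
  by rewrite ll mulrDl -scalerAl.
pose df : {linear V -> R} := HB.pack D (GRing.isLinear.Build _ _ _ _ _ D_lin).
apply: (@linear_differentiableP _ _ _ _ df).
  by move=> y; apply: cvg_sumr => i _; apply: cvgM; [exact: lc|exact: cvg_cst].
pose K := C * \sum_i `|e i|.
have K0 : 0 <= K by rewrite mulr_ge0 ?sumr_ge0// ltW.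
(* Each of the [n] steps will cost [C * |h| * eps'], so this choice makes the total at most
   [eps * |h|]; the 1 keeps the denominator positive when [n] is 0. *)
move=> eps eps0; pose eps' := eps / (1 + C *+ n).
have eps'0 : 0 < eps' by rewrite divr_gt0// ltr_pwDl// mulrn_wge0// ltW.
have [r r0 rP] : exists2 r : R, 0 < r & forall y, `|y - x| < r ->
    U y /\ forall i, `|'D_(e i) f y - 'D_(e i) f x| <= eps'.
  have : \forall y \near x, U y /\ forall i, `|'D_(e i) f y - 'D_(e i) f x| <= eps'.
    apply: filterS2 Ux _ => [y Uy H|]; first by split; [exact: Uy|exact: H].
    apply: filter_forall => i; have /cvgrPdist_le/(_ _ eps'0) := fc (e i).
    by apply: filterS => y; rewrite distrC.
  by case/nbhs_ballP => r /= r0 rP; exists r => // y yr; apply: rP; rewrite -ball_normE /= distrC.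
apply/nbhs_ballP; exists (r / (1 + K)) => /=; first by rewrite divr_gt0// ltr_pwDl.
move=> h; rewrite -ball_normE /= sub0r normrN ltr_pdivlMr ?ltr_pwDl// => hr.
(* Vertices of the path from 0 to [h] that moves along one coordinate at a time; [SK] keeps every
   segment inside the ball where the derivatives are close. *)
pose S k := \sum_(i < n | (i < k)%N) l i h *: e i.
have SS (k : 'I_n) : S k.+1 = S k + l k h *: e k.
  rewrite /S (bigD1 k) ?ltnS//= addrC; congr (_ + _).
  by apply: eq_bigl => i; rewrite ltnS ltn_neqAle andbC -(inj_eq val_inj).
have Sn : S n = h by rewrite [RHS]le; apply: eq_bigl => i; rewrite ltn_ord.
have S0 : S 0%N = 0 by rewrite /S big_pred0.
have SK (k : 'I_n) (s : R) : 0 <= s <= 1 -> `|S k + s *: (l k h *: e k)| <= K * `|h|.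
  move=> /andP[s0 s1]; apply: le_trans (ler_normD _ _) _.
  apply: (@le_trans _ _ (\sum_(i < n | (i < k.+1)%N) `|l i h *: e i|)).
    rewrite [leRHS](bigD1 k) ?ltnS//= addrC; apply: lerD; last first.
      by rewrite normrZ ger0_norm// ler_piMl.
    apply: le_trans (ler_norm_sum _ _ _) _; rewrite le_eqVlt; apply/orP; left; apply/eqP.
    by apply: eq_bigl => i; rewrite ltnS [in RHS]andbC -(inj_eq val_inj) -ltn_neqAle.
  rewrite /K -mulrA mulrCA mulr_suml big_mkcond /=; apply: ler_sum => i _.
  case: ifP => _; first by rewrite normrZ mulrC ler_wpM2l.
  by rewrite mulr_ge0// mulr_ge0// ltW.
have step (k : 'I_n) :
    `|f (x + S k.+1) - f (x + S k) - l k h * 'D_(e k) f x| <= C * `|h| * eps'.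
  have near_x (s : R) : 0 <= s <= 1 -> `|x + S k + s *: (l k h *: e k) - x| < r.
    move=> s01; rewrite -[x + _ + _]addrA [x + _]addrC addrK; apply: le_lt_trans (SK k s s01) _.
    by apply: le_lt_trans hr; rewrite mulrC ler_wpM2l// lerDr.
  rewrite SS addrA; have [s s01|s s01 ->] := @line_MVT V f (x + S k) (l k h *: e k).
    by apply: fd; have [] := rP _ (near_x s s01).
  have [Uy /(_ k) yk] := rP _ (near_x s s01).
  have [_ ->] := is_derive_scale (l k h) (fd _ (e k) Uy).
  by rewrite -[_ *: _]/(_ * _) -mulrBr normrM ler_pM.
have -> : f (x + h) - f x - df h =
    \sum_(k < n) (f (x + S k.+1) - f (x + S k) - l k h * 'D_(e k) f x).
  rewrite sumrB -(big_mkord xpredT (fun k => f (x + S k.+1) - f (x + S k))).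
  by rewrite (telescope_sumr (fun k => f (x + S k)))// Sn S0 addr0.
apply: le_trans (ler_norm_sum _ _ _) _.
apply: le_trans (ler_sum _ (fun k _ => step k)) _.
have Cn : 0 < 1 + C *+ n by rewrite ltr_pwDl// mulrn_wge0// ltW.
have -> : \sum_(k < n) C * `|h| * eps' = C *+ n * eps' * `|h|.
  by rewrite sumr_const card_ord -!mulrnAl mulrAC.
by rewrite ler_wpM2r// mulrCA ger_pMr// ler_pdivrMr// mul1r lerDr.
Qed.

(** [f] is only derivable along [v], so the chain rule for differentials does not apply to it
    directly; on the line through [x] it becomes a curve, for which derivable and differentiable
    agree. *)
Lemma is_derive_comp V W W' (f : V -> W) (g : W -> W') (x v : V) :
  derivable f x v -> differentiable g (f x) ->
  is_derive x v (g \o f) ('D_('D_v f x) g (f x)).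
Proof.
move=> fd gd; pose p (h : R) := f (x + h *: v).
have px : p 0 = f x by rewrite /p scale0r addr0.
have pd : derivable p 0 1 by apply/derivable_line; rewrite scale0r addr0.
have pdiff : differentiable p 0 by apply/derivable1_diffP.
have gp : differentiable (g \o p) 0 by apply: differentiable_comp => //; rewrite px.
have gp' : derivable (g \o p) 0 1 by apply: diff_derivable.
have -> : 'D_('D_v f x) g (f x) = 'D_1 (g \o p) 0.
  rewrite [RHS]deriveE// diff_comp//= ?px//.
  rewrite -[X in 'd g (f x) X]deriveE// derive_line scale0r addr0.
  by rewrite -deriveE.
have dl := derivable_line (g \o f) x v 0; have := derive_line (g \o f) x v 0.
rewrite scale0r addr0 in dl; rewrite scale0r addr0 => E.
by split; [exact/dl|exact/esym/E].
Qed.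

Lemma is_derive_lin V W W' (f : V -> W) (L : W -> W') (x v : V) :
  linear L -> continuous L -> derivable f x v ->
  is_derive x v (L \o f) (L ('D_v f x)).
Proof.
move=> Ll Lc fd; pose l : {linear W -> W'} := HB.pack L (GRing.isLinear.Build _ _ _ _ _ Ll).
have ld := @linear_differentiable _ _ _ l (f x) Lc.
by have := is_derive_comp fd ld; rewrite [X in is_derive _ _ _ X](deriveE _ ld) diff_lin.
Qed.

Lemma continuous_near_eq (T : topologicalType) V (f g : T -> V) x : (\forall y \near x, f y = g y) ->
  {for x, continuous f} -> {for x, continuous g}.
Proof.
move=> fg; rewrite /prop_for /continuous_at (nbhs_singleton fg); apply: cvg_trans.
exact: near_eq_cvg.
Qed.

Lemma C1_differentiable V W (fV : findim V) (fW : findim W) (U : set V)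
    (f : V -> W) (x : V) :
  nbhs x U -> (forall y v, U y -> derivable f y v) ->
  (forall v, {for x, continuous ('D_v f)}) -> differentiable f x.
Proof.
case: fW => n [e [l [lc ll le]]] Ux fd fc.
have -> : f = \sum_(i < n) (fun y => (l i \o f) y *: e i).
  by apply/funext => y; rewrite fct_sumE; exact: le.
apply: differentiable_sum => i; apply: differentiableZl.
apply: (C1_differentiable_scalar fV Ux) => [y v Uy|v].
  by have [] := is_derive_lin (ll i) (lc i) (fd y v Uy).
apply: (@continuous_near_eq _ _ (fun y => l i ('D_v f y))).
  apply: filterS Ux => y Uy; apply/esym.
  by have [_] := is_derive_lin (ll i) (lc i) (fd y v Uy).
by apply: continuous_comp; [exact: fc|exact: lc].
Qed.

(** Smoothness graded by order. The product and chain rules bring back the functions next to their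
    derivatives, so closure properties go by induction on the order with the functions generalized,
    rather than on the list of directions in [iter_derive]. *)
Fixpoint Ck (k : nat) V W (U : set V) (f : V -> W) : Prop :=
  (forall x, U x -> {for x, continuous f} /\ forall v, derivable f x v) /\
  if k is k'.+1 then forall v, Ck k' U ('D_v f) else True.

Lemma iter_derive_rcons V W (vs : seq V) v (f : V -> W) :
  iter_derive (rcons vs v) f = iter_derive vs ('D_v f).
Proof. by rewrite /iter_derive foldr_rcons. Qed.

Lemma smooth_onP V W (U : set V) (f : V -> W) :
  smooth_on U f <-> forall k, Ck k U f.
Proof.
split=> [Uf k|].
  elim: k f Uf => [|k IH] f Uf; split => //; try by move=> x /(Uf [::]).
  by move=> v; apply: IH => vs x /(Uf (rcons vs v)); rewrite iter_derive_rcons.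
move=> Uf vs; elim/last_ind: vs f Uf => [|vs v IH] f Uf x Ux.
  by have [/(_ _ Ux)] := Uf 0%N.
rewrite iter_derive_rcons; apply: IH => // k.
by have [_ /(_ v)] := Uf k.+1.
Qed.

Lemma CkS k V W (U : set V) (f : V -> W) : Ck k.+1 U f -> Ck k U f.
Proof.
elim: k f => [|k IH] f [fU fD]; split => //= v; exact: IH.
Qed.

(** * Closure properties of smooth functions *)

Section Closure.
Variables (V : normedModType R) (U : set V).
Hypothesis Uo : open U.

Lemma Ck_ext W k (f g : V -> W) : (forall x, U x -> f x = g x) -> Ck k U f -> Ck k U g.
Proof.
have near_U x : U x -> \forall y \near x, U y by move=> Ux; exact: open_nbhs_nbhs.
elim: k f g => [|k IH] f g fg [fU fD]; split => //.
- move=> x Ux; have fgx : \forall y \near x, f y = g y by near=> y; apply: fg; near: y; exact: near_U.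
  have [fc fd] := fU x Ux; split; first exact: continuous_near_eq fc.
  by move=> v; apply: near_eq_derivable (fd v).
- move=> x Ux; have fgx : \forall y \near x, f y = g y by near=> y; apply: fg; near: y; exact: near_U.
  have [fc fd] := fU x Ux; split; first exact: continuous_near_eq fc.
  by move=> v; apply: near_eq_derivable (fd v).
move=> v; apply: (IH ('D_v f)); last exact: fD.
by move=> x Ux; apply: near_eq_derive; near=> y; apply: fg; near: y; exact: near_U.
Unshelve. all: by end_near. Qed.

Lemma Ck_lin W W' k (L : W -> W') (f : V -> W) :
  linear L -> continuous L -> Ck k U f -> Ck k U (L \o f).
Proof.
move=> Ll Lc.
have base (g : V -> W) x : U x -> {for x, continuous g} -> (forall v, derivable g x v) ->
    {for x, continuous (L \o g)} /\ forall v, derivable (L \o g) x v.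
  move=> Ux gc gd; split; first by apply: continuous_comp gc _; exact: Lc.
  by move=> v; have [] := is_derive_lin Ll Lc (gd v).
elim: k f => [|k IH] f [fU fD]; split => //; try by move=> x Ux; have [] := fU x Ux; exact: base.
move=> v; apply: Ck_ext (IH _ (fD v)) => x Ux /=.
by have [_ /(_ v) fd] := fU x Ux; have [_] := is_derive_lin Ll Lc fd.
Qed.

Lemma Ck_cst W k (c : W) : Ck k U (fun=> c).
Proof.
have base x : {for x, continuous (fun=> c : W)} /\ forall v : V, derivable (fun=> c : W) x v.
  by split=> [|v]; [exact: cvg_cst|exact: derivable_cst].
elim: k c base => [|k IH] c base; split=> //.
move=> v; have base0 x : {for x, continuous (fun=> 0 : W)} /\ forall u : V, derivable (fun=> 0 : W) x u.
  by split=> [|u]; [exact: cvg_cst|exact: derivable_cst].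
by apply: Ck_ext (IH 0 base0) => x _; rewrite derive_cst.
Qed.

Lemma Ck_add W k (f g : V -> W) : Ck k U f -> Ck k U g -> Ck k U (f \+ g).
Proof.
have base (f1 g1 : V -> W) x : {for x, continuous f1} /\ (forall v, derivable f1 x v) ->
    {for x, continuous g1} /\ (forall v, derivable g1 x v) ->
    {for x, continuous (f1 \+ g1)} /\ forall v, derivable (f1 \+ g1) x v.
  by move=> [fc fd] [gc gd]; split=> [|v]; [exact: continuousD|exact: derivableD].
elim: k f g => [|k IH] f g [fU fD] [gU gD]; split => //; try by move=> x Ux; apply: base; [exact: fU|exact: gU].
move=> v; apply: Ck_ext (IH _ _ (fD v) (gD v)) => x Ux /=.
by have [_ fd] := fU x Ux; have [_ gd] := gU x Ux; rewrite -deriveD.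
Qed.

Lemma Ck_mul k (f g : V -> R) : Ck k U f -> Ck k U g -> Ck k U (f \* g).
Proof.
have base (f1 g1 : V -> R) x : {for x, continuous f1} /\ (forall v, derivable f1 x v) ->
    {for x, continuous g1} /\ (forall v, derivable g1 x v) ->
    {for x, continuous (f1 \* g1)} /\ forall v, derivable (f1 \* g1) x v.
  by move=> [fc fd] [gc gd]; split=> [|v]; [exact: continuousM|exact: derivableM].
elim: k f g => [|k IH] f g Uf Ug.
  by have [fU _] := Uf; have [gU _] := Ug; split; last by []; move=> x Ux; apply: base; [exact: fU|exact: gU].
have [fU fD] := Uf; have [gU gD] := Ug.
split; first by move=> x Ux; apply: base; [exact: fU|exact: gU].
move=> v; apply: (Ck_ext _ (Ck_add (IH _ _ (CkS Uf) (gD v)) (IH _ _ (CkS Ug) (fD v)))) => x Ux /=.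
by have [_ fd] := fU x Ux; have [_ gd] := gU x Ux; rewrite deriveM; [|exact: fd|exact: gd].
Qed.

Lemma Ck_inv k (f : V -> R) : (forall x, U x -> f x != 0) ->
  Ck k U f -> Ck k U (fun x => (f x)^-1).
Proof.
move=> f0.
have base (f1 : V -> R) x : f1 x != 0 -> {for x, continuous f1} /\ (forall v, derivable f1 x v) ->
    {for x, continuous (fun y => (f1 y)^-1)} /\ forall v, derivable (fun y => (f1 y)^-1) x v.
  by move=> f10 [fc fd]; split=> [|v]; [exact: continuousV|exact: derivableV].
elim: k => [|k IH] Uf.
  by have [fU _] := Uf; split; last by []; move=> x Ux; apply: base; [exact: f0|exact: fU].
have [fU fD] := Uf; split; first by move=> x Ux; apply: base; [exact: f0|exact: fU].
move=> v; have IV := IH (CkS Uf).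
apply: (Ck_ext _ (Ck_mul (@Ck_cst R k (-1)) (Ck_mul (Ck_mul IV IV) (fD v)))) => x Ux /=.
have [_ fd] := fU x Ux; rewrite deriveV; [|exact: f0|exact: fd].
rewrite -[RHS]/(_ * _).
by rewrite -exprVn expr2 mulN1r mulNr.
Qed.

End Closure.

Lemma derive_dirD V W (f : V -> W) x u v : differentiable f x ->
  'D_(u + v) f x = 'D_u f x + 'D_v f x.
Proof. by move=> fx; rewrite !deriveE// linearD. Qed.

Lemma derive_dirZ V W (f : V -> W) x a v : differentiable f x ->
  'D_(a *: v) f x = a *: 'D_v f x.
Proof. by move=> fx; rewrite !deriveE// linearZ. Qed.

Lemma derive_dirN V W (f : V -> W) x v : differentiable f x ->
  'D_(- v) f x = - 'D_v f x.
Proof. by move=> fx; rewrite !deriveE// linearN. Qed.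

Lemma derive_dir_sum V W (f : V -> W) x (I : Type) (r : seq I) (a : I -> R) (e : I -> V) :
  differentiable f x ->
  'D_(\sum_(i <- r) a i *: e i) f x = \sum_(i <- r) a i *: 'D_(e i) f x.
Proof.
move=> fx; rewrite deriveE// linear_sum; apply: eq_bigr => i _.
by rewrite linearZ deriveE.
Qed.

Lemma smooth_on_sub V W (U U' : set V) (f : V -> W) :
  U' `<=` U -> smooth_on U f -> smooth_on U' f.
Proof. by move=> UU Uf vs x /UU; exact: Uf. Qed.

Lemma smooth_on_derivable V W (U : set V) (f : V -> W) x v :
  smooth_on U f -> U x -> derivable f x v.
Proof. by move=> Uf /(Uf [::])[_]. Qed.

Lemma smooth_on_continuous V W (U : set V) (f : V -> W) x :
  smooth_on U f -> U x -> {for x, continuous f}.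
Proof. by move=> Uf /(Uf [::])[]. Qed.

Lemma smooth_on_derive V W (U : set V) (f : V -> W) v :
  smooth_on U f -> smooth_on U ('D_v f).
Proof. by move=> Uf vs x Ux; rewrite -iter_derive_rcons; exact: Uf. Qed.

Section SmoothOn.
Variables (V : normedModType R) (U : set V).
Hypothesis Uo : open U.

Lemma smooth_on_differentiable W (fV : findim V) (fW : findim W) (f : V -> W) x :
  smooth_on U f -> U x -> differentiable f x.
Proof.
move=> Uf Ux; apply: (@C1_differentiable V W _ _ U).
- exact: open_nbhs_nbhs.
- by move=> y v; exact: smooth_on_derivable.
- by move=> v; apply: smooth_on_continuous Ux; exact: smooth_on_derive.
Qed.

Lemma Ck_sum W k (I : Type) (r : seq I) (F : I -> V -> W) :
  (forall i, Ck k U (F i)) -> Ck k U (fun x => \sum_(i <- r) F i x).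
Proof.
move=> FU; elim: r => [|i r IH].
  by apply: (Ck_ext Uo _ (Ck_cst Uo k 0)) => x _; rewrite big_nil.
by apply: (Ck_ext Uo _ (Ck_add Uo (FU i) IH)) => x _; rewrite big_cons.
Qed.

(** In coordinates, the derivative of [g \o f] along [v] is the sum of the products of
    [l i ('D_v f)] with the compositions of ['D_(e i) g] and [f]; the latter are covered by the
    induction hypothesis because [g] varies and is smooth to all orders. *)
Lemma Ck_comp V' (fV' : findim V') k (U' : set V') (f : V -> V') (g : V' -> R) :
  open U' -> (forall x, U x -> U' (f x)) ->
  smooth_on U' g -> Ck k U f -> Ck k U (g \o f).
Proof.
move=> U'o UU'.
have base (g1 : V' -> R) : smooth_on U' g1 -> forall x, U x ->
    {for x, continuous f} /\ (forall v, derivable f x v) ->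
    {for x, continuous (g1 \o f)} /\ forall v, derivable (g1 \o f) x v.
  move=> g1U x Ux [fc fd]; split.
    by apply: continuous_comp fc _; apply: smooth_on_continuous g1U _; exact: UU'.
  move=> v; have g1d : differentiable g1 (f x).
    by apply: (@C1_differentiable V' R _ _ U');
      [apply: open_nbhs_nbhs; split => //; exact: UU'|move=> y w; exact: smooth_on_derivable
      |move=> w; apply: smooth_on_continuous (UU' _ Ux); exact: smooth_on_derive].
  by have [] := is_derive_comp (fd v) g1d.
elim: k g => [|k IH] g Ug Uf.
  by have [fU _] := Uf; split; last by []; move=> x Ux; apply: base => //; exact: fU.
have [fU fD] := Uf; split; first by move=> x Ux; apply: base => //; exact: fU.
move=> v; have [n [e [l [lc ll le]]]] := fV'.
have Cki i : Ck k U ((l i \o 'D_v f) \* ('D_(e i) g \o f)).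
  apply: Ck_mul => //; first by apply: Ck_lin => //; exact: fD.
  by apply: IH; [exact: smooth_on_derive|exact: CkS].
apply: (Ck_ext Uo _ (Ck_sum (index_enum 'I_n) Cki)) => x Ux.
have gd : differentiable g (f x).
  by apply: (@C1_differentiable V' R _ _ U');
    [apply: open_nbhs_nbhs; split => //; exact: UU'|move=> y w; exact: smooth_on_derivable
    |move=> w; apply: smooth_on_continuous (UU' _ Ux); exact: smooth_on_derive].
have [_ /(_ v) fd] := fU x Ux; have [_ ->] := is_derive_comp fd gd.
by rewrite [in RHS](le ('D_v f x)) derive_dir_sum.
Qed.

Lemma smooth_on_ext W (f g : V -> W) :
  (forall x, U x -> f x = g x) -> smooth_on U f -> smooth_on U g.
Proof. by move=> fg /smooth_onP Uf; apply/smooth_onP => k; exact: Ck_ext (Uf k). Qed.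

Lemma smooth_on_lin W W' (L : W -> W') (f : V -> W) :
  linear L -> continuous L -> smooth_on U f -> smooth_on U (L \o f).
Proof. by move=> Ll Lc /smooth_onP Uf; apply/smooth_onP => k; exact: Ck_lin. Qed.

Lemma smooth_on_cst W (c : W) : smooth_on U (fun=> c).
Proof. by apply/smooth_onP => k; exact: Ck_cst. Qed.

Lemma smooth_on_id : smooth_on U id.
Proof.
apply/smooth_onP; case=> [|k]; split => //; try by
  move=> x _; split=> [|v]; [exact: cvg_id|exact: derivable_id].
by move=> v; apply: (Ck_ext Uo _ (Ck_cst Uo k v)) => x _; rewrite derive_id.
Qed.

Lemma smooth_on_add W (f g : V -> W) :
  smooth_on U f -> smooth_on U g -> smooth_on U (fun x => f x + g x).
Proof.
by move=> /smooth_onP Uf /smooth_onP Ug; apply/smooth_onP => k; exact: Ck_add.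
Qed.

Lemma smooth_on_opp W (f : V -> W) : smooth_on U f -> smooth_on U (fun x => - f x).
Proof.
apply: (@smooth_on_lin _ _ (fun y => - y)) => [a x y|]; last exact: opp_continuous.
by rewrite opprD scalerN.
Qed.

Lemma smooth_on_sub_fun W (f g : V -> W) :
  smooth_on U f -> smooth_on U g -> smooth_on U (fun x => f x - g x).
Proof. by move=> Uf Ug; apply: smooth_on_add => //; exact: smooth_on_opp. Qed.

Lemma smooth_on_sum W (I : Type) (r : seq I) (F : I -> V -> W) :
  (forall i, smooth_on U (F i)) -> smooth_on U (fun x => \sum_(i <- r) F i x).
Proof.
by move=> FU; apply/smooth_onP => k; apply: Ck_sum => i; move: k; exact/smooth_onP.
Qed.

Lemma smooth_on_mul (f g : V -> R) :
  smooth_on U f -> smooth_on U g -> smooth_on U (fun x => f x * g x).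
Proof.
by move=> /smooth_onP Uf /smooth_onP Ug; apply/smooth_onP => k; exact: Ck_mul.
Qed.

Lemma smooth_on_prod (I : Type) (r : seq I) (F : I -> V -> R) :
  (forall i, smooth_on U (F i)) -> smooth_on U (fun x => \prod_(i <- r) F i x).
Proof.
move=> FU; elim: r => [|i r IH].
  by apply: smooth_on_ext (@smooth_on_cst R 1) => x _; rewrite big_nil.
by apply: (@smooth_on_ext R) (smooth_on_mul (FU i) IH) => x _; rewrite big_cons.
Qed.

Lemma smooth_on_inv (f : V -> R) : (forall x, U x -> f x != 0) ->
  smooth_on U f -> smooth_on U (fun x => (f x)^-1).
Proof.
by move=> f0 /smooth_onP Uf; apply/smooth_onP => k; exact: Ck_inv.
Qed.

Lemma smooth_on_coord W (fW : findim W) (f : V -> W) :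
  (forall l : W -> R, linear l -> continuous l -> smooth_on U (l \o f)) ->
  smooth_on U f.
Proof.
move=> fU; have [n [e [l [lc ll le]]]] := fW.
apply: (smooth_on_ext (f := fun x => \sum_i l i (f x) *: e i)) => [x _|].
  by rewrite -le.
apply: smooth_on_sum => i; apply: (@smooth_on_lin R W (fun a => a *: e i)).
- by move=> a x y; rewrite scalerDl scalerA.
- exact: scalel_continuous.
- exact: fU.
Qed.

Lemma smooth_on_comp V' W (fV' : findim V') (fW : findim W) (U' : set V')
    (f : V -> V') (g : V' -> W) :
  open U' -> (forall x, U x -> U' (f x)) ->
  smooth_on U' g -> smooth_on U f -> smooth_on U (g \o f).
Proof.
move=> U'o UU' Ug Uf; apply: smooth_on_coord => l ll lc; apply/smooth_onP => k.
apply: (Ck_comp (g := l \o g) _ U'o) => //; last by move: k; exact/smooth_onP.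
move: Ug => /smooth_onP Ug; apply/smooth_onP => j; exact: Ck_lin.
Qed.

Lemma smooth_on_pair V1 V2 (f : V -> V1) (g : V -> V2) :
  smooth_on U f -> smooth_on U g -> smooth_on U (fun x => (f x, g x)).
Proof.
move=> Uf Ug.
have l1 : linear (fun y : V1 => (y, 0) : V1 * V2).
  by move=> a x y; apply: injective_projections => //=; rewrite scaler0 addr0.
have l2 : linear (fun y : V2 => (0, y) : V1 * V2).
  by move=> a x y; apply: injective_projections => //=; rewrite scaler0 addr0.
have c1 : continuous (fun y : V1 => (y, 0) : V1 * V2).
  by move=> x; apply: cvg_pair; [exact: cvg_id|exact: cvg_cst].
have c2 : continuous (fun y : V2 => (0, y) : V1 * V2).
  by move=> x; apply: cvg_pair; [exact: cvg_cst|exact: cvg_id].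
apply: smooth_on_ext (smooth_on_add (smooth_on_lin l1 c1 Uf) (smooth_on_lin l2 c2 Ug)).
by move=> x _; apply: injective_projections => /=; rewrite ?addr0 ?add0r.
Qed.

Lemma smooth_on_mx m n (f : V -> 'M[R]_(m, n)) :
  (forall i j, smooth_on U (fun x => f x i j)) -> smooth_on U f.
Proof.
move=> fU; apply: (smooth_on_ext (f := fun x => \sum_i \sum_j f x i j *: delta_mx i j)).
  by move=> x _; rewrite -matrix_sum_delta.
apply: smooth_on_sum => i; apply: smooth_on_sum => j.
apply: (@smooth_on_lin R _ (fun a => a *: delta_mx i j)) => //; last exact: scalel_continuous.
by move=> a x y; rewrite scalerDl scalerA.
Qed.

Lemma smooth_on_entry m n (f : V -> 'M[R]_(m, n)) i j :
  smooth_on U f -> smooth_on U (fun x => f x i j).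
Proof.
apply: (@smooth_on_lin _ _ (fun M : 'M[R]_(m, n) => M i j)); last exact: coord_continuous.
by move=> a M N; rewrite !mxE.
Qed.

Lemma smooth_on_mulmx m n p (f : V -> 'M[R]_(m, n)) (g : V -> 'M[R]_(n, p)) :
  smooth_on U f -> smooth_on U g -> smooth_on U (fun x => f x *m g x).
Proof.
move=> Uf Ug; apply: smooth_on_mx => i j.
apply: (smooth_on_ext (f := fun x => \sum_k f x i k * g x k j)) => [x _|].
  by rewrite mxE.
by apply: smooth_on_sum => k; apply: smooth_on_mul; exact: smooth_on_entry.
Qed.

Lemma smooth_on_trmx m n (f : V -> 'M[R]_(m, n)) :
  smooth_on U f -> smooth_on U (fun x => (f x)^T).
Proof.
move=> Uf; apply: smooth_on_mx => i j.
by apply: (smooth_on_ext (f := fun x => f x j i)) => [x _|]; rewrite ?mxE//; exact: smooth_on_entry.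
Qed.

Lemma smooth_on_det n (f : V -> 'M[R]_n) :
  smooth_on U f -> smooth_on U (fun x => \det (f x)).
Proof.
move=> Uf; apply: smooth_on_sum => s; apply: smooth_on_mul; first exact: smooth_on_cst.
by apply: smooth_on_prod => i; exact: smooth_on_entry.
Qed.

Lemma smooth_on_invmx n (f : V -> 'M[R]_n) : (forall x, U x -> f x \in unitmx) ->
  smooth_on U f -> smooth_on U (fun x => invmx (f x)).
Proof.
move=> fu Uf; apply: smooth_on_mx => i j.
apply: (smooth_on_ext (f := fun x => (\det (f x))^-1 * \adj (f x) i j)) => [x Ux|].
  by rewrite /invmx fu// !mxE.
apply: smooth_on_mul.
  apply: smooth_on_inv; last exact: smooth_on_det.
  by move=> x /fu; rewrite unitmxE unitfE.
apply: (smooth_on_ext (f := fun x => cofactor (f x) j i)) => [x _|]; first by rewrite mxE.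
apply: smooth_on_mul; first exact: smooth_on_cst.
apply: smooth_on_det; apply: smooth_on_mx => a b.
by apply: (smooth_on_ext (f := fun x => f x (lift j a) (lift i b))) => [x _|];
  rewrite ?mxE//; exact: smooth_on_entry.
Qed.

End SmoothOn.

(** * Symmetry of second derivatives and local injectivity *)

Lemma growth_rate_translate V W (f : V -> W) (x u v : V) :
  (fun h : R => h^-1 *: (((fun y => f (y + v)) \o shift x) (h *: u) - f (x + v))) =
  (fun h : R => h^-1 *: ((f \o shift (x + v)) (h *: u) - f (x + v))).
Proof. by apply/funext => h /=; rewrite addrA. Qed.

Lemma derive_translate V W (f : V -> W) (x u v : V) :
  'D_u (fun y => f (y + v)) x = 'D_u f (x + v).
Proof. by rewrite /derive growth_rate_translate. Qed.

Lemma derivable_translate V W (f : V -> W) (x u v : V) :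
  derivable f (x + v) u -> derivable (fun y => f (y + v)) x u.
Proof. by rewrite /derivable growth_rate_translate. Qed.

(** Two applications of the mean value theorem: along [u] to the difference of [f] and its translate
    by [v], then along [v] to ['D_u f]. The second difference on the left is symmetric in [u] and
    [v], which is what equality of the mixed derivatives rests on. *)
Lemma double_difference V (U : set V) (f : V -> R) (x u v : V) : smooth_on U f ->
  (forall a b : R, 0 <= a <= 1 -> 0 <= b <= 1 -> U (x + a *: u + b *: v)) ->
  exists a b : R, [/\ 0 <= a <= 1, 0 <= b <= 1 &
    f (x + u + v) - f (x + u) - (f (x + v) - f x) = 'D_v ('D_u f) (x + a *: u + b *: v)].
Proof.
move=> Uf UU; pose g y := f (y + v) - f y.
have i01 : 0 <= (1 : R) <= 1 by rewrite ler01 lexx.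
have i00 : 0 <= (0 : R) <= 1 by rewrite ler01 lexx.
have fd1 (s : R) : 0 <= s <= 1 -> derivable (fun y => f (y + v)) (x + s *: u) u.
  move=> s01; apply: derivable_translate; apply: smooth_on_derivable Uf _.
  by have := UU s 1 s01 i01; rewrite scale1r.
have fd2 (s : R) : 0 <= s <= 1 -> derivable f (x + s *: u) u.
  by move=> s01; apply: smooth_on_derivable Uf _; have := UU s 0 s01 i00; rewrite scale0r addr0.
have [s s01|a a01 E] := @line_MVT V g x u.
  by apply: derivableB; [exact: fd1|exact: fd2].
rewrite -/(g (x + u)) -/(g x) E.
have -> : 'D_u g (x + a *: u) = 'D_u f (x + a *: u + v) - 'D_u f (x + a *: u).
  rewrite deriveB; [|exact: fd1|exact: fd2].
  by rewrite (derive_translate f).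
have [s s01|b b01 ->] := @line_MVT V ('D_u f) (x + a *: u) v; last by exists a, b.
by apply: smooth_on_derivable (smooth_on_derive u Uf) _; exact: UU.
Qed.

Lemma derive_scale_dir V W (U : set V) (f : V -> W) (x u : V) (t : R) :
  open U -> smooth_on U f -> U x -> 'D_(t *: u) f x = t *: 'D_u f x.
Proof.
move=> Uo Uf Ux.
by have [_ ->] := is_derive_scale t (smooth_on_derivable (v:=u) Uf Ux).
Qed.

(** On a small parallelogram at [x] the same second difference is a value of either mixed
    derivative. If these differed at [x], continuity would keep their values on the parallelogram
    apart. *)
Lemma derive_comm_scalar V (U : set V) (f : V -> R) (x u v : V) :
  open U -> smooth_on U f -> U x -> 'D_u ('D_v f) x = 'D_v ('D_u f) x.
Proof.
have swap (p q s w : R) : p - q - (s - w) = p - s - (q - w) by lra.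
move=> Uo Uf Ux; apply/eqP/negPn/negP => ne.
set A := 'D_u _ _ in ne; set B := 'D_v _ _ in ne.
pose eps := `|A - B| / 2; have e0 : 0 < eps by rewrite divr_gt0// normr_gt0 subr_eq0.
have cont w w' : {for x, continuous ('D_w ('D_w' f))}.
  by apply: smooth_on_continuous Ux; apply: smooth_on_derive; exact: smooth_on_derive.
have near_x : \forall y \near x, [/\ U y, `|A - 'D_u ('D_v f) y| < eps &
    `|B - 'D_v ('D_u f) y| < eps].
  have /cvgrPdist_lt/(_ _ e0) H1 := cont u v; have /cvgrPdist_lt/(_ _ e0) H2 := cont v u.
  apply: filterS3 H1 H2 (open_nbhs_nbhs (conj Uo Ux)) => y h1 h2 Uy.
  by split; [exact: Uy|exact: h1|exact: h2].
have [r /= r0 rP] := (nbhs_ballP _ _).1 near_x.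
(* [t] shrinks the parallelogram spanned by [u] and [v] into the ball; the factor [t * t] that it
   brings in is cancelled before the comparison. *)
have [t t0 tr] : exists2 t : R, 0 < t & t * (`|u| + `|v|) < r.
  have uv0 : 0 < 1 + (`|u| + `|v|) by rewrite ltr_pwDl// addr_ge0.
  exists (r / (1 + (`|u| + `|v|))); first by rewrite divr_gt0.
  by rewrite mulrAC ltr_pdivrMr// ltr_pM2l// ltrDr.
have ball_ab (a b : R) : 0 <= a <= 1 -> 0 <= b <= 1 ->
    ball x r (x + a *: (t *: u) + b *: (t *: v)).
  move=> /andP[a0 a1] /andP[b0 b1]; rewrite -ball_normE /= -addrA opprD addrA subrr sub0r normrN.
  apply: le_lt_trans (ler_normD _ _) _; rewrite !normrZ (ger0_norm (ltW t0)) (ger0_norm a0) (ger0_norm b0).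
  apply: le_lt_trans tr; rewrite mulrDr.
  by apply: lerD; rewrite ler_piMl// mulr_ge0// (ltW t0).
have UU (a b : R) : 0 <= a <= 1 -> 0 <= b <= 1 ->
    U (x + a *: (t *: u) + b *: (t *: v)) by move=> a01 b01; have [] := rP _ (ball_ab a b a01 b01).
have scale2 w w' y : U y -> 'D_(t *: w) ('D_(t *: w') f) y = t * (t * 'D_w ('D_w' f) y).
  move=> Uy; have -> : 'D_(t *: w) ('D_(t *: w') f) y = 'D_(t *: w) (t \*: 'D_w' f) y.
    apply: near_eq_derive; near=> z; apply: (derive_scale_dir _ _ Uo Uf).
    by near: z; exact: open_nbhs_nbhs.
  have Uw' := smooth_on_derive w' Uf.
  rewrite deriveZ; last exact: smooth_on_derivable (smooth_on_derive _ Uf) Uy.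
  by rewrite (derive_scale_dir _ _ Uo Uw').
have [a [b [a01 b01 E1]]] := double_difference Uf UU.
have [a' b' a'01 b'01|a' [b' [a'01 b'01 E2]]] := @double_difference V U f x (t *: v) (t *: u) Uf.
  by rewrite addrAC; exact: UU.
have Uab := UU _ _ a01 b01; have Uab' : U (x + a' *: (t *: v) + b' *: (t *: u)).
  by rewrite addrAC; exact: UU.
rewrite (scale2 v u _ Uab) in E1; rewrite (scale2 u v _ Uab') in E2.
have E3 : f (x + t *: u + t *: v) - f (x + t *: u) - (f (x + t *: v) - f x) =
    f (x + t *: v + t *: u) - f (x + t *: v) - (f (x + t *: u) - f x).
  by rewrite (addrAC x (t *: v)) swap.
move: (etrans (esym E1) (etrans E3 E2)).
move=> /(mulfI (lt0r_neq0 t0))/(mulfI (lt0r_neq0 t0)) E.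
have [_ _ Bab] := rP _ (ball_ab _ _ a01 b01).
have [_ Aab _] : [/\ U (x + a' *: (t *: v) + b' *: (t *: u)),
   `|A - 'D_u ('D_v f) (x + a' *: (t *: v) + b' *: (t *: u))| < eps &
   `|B - 'D_v ('D_u f) (x + a' *: (t *: v) + b' *: (t *: u))| < eps].
  by apply: rP; rewrite addrAC; exact: ball_ab.
rewrite E in Bab; rewrite distrC in Bab.
have := ltrD Aab Bab; rewrite -splitr ltNge => /negP; apply.
by apply: le_trans (ler_normD _ _); rewrite addrA subrK.
Unshelve. all: by end_near. Qed.

Lemma derive_comm V W (fW : findim W) (U : set V) (f : V -> W) (x u v : V) :
  open U -> smooth_on U f -> U x -> 'D_u ('D_v f) x = 'D_v ('D_u f) x.
Proof.
case: fW => n [e [l [lc ll le]]] Uo Uf Ux.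
suff : forall i, l i ('D_u ('D_v f) x) = l i ('D_v ('D_u f) x).
  move: ('D_u ('D_v f) x) ('D_v ('D_u f) x) => A B AB.
  by rewrite (le A) (le B); apply: eq_bigr => i _; rewrite AB.
move=> i.
have lD w w' : l i ('D_w ('D_w' f) x) = 'D_w ('D_w' (l i \o f)) x.
  have -> : 'D_w ('D_w' (l i \o f)) x = 'D_w (l i \o 'D_w' f) x.
    apply: near_eq_derive; near=> z.
    have Uz : U z by near: z; exact: open_nbhs_nbhs.
    by have [_] := is_derive_lin (ll i) (lc i) (smooth_on_derivable (v:=w') Uf Uz).
  by have [_] := is_derive_lin (ll i) (lc i) (smooth_on_derivable (v:=w) (smooth_on_derive w' Uf) Ux).
by rewrite !lD; exact: derive_comm_scalar Uo (smooth_on_lin Uo (ll i) (lc i) Uf) Ux.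
Unshelve. all: by end_near. Qed.

Lemma jacobian_eq n m (f : 'rV[R]_n -> 'rV[R]_m) x (A : 'M[R]_(n, m)) :
  differentiable f x -> (forall v, 'D_v f x = v *m A) -> 'J f x = A.
Proof.
move=> fx fA; apply/row_matrixP => i.
by rewrite !rowE -deriveEjacobian// fA.
Qed.

Lemma jacobian_comp n m p (f : 'rV[R]_n -> 'rV[R]_m) (g : 'rV[R]_m -> 'rV[R]_p) x :
  differentiable f x -> differentiable g (f x) ->
  'J (g \o f) x = 'J f x *m 'J g (f x).
Proof.
move=> fx gx; apply: jacobian_eq; first exact: differentiable_comp.
move=> v; have [_ ->] := is_derive_comp (diff_derivable (v := v) fx) gx.
by rewrite deriveEjacobian// deriveEjacobian// mulmxA.
Qed.

Lemma row_jacobian n m (f : 'rV[R]_n -> 'rV[R]_m) x i : differentiable f x ->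
  row i ('J f x) = 'D_(delta_mx 0 i) f x.
Proof. by move=> fx; rewrite rowE deriveEjacobian. Qed.

Lemma derive_entry V m n (f : V -> 'M[R]_(m, n)) x v i j : derivable f x v ->
  'D_v (fun y => f y i j) x = 'D_v f x i j.
Proof.
move=> fx; have ll : linear (fun M : 'M[R]_(m, n) => M i j) by move=> a M N; rewrite !mxE.
by have [_] := is_derive_lin ll (@coord_continuous _ _ _ i j) fx.
Qed.

Lemma jacobianE n m (f : 'rV[R]_n -> 'rV[R]_m) x i j : differentiable f x ->
  'J f x i j = 'D_(delta_mx 0 i) (fun y => f y 0 j) x.
Proof.
move=> fx; rewrite derive_entry; last exact: diff_derivable.
by rewrite -(row_jacobian i fx) [RHS]mxE.
Qed.

Lemma jacobian_id n (x : 'rV[R]_n) : 'J id x = 1%:M.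
Proof.
apply: jacobian_eq => [|v]; last by rewrite derive_id mulmx1.
exact: (smooth_on_differentiable openT _ _ (smooth_on_id openT)).
Qed.

Lemma jacobian_ext n m (U : set 'rV[R]_n) (f g : 'rV[R]_n -> 'rV[R]_m) x :
  open U -> smooth_on U f -> U x -> (forall y, U y -> f y = g y) -> 'J g x = 'J f x.
Proof.
move=> Uo Uf Ux fg; have Ug := smooth_on_ext Uo fg Uf.
apply: jacobian_eq; first exact: smooth_on_differentiable Ug Ux.
move=> v; rewrite -deriveEjacobian; last exact: smooth_on_differentiable Uf Ux.
apply: near_eq_derive; apply: filterS (open_nbhs_nbhs (conj Uo Ux)) => y Uy.
by rewrite fg.
Qed.

Lemma smooth_on_jacobian n m (U : set 'rV[R]_n) (f : 'rV[R]_n -> 'rV[R]_m) :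
  open U -> smooth_on U f -> smooth_on U (jacobian f).
Proof.
move=> Uo Uf; apply: smooth_on_mx => // i j.
apply: (smooth_on_ext Uo (f := fun x => 'D_(delta_mx 0 i) (fun y => f y 0 j) x)).
  by move=> x Ux; rewrite jacobianE//; apply: smooth_on_differentiable Uf Ux.
by apply: smooth_on_derive; exact: smooth_on_entry.
Qed.

Lemma mx_norm_le m n (A : 'M[R]_(m, n)) (a : R) :
  0 <= a -> (forall i j, `|A i j| <= a) -> `|A| <= a.
Proof.
by move=> a0 Aa; rewrite [leLHS]mx_normrE; apply: bigmax_le => // -[i j] _; exact: Aa.
Qed.

Lemma mx_norm_ge_entry m n (A : 'M[R]_(m, n)) i j : `|A i j| <= `|A|.
Proof.
by rewrite [leRHS]mx_normrE; exact: (le_bigmax _ (fun ij => `|A ij.1 ij.2|) (i, j)).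
Qed.

Lemma row_sum_delta_dir n (v : 'rV[R]_n) : v = \sum_i v 0 i *: delta_mx 0 i.
Proof. by rewrite [LHS]matrix_sum_delta big_ord1. Qed.

Lemma small_jacobian_lipschitz n m (U : set 'rV[R]_n) (g : 'rV[R]_n -> 'rV[R]_m) x (e : R) :
  open U -> smooth_on U g -> U x -> 'J g x = 0 -> 0 < e ->
  exists2 r : R, 0 < r & forall y z, ball x r y -> ball x r z ->
    `|g y - g z| <= e * `|y - z|.
Proof.
(* With the entries of the Jacobian at most [d], the [n] coordinate directions contribute at most
   [n * d <= e]; [n.+1] also covers [n = 0]. *)
move=> Uo Ug Ux gx e0; pose d := e / n.+1%:R.
have d0 : 0 < d by rewrite divr_gt0.
have [r /= r0 rP] : exists2 r : R, 0 < r & forall y, ball x r y ->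
    U y /\ forall i j, `|'J g y i j| <= d.
  have : \forall y \near x, U y /\ forall i j, `|'J g y i j| <= d.
    have /cvgrPdist_le/(_ _ d0) H := smooth_on_continuous (smooth_on_jacobian Uo Ug) Ux.
    apply: filterS2 (open_nbhs_nbhs (conj Uo Ux)) H => y Uy H; split=> // i j.
    by move: H; rewrite gx sub0r normrN; apply: le_trans; exact: mx_norm_ge_entry.
  by case/nbhs_ballP => r /= r0 rP; exists r.
exists r => // y z; rewrite -ball_normE /= => yr zr.
have seg (s : R) : 0 <= s <= 1 -> ball x r (z + s *: (y - z)).
  move=> /andP[s0 s1]; rewrite -ball_normE /=.
  have -> : x - (z + s *: (y - z)) = s *: (x - y) + (1 - s) *: (x - z).
    by apply/matrixP => i j; rewrite !mxE; ring.
  apply: le_lt_trans (ler_normD _ _) _; rewrite !normrZ (ger0_norm s0) ger0_norm ?subr_ge0//.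
  have [->|s0'] := eqVneq s 0; first by rewrite mul0r add0r subr0 mul1r.
  rewrite [ltRHS](_ : r = s * r + (1 - s) * r); last by ring.
  apply: ltr_leD; first by rewrite ltr_pM2l// lt0r s0' s0.
  by rewrite ler_wpM2l ?subr_ge0// ltW.
apply: mx_norm_le => [|i j]; first by rewrite mulr_ge0// ltW.
have Ugj := smooth_on_entry Uo 0 j Ug.
have [s s01|s s01] := @line_MVT _ (fun w => g w 0 j) z (y - z).
  by have [Us _] := rP _ (seg s s01); exact: smooth_on_derivable Ugj Us.
have [Us Js] := rP _ (seg s s01).
rewrite [z + (y - z)]addrC subrK ord1 !mxE => ->.
rewrite [X in 'D_X _ _](row_sum_delta_dir (y - z)) derive_dir_sum; last first.
  exact: smooth_on_differentiable Ugj Us.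
apply: le_trans (ler_norm_sum _ _ _) _.
apply: (@le_trans _ _ (\sum_(k < n) d * `|y - z|)).
  apply: ler_sum => k _; rewrite normrM mulrC; apply: ler_pM => //.
    by rewrite -jacobianE//; exact: smooth_on_differentiable Ug Us.
  exact: mx_norm_ge_entry.
rewrite sumr_const card_ord -mulrnAl ler_wpM2r// /d -mulrnAr -mulr_natl.
by rewrite ger_pMr// ler_pdivrMr// mul1r ler_nat.
Qed.

(** The injectivity half of the inverse function theorem: [f y *m B - y], with [B] the inverse
    Jacobian, has derivative 0 at [x] and is therefore 1/2-Lipschitz nearby, so [f y = f z] forces
    [|y - z| <= |y - z| / 2]. *)
Lemma local_injectivity n (U : set 'rV[R]_n) (f : 'rV[R]_n -> 'rV[R]_n) x :
  open U -> smooth_on U f -> U x -> 'J f x \in unitmx ->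
  exists2 r : R, 0 < r & forall y z, ball x r y -> ball x r z -> f y = f z -> y = z.
Proof.
move=> Uo Uf Ux Ju; set B := invmx ('J f x).
pose g y := f y *m B - y.
have UfB : smooth_on U (fun y => f y *m B).
  by apply: smooth_on_mulmx => //; exact: smooth_on_cst.
have Ug : smooth_on U g by exact: (smooth_on_sub_fun Uo UfB (smooth_on_id Uo)).
have ll : linear (fun w : 'rV[R]_n => w *m B).
  by move=> a y z; rewrite mulmxDl -scalemxAl.
have lc : continuous (fun w : 'rV[R]_n => w *m B).
  move=> w; apply: differentiable_continuous.
  apply: (smooth_on_differentiable openT _ _ _ I).
  by apply: smooth_on_mulmx; [exact: openT|apply: smooth_on_id; exact: openT
    |apply: smooth_on_cst; exact: openT].
have gx : 'J g x = 0.
  apply: jacobian_eq; first exact: smooth_on_differentiable Ug Ux.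
  move=> v; rewrite mulmx0 deriveB; [|exact: smooth_on_derivable UfB Ux|exact: derivable_id].
  have [_ ->] := is_derive_lin ll lc (smooth_on_derivable (v := v) Uf Ux).
  rewrite derive_id deriveEjacobian; last exact: smooth_on_differentiable Uf Ux.
  by rewrite -mulmxA mulmxV// mulmx1 subrr.
have h0 : 0 < (2^-1 : R) by rewrite invr_gt0.
have [r r0 rP] := small_jacobian_lipschitz Uo Ug Ux gx h0.
exists r => // y z yr zr fyz; have := rP y z yr zr.
have -> : g y - g z = z - y by rewrite /g fyz opprB addrC addrA subrK.
rewrite distrC.
rewrite -subr_ge0 -[X in _ - X]mul1r -mulrBl.
have -> : 2^-1 - 1 = - 2^-1 :> R by lra.
rewrite mulNr oppr_ge0 pmulr_rle0// normr_le0 subr_eq0 => /eqP //.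
Qed.

End Lines.

#[local] Existing Instance findim_R.
#[local] Existing Instance findim_mx.
#[local] Existing Instance findim_prod.

Lemma smooth_on_local (R : realType) (V W : normedModType R) (U : set V) (f : V -> W) :
  (forall x, U x -> exists2 U' : set V, U' x & smooth_on U' f) -> smooth_on U f.
Proof. by move=> loc vs x /loc[U' U'x /(_ vs x U'x)]. Qed.

(** * Charts and tangent maps *)

Section Charts.
Context {R : realType} {M : topologicalType} (w : symplectic4 R M).
Implicit Types (c d : chart R M) (p : M) (O : set M).

Definition cimg c O := cmap c @` (cdom c `&` O).

Lemma cmap_continuous c p : atlas w c -> cdom c p -> {for p, continuous (cmap c)}.
Proof.
move=> wc cp; have [+ _] := sm_continuous wc.
by rewrite (continuous_open_subspace _ (sm_open wc).1) => /(_ p); apply; exact/mem_set.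
Qed.

Lemma cimg_inv c O x : atlas w c -> cimg c O x ->
  [/\ cdom c (cinv c x), O (cinv c x) & cmap c (cinv c x) = x].
Proof. by move=> wc [p [cp Op] <-]; rewrite (sm_cancel wc cp). Qed.

Lemma cinv_continuous c O x : atlas w c -> cimg c O x ->
  {for x, continuous (cinv c)}.
Proof.
move=> wc [p [cp _] <-]; have [_] := sm_continuous wc.
rewrite (continuous_open_subspace _ (sm_open wc).2) => /(_ (cmap c p)); apply.
by apply/mem_set; exists p.
Qed.

Lemma mem_cimg c O p : cdom c p -> O p -> cimg c O (cmap c p).
Proof. by move=> cp Op; exists p. Qed.

Lemma open_cimg c O : atlas w c -> open O -> open (cimg c O).
Proof.
move=> wc Oo; rewrite openE => x cx; have [cx1 Ox cx2] := cimg_inv wc cx.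
have [_ io] := sm_open wc.
have ix : (cmap c @` cdom c) x by exists (cinv c x).
have nO : nbhs (cinv c x) O by exact: open_nbhs_nbhs.
rewrite /interior; apply: filterS2 (open_nbhs_nbhs (conj io ix)) (cinv_continuous wc cx nO).
by move=> y [q cq <-] /=; rewrite (sm_cancel wc cq) => Oq; exists q.
Qed.

Lemma nbhs_cimg c O p : atlas w c -> open O -> cdom c p -> O p ->
  nbhs (cmap c p) (cimg c O).
Proof.
by move=> wc Oo cp Op; apply: open_nbhs_nbhs; split; [exact: open_cimg|exact: mem_cimg].
Qed.

Lemma nbhs_cmap c p (A : set 'rV[R]_4) : atlas w c -> cdom c p ->
  nbhs (cmap c p) A -> \forall q \near p, cdom c q /\ A (cmap c q).
Proof.
move=> wc cp pA; have pA' : \forall q \near p, A (cmap c q) := cmap_continuous wc cp pA.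
by apply: filterS2 pA' (open_nbhs_nbhs (conj (sm_open wc).1 cp)) => q Aq cq.
Qed.

Definition smooth_fun O (W : normedModType R) (F : M -> W) : Prop :=
  forall c, atlas w c -> smooth_on (cimg c O) (F \o cinv c).

Lemma smooth_map_fun (W : normedModType R) (F : M -> W) :
  smooth_map w F <-> smooth_fun setT F.
Proof.
by split=> FM c wc; have := FM c wc; rewrite /cimg setIT.
Qed.

End Charts.

Section Maps.
Context {R : realType} {M1 M2 M3 : topologicalType}.
Context (w1 : symplectic4 R M1) (w2 : symplectic4 R M2) (w3 : symplectic4 R M3).

Definition local_rep (c : chart R M1) (d : chart R M2) (F : M1 -> M2) :=
  cmap d \o F \o cinv c.

(** Like ['J], this matrix acts on row vectors, so the tangent map of [G \o F] is the product in the
    order [F], then [G]. *)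
Definition tangent (c : chart R M1) (d : chart R M2) (F : M1 -> M2) (p : M1) :
  'M[R]_4 := 'J (local_rep c d F) (cmap c p).

End Maps.

Lemma open_preimage (R : realType) (M1 M2 : topologicalType) (w1 : symplectic4 R M1)
    (w2 : symplectic4 R M2) (F : M1 -> M2) (O : set M2) :
  smooth_between w1 w2 F -> open O -> open (F @^-1` O).
Proof. by move=> Fs; move: O; apply/continuousP; exact: Fs.1. Qed.

Section Composition.
Context {R : realType} {M1 M2 M3 : topologicalType}.
Context (w1 : symplectic4 R M1) (w2 : symplectic4 R M2) (w3 : symplectic4 R M3).
Context (F : M1 -> M2) (G : M2 -> M3).
Hypotheses (Fs : smooth_between w1 w2 F) (Gs : smooth_between w2 w3 G).

Lemma smooth_fun_comp (O : set M2) (W : normedModType R) (fW : findim W) (f : M2 -> W) :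
  open O -> smooth_fun w2 O f -> smooth_fun w1 (F @^-1` O) (f \o F).
Proof.
move=> Oo fO c wc; apply: smooth_on_local => x cx.
have [cx1 Ox cx2] := cimg_inv wc cx; set p := cinv c x in cx1 Ox cx2 *.
pose d := chart_at w2 (F p); have [wd dp] := sm_chart_at w2 (F p).
pose U := cimg c (F @^-1` (O `&` cdom d)).
have dd := (sm_open wd).1.
have Uo : open U by apply: (open_cimg wc); apply: (open_preimage Fs); exact: openI.
exists U; first by rewrite -cx2; exact: mem_cimg.
apply: (smooth_on_ext Uo (f := (f \o cinv d) \o local_rep c d F)).
  move=> y /(cimg_inv wc)[cy1 [Oy dy] cy2] /=.
  by rewrite /local_rep /= (sm_cancel wd dy).
apply: (@smooth_on_comp _ _ _ Uo _ _ _ _ (cimg d O)).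
- exact: (open_cimg wd Oo).
- by move=> y /(cimg_inv wc)[cy1 [Oy dy] cy2]; exact: mem_cimg.
- exact: fO.
- apply: smooth_on_sub (Fs.2 c d wc wd) => y [q [cq [Oq dq]] <-].
  by exists q.
Qed.

Lemma smooth_between_comp : smooth_between w1 w3 (G \o F).
Proof.
split; first by move=> x; apply: continuous_comp; [exact: Fs.1|exact: Gs.1].
move=> c e wc we.
have oe : open (G @^-1` cdom e) by exact: open_preimage Gs (sm_open we).1.
have H : smooth_fun w2 (G @^-1` cdom e) (cmap e \o G).
  by move=> d wd; apply: smooth_on_sub (Gs.2 d e wd we) => y [q [cq oq] <-]; exists q.
exact: (smooth_fun_comp _ oe H wc).
Qed.

Section Point.
Variables (c : chart R M1) (d : chart R M2) (p : M1).
Hypotheses (wc : atlas w1 c) (wd : atlas w2 d) (cp : cdom c p) (dp : cdom d (F p)).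

Lemma local_rep_smooth : exists U : set 'rV[R]_4,
  [/\ open U, U (cmap c p), smooth_on U (local_rep c d F) &
   forall x, U x -> [/\ cdom c (cinv c x), cdom d (F (cinv c x)) & cmap c (cinv c x) = x]].
Proof.
exists (cimg c (F @^-1` cdom d)); split.
- by apply: (open_cimg wc); apply: (open_preimage Fs); exact: (sm_open wd).1.
- exact: mem_cimg.
- exact: Fs.2.
- by move=> x /(cimg_inv wc).
Qed.

Lemma local_rep_differentiable : differentiable (local_rep c d F) (cmap c p).
Proof.
have [U [Uo Up Us _]] := local_rep_smooth.
exact: smooth_on_differentiable Us Up.
Qed.

Lemma local_rep_at : local_rep c d F (cmap c p) = cmap d (F p).
Proof. by rewrite /local_rep /= (sm_cancel wc cp). Qed.

Lemma tangent_comp (e : chart R M3) : atlas w3 e -> cdom e (G (F p)) ->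
  tangent c e (G \o F) p = tangent c d F p *m tangent d e G (F p).
Proof.
move=> we ep.
have oGe : open (G @^-1` cdom e) by exact: open_preimage Gs (sm_open we).1.
have [U [Uo Up Us UP]] := local_rep_smooth.
have gd : differentiable (local_rep d e G) (cmap d (F p)).
  have Go : open (cimg d (G @^-1` cdom e)) by exact: (open_cimg wd oGe).
  exact: (smooth_on_differentiable Go _ _ (Gs.2 _ _ wd we) (mem_cimg dp ep)).
rewrite /tangent -[in RHS]local_rep_at -jacobian_comp; last 2 first.
- exact: local_rep_differentiable.
- by rewrite local_rep_at.
pose U' := U `&` cimg c ((G \o F) @^-1` cdom e).
have U'o : open U'.
  by apply: openI => //; apply: (open_cimg wc); exact: (open_preimage Fs oGe).
have U's : smooth_on U' (local_rep c e (G \o F)).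
  by apply: smooth_on_sub (smooth_between_comp.2 c e wc we) => y [].
rewrite -(@jacobian_ext _ _ _ U' _ (local_rep d e G \o local_rep c d F) _ U'o U's) //.
  by split => //; exact: mem_cimg.
move=> y [Uy _]; have [_ dy _] := UP y Uy.
by rewrite /local_rep /= (sm_cancel wd dy).
Qed.

Lemma dloc_comp (f : M2 -> R) (O : set M2) : open O -> O (F p) ->
  smooth_fun w2 O f ->
  dloc c (f \o F) (cmap c p) = dloc d f (cmap d (F p)) *m (tangent c d F p)^T.
Proof.
move=> Oo Op fO; apply/rowP => i; rewrite !mxE.
have io : open (cimg d O) by exact: (open_cimg wd Oo).
have fd : differentiable (f \o cinv d) (local_rep c d F (cmap c p)).
  rewrite local_rep_at.
  exact: (smooth_on_differentiable io _ _ (fO d wd) (mem_cimg dp Op)).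
have [U [Uo Up Us UP]] := local_rep_smooth.
transitivity ('D_(delta_mx 0 i) ((f \o cinv d) \o local_rep c d F) (cmap c p)).
  apply: near_eq_derive; apply: filterS (open_nbhs_nbhs (conj Uo Up)) => y /UP[_ dy _].
  by rewrite /local_rep /= (sm_cancel wd dy).
have [_ ->] := is_derive_comp (diff_derivable (v := delta_mx 0 i) local_rep_differentiable) fd.
rewrite deriveEjacobian; last exact: local_rep_differentiable.
rewrite -/(tangent c d F p) [X in 'D_X _ _](row_sum_delta_dir _) derive_dir_sum//.
rewrite local_rep_at; apply: eq_bigr => j _.
by rewrite -rowE !mxE [RHS]mulrC.
Qed.

End Point.
End Composition.

(** The identity behind naturality of Hamiltonian fields: [a *m T'] is the pulled-back differential,
    [T *m W *m T'] the pulled-back form with the transpose of [T] for [T'], and the final [T] pushes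
    the vector forward. *)
Lemma conj_invmx (R : fieldType) m n (a : 'M[R]_(m, n)) (T W T' : 'M[R]_n) :
  T \in unitmx -> W \in unitmx -> T' \in unitmx ->
  a *m T' *m invmx (T *m W *m T') *m T = a *m invmx W.
Proof.
move=> Tu Wu T'u; have Nu : T *m W *m T' \in unitmx by rewrite !unitmx_mul Tu Wu.
rewrite -[LHS](mulmxK Wu) -[X in X *m _](mulmxA _ T W) -[X in _ *m X *m invmx W](mulmxK T'u).
by move: (T *m W *m T') Nu => N Nu; rewrite !mulmxA mulmxKV// mulmxK.
Qed.

Lemma smooth_between_id (R : realType) (M : topologicalType) (w : symplectic4 R M) :
  smooth_between w w id.
Proof. by split; [move=> x; exact: cvg_id|move=> c d wc wd; exact: (sm_trans wc wd)]. Qed.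

(** * Hamiltonian vector fields in charts *)

Section Hamvec.
Context {R : realType} {M : topologicalType} (w : symplectic4 R M).
Implicit Types (c d : chart R M) (p : M) (O : set M).

Lemma tangent_id c p : atlas w c -> cdom c p -> tangent c c id p = 1%:M.
Proof.
move=> wc cp; rewrite -(jacobian_id (cmap c p)).
have Uo := open_cimg wc openT.
apply: (jacobian_ext Uo (smooth_on_id Uo)); first exact: mem_cimg.
by move=> y /(cimg_inv wc)[_ _ E]; rewrite /local_rep /= E.
Qed.

Lemma omega_tangent c d p : atlas w c -> atlas w d -> cdom c p -> cdom d p ->
  omega w c (cmap c p) = tangent c d id p *m omega w d (cmap d p) *m (tangent c d id p)^T.
Proof. by move=> wc wd cp dp; exact: (omega_trans wc wd cp dp). Qed.

Lemma omega_unit c O x : atlas w c -> cimg c O x -> omega w c x \in unitmx.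
Proof. by move=> wc [p [cp _] <-]; exact: omega_nondegenerate. Qed.

Lemma hamvecE c O (f : M -> R) x : atlas w c -> cimg c O x ->
  hamvec w c f x *m omega w c x = dloc c f x.
Proof. by move=> wc cx; rewrite /hamvec mulmxKV//; exact: omega_unit cx. Qed.

Lemma dloc_smooth c O (f : M -> R) : atlas w c -> open O -> smooth_fun w O f ->
  smooth_on (cimg c O) (dloc c f).
Proof.
move=> wc Oo fO; have io := open_cimg wc Oo; apply: (smooth_on_mx io) => i j.
apply: (smooth_on_ext io (f := 'D_(delta_mx 0 j) (f \o cinv c))) => [x _|].
  by rewrite mxE.
by apply: smooth_on_derive; exact: fO.
Qed.

Lemma omega_smooth_cimg c O : atlas w c -> smooth_on (cimg c O) (omega w c).
Proof.
move=> wc; apply: smooth_on_sub (omega_smooth wc) => x [p [cp _] <-].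
by exists p.
Qed.

Lemma hamvec_smooth c O (f : M -> R) : atlas w c -> open O -> smooth_fun w O f ->
  smooth_on (cimg c O) (hamvec w c f).
Proof.
move=> wc Oo fO; have io := open_cimg wc Oo.
apply: smooth_on_mulmx => //; first exact: dloc_smooth.
apply: smooth_on_invmx => //; last exact: omega_smooth_cimg.
by move=> x; exact: omega_unit.
Qed.

Lemma dloc_jacobian c O (f : M -> R) x v : atlas w c -> open O -> smooth_fun w O f ->
  cimg c O x -> 'D_v (f \o cinv c) x = (dloc c f x *m v^T) 0 0.
Proof.
move=> wc Oo fO cx; have io := open_cimg wc Oo.
rewrite [X in 'D_X _ _](row_sum_delta_dir v) derive_dir_sum; last first.
  exact: (smooth_on_differentiable io _ _ (fO c wc) cx).
by rewrite mxE; apply: eq_bigr => j _; rewrite !mxE [RHS]mulrC.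
Qed.

End Hamvec.

Section Symplecto.
Context {R : realType} {M1 M2 : topologicalType}.
Context (w1 : symplectic4 R M1) (w2 : symplectic4 R M2) (F : M1 -> M2).
Hypotheses (Fs : smooth_between w1 w2 F) (Ff : preserves_form w1 w2 F).
Variables (c : chart R M1) (d : chart R M2) (p : M1).
Hypotheses (wc : atlas w1 c) (wd : atlas w2 d) (cp : cdom c p) (dp : cdom d (F p)).

Lemma preserves_form_charts : omega w1 c (cmap c p) =
  tangent c d F p *m omega w2 d (cmap d (F p)) *m (tangent c d F p)^T.
Proof.
have [wc0 cp0] := sm_chart_at w1 p; have [wd0 dp0] := sm_chart_at w2 (F p).
rewrite (omega_tangent wc wc0 cp cp0) (Ff p).
rewrite -/(tangent (chart_at w1 p) (chart_at w2 (F p)) F p).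
rewrite (omega_tangent wd0 wd dp0 dp).
have -> : tangent c d F p = tangent c (chart_at w1 p) id p *m
    tangent (chart_at w1 p) (chart_at w2 (F p)) F p *m tangent (chart_at w2 (F p)) d id (F p).
  have id1 := smooth_between_id w1; have id2 := smooth_between_id w2.
  rewrite -(tangent_comp id1 Fs wc wc0 cp cp0 wd0 dp0).
  exact: (tangent_comp (smooth_between_comp id1 Fs) id2 wc wd0 cp dp0 wd dp).
move: (tangent c (chart_at w1 p) id p) (tangent (chart_at w2 (F p)) d id (F p))
  (tangent (chart_at w1 p) (chart_at w2 (F p)) F p) (omega w2 d _) => A B C D.
by rewrite !trmx_mul !mulmxA.
Qed.

Lemma tangent_unit : tangent c d F p \in unitmx.
Proof.
have := omega_nondegenerate wc cp; rewrite preserves_form_charts.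
by rewrite !unitmx_mul => /andP[/andP[]].
Qed.

(** Naturality of the Hamiltonian field; besides symplectomorphisms it is applied to the identity,
    where it becomes the rule for changing charts. *)
Lemma hamvec_comp (f : M2 -> R) (O : set M2) : open O -> O (F p) -> smooth_fun w2 O f ->
  hamvec w2 d f (cmap d (F p)) = hamvec w1 c (f \o F) (cmap c p) *m tangent c d F p.
Proof.
move=> Oo Op fO; have Tu := tangent_unit; set T := tangent c d F p in Tu *.
have Tu' : T^T \in unitmx by rewrite unitmx_tr.
rewrite /hamvec (dloc_comp Fs wc wd cp dp Oo Op fO) preserves_form_charts -/T.
have wu := omega_nondegenerate wd dp.
exact/esym/conj_invmx.
Qed.

End Symplecto.

(** * Poisson commuting functions and their flows *)

Section Bracket.
Context {R : realType}.

Lemma derive_mulmx (V : normedModType R) m n p (A : V -> 'M[R]_(m, n))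
    (B : V -> 'M[R]_(n, p)) x v : derivable A x v -> derivable B x v ->
  is_derive x v (fun y => A y *m B y) ('D_v A x *m B x + A x *m 'D_v B x).
Proof.
move=> Ad Bd.
have Aij i j : is_derive x v (fun y => A y i j) ('D_v A x i j).
  split; first by move/derivable_mxP : Ad; apply.
  exact: derive_entry.
have Bij i j : is_derive x v (fun y => B y i j) ('D_v B x i j).
  split; first by move/derivable_mxP : Bd; apply.
  exact: derive_entry.
have ABij i j : is_derive x v (fun y => (A y *m B y) i j)
    (('D_v A x *m B x + A x *m 'D_v B x) i j).
  have -> : (fun y => (A y *m B y) i j) =
      \sum_(k < n) ((fun y => A y i k) * (fun y => B y k j)).
    by apply/funext => y; rewrite mxE fct_sumE.
  apply: is_derive_eq.
  rewrite !mxE -big_split /=; apply: eq_bigr => k _.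
  by rewrite addrC; congr (_ + _); rewrite -[LHS]/(_ * _) mulrC.
have ABd : derivable (fun y => A y *m B y) x v.
  by apply/derivable_mxP => i j; have [] := ABij i j.
split=> //; apply/matrixP => i j; rewrite -derive_entry//.
by have [_] := ABij i j.
Qed.

Definition bl n (A : 'M[R]_n) (u v : 'rV[R]_n) : R := (u *m A *m v^T) 0 0.

Lemma bl_tr n (A : 'M[R]_n) u v : bl A u v = bl A^T v u.
Proof.
rewrite /bl; have -> : v *m A^T *m u^T = (u *m A *m v^T)^T by rewrite !trmx_mul trmxK mulmxA.
by rewrite [RHS]mxE.
Qed.

Lemma bl_skew n (A : 'M[R]_n) u v : A^T = - A -> bl A u v = - bl A v u.
Proof. by move=> At; rewrite bl_tr At /bl mulmxN mulNmx mxE. Qed.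

Lemma bl_sum n (A : 'M[R]_n) u v : bl A u v = \sum_j \sum_k u 0 j * v 0 k * A j k.
Proof.
rewrite /bl mxE exchange_big; apply: eq_bigr => k _; rewrite !mxE mulr_suml.
by apply: eq_bigr => j _; rewrite mulrAC.
Qed.

Lemma bl_ext n (a b : 'rV[R]_n) : (forall v : 'rV[R]_n, (a *m v^T) 0 0 = (b *m v^T) 0 0) -> a = b.
Proof.
move=> ab; apply/rowP => i; have := ab (delta_mx 0 i).
by rewrite trmx_delta -!colE !mxE.
Qed.

(** The linear algebra behind the vanishing of [X, Y] when {f, g} = 0. Besides nondegeneracy and
    skewness, the hypotheses are symmetry of the second derivatives of f and of g, the derivative of
    omega(X, Y) = 0, and closedness of omega; evaluated at suitable vectors they combine to
    omega([DX Y] - [DY X], v) = 0. *)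
Lemma bracket_algebra n (W : 'M[R]_n) (DX DY : 'rV[R]_n -> 'rV[R]_n)
    (DW : 'rV[R]_n -> 'M[R]_n) (X Y : 'rV[R]_n) :
  W \in unitmx -> W^T = - W -> (forall u, (DW u)^T = - DW u) ->
  (forall u v, bl W (DX u) v + bl (DW u) X v = bl W (DX v) u + bl (DW v) X u) ->
  (forall u v, bl W (DY u) v + bl (DW u) Y v = bl W (DY v) u + bl (DW v) Y u) ->
  (forall v, bl W (DX v) Y + bl (DW v) X Y + bl W X (DY v) = 0) ->
  (forall a b c, bl (DW a) b c + bl (DW b) c a + bl (DW c) a b = 0) ->
  DX Y = DY X.
Proof.
move=> Wu Ws DWs SX SY P C.
suff H v : bl W (DX Y) v = bl W (DY X) v.
  by apply: (can_inj (mulmxK Wu)); apply: bl_ext => v; exact: H.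
have h1 := SX Y v; have h2 := SY X v; have h3 := P v; have h4 := C X Y v.
rewrite [bl W X _]bl_skew// in h3.
rewrite [bl (DW Y) X v]bl_skew// in h1; rewrite [bl (DW v) Y X]bl_skew// in h2.
lra.
Qed.

Lemma derive_bl (V : normedModType R) n (W : V -> 'M[R]_n) (A : V -> 'rV[R]_n) x u v :
  derivable A x u -> derivable W x u ->
  'D_u (fun y => bl (W y) (A y) v) x = bl (W x) ('D_u A x) v + bl ('D_u W x) (A x) v.
Proof.
move=> Ad Wd; have [d1 e1] := derive_mulmx Ad Wd.
have [d2 e2] := derive_mulmx d1 (derivable_cst (v^T) x u).
rewrite /bl (derive_entry _ _ d2) e2 derive_cst mulmx0 addr0 e1.
by rewrite mulmxDl mxE.
Qed.

(** Both sides are mixed second derivatives of [h], obtained by differentiating dh = W(A, .), so the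
    identity is their symmetry. *)
Lemma hessian_bl n (U : set 'rV[R]_n) (h : 'rV[R]_n -> R) (W : 'rV[R]_n -> 'M[R]_n)
    (A : 'rV[R]_n -> 'rV[R]_n) x u v :
  open U -> U x -> smooth_on U h -> smooth_on U W -> smooth_on U A ->
  (forall y v, U y -> 'D_v h y = bl (W y) (A y) v) ->
  bl (W x) ('D_u A x) v + bl ('D_u W x) (A x) v =
  bl (W x) ('D_v A x) u + bl ('D_v W x) (A x) u.
Proof.
move=> Uo Ux hU WU AU hA.
have step a b : bl (W x) ('D_a A x) b + bl ('D_a W x) (A x) b = 'D_a ('D_b h) x.
  rewrite -derive_bl; [|exact: smooth_on_derivable Ux|exact: smooth_on_derivable Ux].
  apply: near_eq_derive; apply: filterS (open_nbhs_nbhs (conj Uo Ux)) => y Uy.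
  by rewrite hA.
by rewrite !step; exact: (derive_comm _ u v Uo hU Ux).
Qed.

Lemma poisson_commute_bracket (U : set 'rV[R]_4) (W : 'rV[R]_4 -> 'M[R]_4)
    (f g : 'rV[R]_4 -> R) (X Y : 'rV[R]_4 -> 'rV[R]_4) (x : 'rV[R]_4) :
  open U -> U x -> smooth_on U W -> smooth_on U f -> smooth_on U g ->
  smooth_on U X -> smooth_on U Y ->
  (forall y, U y -> W y \in unitmx) -> (forall y, U y -> (W y)^T = - W y) ->
  (forall y (i j k : 'I_4), U y ->
     'D_(delta_mx 0 i) (fun z => W z j k) y + 'D_(delta_mx 0 j) (fun z => W z k i) y +
     'D_(delta_mx 0 k) (fun z => W z i j) y = 0) ->
  (forall y v, U y -> 'D_v f y = bl (W y) (X y) v) ->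
  (forall y v, U y -> 'D_v g y = bl (W y) (Y y) v) ->
  (forall y, U y -> bl (W y) (X y) (Y y) = 0) ->
  'D_(Y x) X x = 'D_(X x) Y x.
Proof.
move=> Uo Ux WU fU gU XU YU Wu Ws Wc fX gY XY0.
have near_x (P : 'rV[R]_4 -> Prop) : (forall y, U y -> P y) -> \forall y \near x, P y.
  by move=> UP; exact: filterS UP (open_nbhs_nbhs (conj Uo Ux)).
apply: (@bracket_algebra _ (W x) (fun u => 'D_u X x) (fun u => 'D_u Y x) (fun u => 'D_u W x)).
- exact: Wu.
- exact: Ws.
- move=> u; apply/matrixP => i j; rewrite [LHS]mxE [RHS]mxE -!derive_entry; last 2 first.
  + exact: smooth_on_derivable Ux.
  + exact: smooth_on_derivable Ux.
  have WijU := smooth_on_entry Uo i j WU.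
  rewrite -deriveN; last exact: smooth_on_derivable Ux.
  apply: near_eq_derive; apply: near_x => y Uy.
  by have /matrixP/(_ i j) := Ws y Uy; rewrite !mxE.
- by move=> u v; exact: (hessian_bl u v Uo Ux fU WU XU fX).
- by move=> u v; exact: (hessian_bl u v Uo Ux gU WU YU gY).
- move=> v; have Xd : derivable X x v by exact: smooth_on_derivable Ux.
  have Yd : derivable (fun y => (Y y)^T) x v.
    by apply: smooth_on_derivable Ux; exact: smooth_on_trmx.
  have Wd : derivable W x v by exact: smooth_on_derivable Ux.
  have [d1 e1] := derive_mulmx Xd Wd; have [d2 e2] := derive_mulmx d1 Yd.
  have : 'D_v (fun y => (X y *m W y *m (Y y)^T) 0 0) x = 0.
    rewrite -(derive_cst (0 : R) x v); apply: near_eq_derive; apply: near_x => y Uy.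
    exact: XY0.
  have eT : 'D_v (fun y => (Y y)^T) x = ('D_v Y x)^T.
    apply/matrixP => k l; rewrite -(derive_entry _ _ Yd) mxE -derive_entry; last first.
      exact: smooth_on_derivable Ux.
    by congr ('D_v _ x); apply/funext => y; rewrite mxE.
  rewrite (derive_entry _ _ d2) e2 e1 eT mulmxDl.
  by rewrite [X in X = _ -> _]mxE [X in X + _ = _ -> _]mxE.
(* Closedness is given on triples of basis vectors; all three terms are expanded over such triples
   and their indices are permuted cyclically to match. *)
- move=> a b c.
  pose d3 (i j k : 'I_4) := 'D_(delta_mx 0 i) (fun z => W z j k) x.
  have dW a' b' c' : bl ('D_a' W x) b' c' =
      \sum_i \sum_j \sum_k a' 0 i * b' 0 j * c' 0 k * d3 i j k.
    rewrite bl_sum; rewrite [RHS]exchange_big; apply: eq_bigr => j _.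
    rewrite [RHS]exchange_big; apply: eq_bigr => k _.
    rewrite -derive_entry; last exact: smooth_on_derivable Ux.
    rewrite [X in 'D_X _ _](row_sum_delta_dir a') derive_dir_sum; last first.
      exact: (smooth_on_differentiable Uo _ _ (smooth_on_entry Uo j k WU) Ux).
    rewrite mulr_sumr; apply: eq_bigr => i _; rewrite -[_ *: _]/(_ * _) /d3.
    by rewrite mulrCA !mulrA.
  have -> : bl ('D_b W x) c a = \sum_i \sum_j \sum_k a 0 i * b 0 j * c 0 k * d3 j k i.
    rewrite dW; under eq_bigr => j _ do rewrite exchange_big /=.
    rewrite exchange_big /=; apply: eq_bigr => i _; apply: eq_bigr => j _.
    by apply: eq_bigr => k _; congr (_ * _); rewrite mulrC mulrA.
  have -> : bl ('D_c W x) a b = \sum_i \sum_j \sum_k a 0 i * b 0 j * c 0 k * d3 k i j.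
    rewrite dW exchange_big /=; apply: eq_bigr => i _.
    rewrite exchange_big /=; apply: eq_bigr => j _.
    by apply: eq_bigr => k _; congr (_ * _); rewrite -mulrA mulrC.
  rewrite dW -!big_split big1//= => i _; rewrite -!big_split big1//= => j _.
  rewrite -!big_split big1//= => k _.
  by rewrite -!mulrDr (Wc x i j k Ux) mulr0.
Qed.

End Bracket.

Lemma continuous_pair (X Y Z : topologicalType) (f : X -> Y) (g : X -> Z) x :
  {for x, continuous f} -> {for x, continuous g} -> {for x, continuous (fun y => (f y, g y))}.
Proof. by move=> fc gc; exact: (cvg_pair fc gc). Qed.

Section Curves.
Context {R : realType}.

Lemma is_derive_pair (V W1 W2 : normedModType R) (f : V -> W1) (g : V -> W2) x v a b :
  is_derive x v f a -> is_derive x v g b ->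
  is_derive x v (fun y => (f y, g y)) (a, b).
Proof.
move=> [fd <-] [gd <-].
suff H : (h^-1 *: (((fun y => (f y, g y)) \o shift x) (h *: v) - (f x, g x)) @[h --> 0^'] --> ('D_v f x, 'D_v g x)).
  by split; [apply/cvg_ex; exists ('D_v f x, 'D_v g x)|exact: cvg_lim H].
by apply: cvg_pair; [exact: fd|exact: gd].
Qed.

Lemma derive_snd (V1 V2 W : normedModType R) (F : V1 * V2 -> W) t x v :
  'D_(0, v) F (t, x) = 'D_v (fun y => F (t, y)) x.
Proof.
rewrite /derive; suff -> : (fun h : R => h^-1 *: ((F \o shift (t, x)) (h *: (0, v)) - F (t, x))) =
  (fun h : R => h^-1 *: (((fun y => F (t, y)) \o shift x) (h *: v) - F (t, x))) by [].
apply/funext => h /=; congr (_ *: (F _ - _)).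
by apply: injective_projections => //=; rewrite scaler0 add0r.
Qed.

Lemma derive_fst (V1 V2 W : normedModType R) (F : V1 * V2 -> W) t x v :
  'D_(v, 0) F (t, x) = 'D_v (fun s => F (s, x)) t.
Proof.
rewrite /derive; suff -> : (fun h : R => h^-1 *: ((F \o shift (t, x)) (h *: (v, 0)) - F (t, x))) =
  (fun h : R => h^-1 *: (((fun y => F (y, x)) \o shift t) (h *: v) - F (t, x))) by [].
apply/funext => h /=; congr (_ *: (F _ - _)).
by apply: injective_projections => //=; rewrite scaler0 add0r.
Qed.

Lemma zero_derive_cst m n (g : R -> 'M[R]_(m, n)) (a b : R) (A : set R) :
  (forall s : R, 0 <= s <= 1 -> A (a + s * (b - a))) ->
  (forall t, A t -> is_derive t 1 g 0) -> g b = g a.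
Proof.
move=> Aab gA; apply/matrixP => i j.
have gd (s : R) : 0 <= s <= 1 ->
    is_derive (a + s * (b - a)) (b - a) (fun t => g t i j) 0.
  move=> /Aab/gA[gd g0].
  have gij : derivable (fun t => g t i j) (a + s * (b - a)) 1.
    by move/derivable_mxP : gd; apply.
  have := is_derive_scale (b - a) gij.
  rewrite [(b - a) *: (1 : R)]mulr1 (derive_entry _ _ gd) g0 mxE.
  by rewrite [X in is_derive _ _ _ X]mulr0.
have [s s01|s s01] := @line_MVT _ R (fun t => g t i j) a (b - a).
  by have [] := gd s s01.
have [_ ->] := gd s s01.
by rewrite [a + _]addrC subrK => /eqP; rewrite subr_eq0 => /eqP.
Qed.

Context {M : topologicalType} (w : symplectic4 R M).

Lemma locally_constant_connected (X : topologicalType) (T : Type) (h : X -> T) :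
  connected [set: X] -> (forall t, \forall s \near t, h s = h t) ->
  forall s t, h s = h t.
Proof.
move=> cX hl s t; pose B := [set r | h r = h t].
suff : B = setT by move=> /seteqP[_ /(_ s I)].
apply: cX; first by exists t.
  exists B; last by rewrite setTI.
  by rewrite openE => r hr; apply: filterS (hl r) => u; rewrite /B /= hr.
exists B; last by rewrite setTI.
rewrite -openC openE => r hr; apply: filterS (hl r) => u hu hu'; apply: hr.
by rewrite /B /= -hu.
Qed.

Lemma connectedR : connected [set: R].
Proof. by apply/connected_intervalP => a b. Qed.

Lemma zero_velocity_constant (h : R -> M) : continuous h ->
  (forall t c, atlas w c -> cdom c (h t) -> is_derive t 1 (cmap c \o h) 0) ->
  forall s t, h s = h t.
Proof.
move=> hc h0; apply: locally_constant_connected; first exact: connectedR.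
move=> t; have [wc ct] := sm_chart_at w (h t); set c := chart_at w (h t) in wc ct.
have near_t : \forall s \near t, cdom c (h s).
  by apply: hc; apply: open_nbhs_nbhs; split => //; exact: (sm_open wc).1.
have [r /= r0 rP] := (nbhs_ballP _ _).1 near_t.
apply/nbhs_ballP; exists r => //= s sr.
have : (cmap c \o h) s = (cmap c \o h) t.
  apply: (@zero_derive_cst _ _ _ _ _ (ball t r)); last by move=> u /rP ur; exact: h0.
  move=> u /andP[u0 u1]; move: sr; rewrite -!ball_normE /= opprD addrA subrr sub0r normrN normrM.
  by rewrite distrC; apply: le_lt_trans; rewrite ger0_norm// ler_piMl.
move=> /(congr1 (cinv c)) /=.
by rewrite (sm_cancel wc ct) (sm_cancel wc (rP _ sr)).
Qed.

End Curves.

(** * Complete Hamiltonian flows *)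

Section Flow.
Context {R : realType} {M : topologicalType} (w : symplectic4 R M).

(** Stated for an arbitrary space of parameters and an arbitrary open target, since it serves flows,
    torus actions and their composition with a map from another manifold. *)
Lemma open_action_dom (P X : topologicalType) (W : set M) (Q : set X) (rho : P -> M -> X) c :
  open W -> open Q ->
  (forall t p, W p -> {for (t, p), continuous (fun z : P * M => rho z.1 z.2)}) ->
  atlas w c ->
  open [set z : P * 'rV[R]_4 | exists p, [/\ W p, cdom c p, z.2 = cmap c p & Q (rho z.1 p)]].
Proof.
move=> Wo Qo hc wc; rewrite openE => -[t x] [p [/= Wp cp -> dp]].
have near_p : \forall z \near (t, p), Q (rho z.1 z.2).
  exact: (hc t p Wp _ (open_nbhs_nbhs (conj Qo dp))).
have cont : {for (t, cmap c p), continuous (fun z : P * 'rV[R]_4 => (z.1, cinv c z.2))}.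
  have c2 : {for (t, cmap c p), continuous (fun z : P * 'rV[R]_4 => cinv c z.2)}.
    apply: (@continuous_comp _ _ _ snd); first exact: cvg_snd.
    exact: (cinv_continuous wc (mem_cimg cp (I : setT p))).
  have c1 : {for (t, cmap c p), continuous (fun z : P * 'rV[R]_4 => z.1)} by exact: cvg_fst.
  exact: (continuous_pair c1 c2).
rewrite /interior.
have H1 : \forall z \near (t, cmap c p), Q (rho z.1 (cinv c z.2)).
  by apply: (cont (fun z => Q (rho z.1 z.2))); rewrite /= (sm_cancel wc cp).
have H2 : \forall z \near (t, cmap c p), cimg c W z.2.
  exact: (cvg_snd (nbhs_cimg wc Wo cp Wp)).
apply: filterS2 H1 H2 => -[s y] /= dy /(cimg_inv wc)[cy Wy E].
by exists (cinv c y).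
Qed.

(** The flows in question come from circle actions, so completeness, the group law and joint
    smoothness in time and point are data and no differential equation has to be solved. *)
Record ham_flow (f : M -> R) (phi : R -> M -> M) : Prop := {
  hf_fun : smooth_fun w setT f;
  hf_zero : forall p, phi 0 p = p;
  hf_add : forall s t p, phi (s + t) p = phi s (phi t p);
  hf_cont : continuous (fun z : R * M => phi z.1 z.2);
  hf_smooth : forall c d, atlas w c -> atlas w d ->
    smooth_on [set z : R * 'rV[R]_4 | exists p,
                 [/\ cdom c p, z.2 = cmap c p & cdom d (phi z.1 p)]]
              (fun z : R * 'rV[R]_4 => cmap d (phi z.1 (cinv c z.2)));
  hf_curve : forall p, integral_curve w f (fun t => phi t p) }.

Variables (f : M -> R) (phi : R -> M -> M).
Hypothesis Hf : ham_flow f phi.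

Implicit Types (c d : chart R M).

Definition flow_dom c d := [set z : R * 'rV[R]_4 |
  exists p, [/\ cdom c p, z.2 = cmap c p & cdom d (phi z.1 p)]].

Definition flow_rep c d (z : R * 'rV[R]_4) := cmap d (phi z.1 (cinv c z.2)).

Lemma flow_domP c d t p : atlas w c -> cdom c p ->
  flow_dom c d (t, cmap c p) <-> cdom d (phi t p).
Proof.
move=> wc cp; split=> [[q [cq /= E dq]]|dp]; last by exists p.
by rewrite -(sm_cancel wc cp) E (sm_cancel wc cq).
Qed.

Lemma open_flow_dom c d : atlas w c -> atlas w d -> open (flow_dom c d).
Proof.
move=> wc wd.
have := open_action_dom (rho := phi) openT (sm_open wd).1 (fun t p _ => hf_cont Hf (x := (t, p))) wc.
by congr open; apply/seteqP; split=> z [p]; [case=> _ *; exists p|case=> *; exists p].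
Qed.

Lemma flow_rep_smooth c d : atlas w c -> atlas w d ->
  smooth_on (flow_dom c d) (flow_rep c d).
Proof. by move=> wc wd; exact: (hf_smooth Hf wc wd). Qed.

Lemma flow_rep_differentiable c d t p : atlas w c -> atlas w d -> cdom c p ->
  cdom d (phi t p) -> differentiable (flow_rep c d) (t, cmap c p).
Proof.
move=> wc wd cp dp.
apply: (smooth_on_differentiable (open_flow_dom wc wd) _ _ (flow_rep_smooth wc wd)).
by exists p.
Qed.

Lemma flow_map_continuous t : continuous (phi t).
Proof.
move=> p; apply: (@continuous_comp _ _ _ (fun q => (t, q)) (fun z : R * M => phi z.1 z.2)).
  by apply: continuous_pair; [exact: cvg_cst|exact: cvg_id].
exact: (hf_cont Hf).
Qed.

Lemma flow_between t : smooth_between w w (phi t).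
Proof.
split; first exact: flow_map_continuous.
move=> c d wc wd.
have oc : open (phi t @^-1` cdom d).
  by have /continuousP := @flow_map_continuous t; apply; exact: (sm_open wd).1.
have io := open_cimg wc oc.
apply: (@smooth_on_comp _ _ _ io _ _ _ _ (flow_dom c d) (fun x => (t, x)) (flow_rep c d)).
- exact: open_flow_dom.
- by move=> x [p [cp dp] <-]; exists p.
- exact: flow_rep_smooth.
- by apply: smooth_on_pair => //; [exact: smooth_on_cst|exact: smooth_on_id].
Qed.

Lemma derive_flow_time c d t p : atlas w c -> atlas w d -> cdom c p ->
  cdom d (phi t p) -> 'D_(1, 0) (flow_rep c d) (t, cmap c p) = hamvec w d f (cmap d (phi t p)).
Proof.
move=> wc wd cp dp; rewrite derive_fst.
have [_ /(_ t d wd dp)[_ <-]] := hf_curve Hf p.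
by congr ('D_1 _ t); apply/funext => s; rewrite /flow_rep /= (sm_cancel wc cp).
Qed.

Lemma derive_flow_space c d t p v : atlas w c -> atlas w d -> cdom c p ->
  cdom d (phi t p) ->
  'D_(0, v) (flow_rep c d) (t, cmap c p) = v *m tangent c d (phi t) p.
Proof.
move=> wc wd cp dp; rewrite derive_snd /tangent -deriveEjacobian//.
exact: (local_rep_differentiable (flow_between t)).
Qed.

Lemma derive_flow c d t p a v : atlas w c -> atlas w d -> cdom c p ->
  cdom d (phi t p) ->
  'D_(a, v) (flow_rep c d) (t, cmap c p) =
  a *: hamvec w d f (cmap d (phi t p)) + v *m tangent c d (phi t) p.
Proof.
move=> wc wd cp dp; have Pd := flow_rep_differentiable wc wd cp dp.
have -> : (a, v) = a *: (1, 0) + (0, v) :> R * 'rV[R]_4.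
  by apply: injective_projections; rewrite /= ?addr0 ?scaler0 ?add0r//; exact/esym/mulr1.
by rewrite derive_dirD// derive_dirZ// derive_flow_time// derive_flow_space.
Qed.

Lemma flow_curve c d (g : R -> M) (al : R -> R) t a v : atlas w c -> atlas w d ->
  {for t, continuous g} -> cdom c (g t) -> cdom d (phi (al t) (g t)) ->
  is_derive t 1 (cmap c \o g) v -> is_derive t 1 al a ->
  is_derive t 1 (fun s => cmap d (phi (al s) (g s)))
    (a *: hamvec w d f (cmap d (phi (al t) (g t))) + v *m tangent c d (phi (al t)) (g t)).
Proof.
move=> wc wd gc cg dg gv ala.
have Pd := flow_rep_differentiable wc wd cg dg.
have pv := is_derive_pair ala gv.
have := is_derive_comp (@ex_derive _ _ _ _ _ _ _ pv) Pd.
rewrite (@derive_val _ _ _ _ _ _ _ pv) derive_flow//.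
apply: near_eq_is_derive.
have H : \forall s \near t, cdom c (g s).
  by apply: gc; apply: open_nbhs_nbhs; split => //; exact: (sm_open wc).1.
by apply: filterS H => s cs; rewrite /flow_rep /= (sm_cancel wc cs).
Qed.

Lemma flow_continuous_curve (g : R -> M) (al : R -> R) t :
  {for t, continuous g} -> {for t, continuous al} ->
  {for t, continuous (fun s => phi (al s) (g s))}.
Proof.
move=> gc ac; apply: (@continuous_comp _ _ _ (fun s => (al s, g s)) (fun z : R * M => phi z.1 z.2)).
  exact: continuous_pair.
exact: (hf_cont Hf).
Qed.

(** Both sides are the velocity at [s = 0] of [s |-> phi (s + t) p], computed once through the map
    [phi t] and once along the orbit. *)
Lemma flow_preserves_hamvec c d t p : atlas w c -> atlas w d -> cdom c p ->
  cdom d (phi t p) ->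
  hamvec w c f (cmap c p) *m tangent c d (phi t) p = hamvec w d f (cmap d (phi t p)).
Proof.
move=> wc wd cp dp.
have [gc /(_ 0 c wc)] := hf_curve Hf p; rewrite (hf_zero Hf) => /(_ cp) gv.
have c0 : {for 0, continuous (fun s : R => phi s p)} by exact: gc.
have := @flow_curve c d (fun s => phi s p) (fun=> t) 0 0 _ wc wd c0.
rewrite (hf_zero Hf) => /(_ _ cp dp gv (is_derive_cst _ _ _))[_ E1].
rewrite scale0r add0r in E1; rewrite -E1.
have [_ /(_ t d wd dp)[_ <-]] := hf_curve Hf p.
have E := derive_translate (fun s => cmap d (phi s p)) 0 1 t.
rewrite add0r in E; apply: etrans E.
congr (derive _ (0 : R) (1 : R)); apply/funext => s.
by rewrite -(hf_add Hf) addrC.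
Qed.

(** The curve [phi (- s) (g s)] has as velocity minus the field plus the field carried along by the
    flow, which is 0, so it is constant. The known flow takes the place of a Lipschitz estimate. *)
Lemma flow_unique (g : R -> M) : integral_curve w f g -> forall t, g t = phi t (g 0).
Proof.
move=> [gc gd] t; pose h s := phi (- s) (g s).
suff : h t = h 0.
  rewrite /h oppr0 (hf_zero Hf) => /(congr1 (phi t)).
  by rewrite -(hf_add Hf) subrr (hf_zero Hf).
apply: (@zero_velocity_constant _ _ w).
  by move=> s; apply: flow_continuous_curve; [exact: gc|exact: opp_continuous].
move=> s d wd ds; have [wc cs] := sm_chart_at w (g s).
have opp_d : is_derive s (1 : R) (fun r : R => - r) (- 1).
  by apply: is_deriveN.
have := flow_curve wc wd (gc s) cs ds (gd s _ wc cs) opp_d.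
by rewrite (flow_preserves_hamvec wc wd cs ds) scaleN1r addNr.
Qed.

End Flow.

Lemma preserves_form_id (R : realType) (M : topologicalType) (w : symplectic4 R M) :
  preserves_form w w id.
Proof.
by move=> p; have [wc cp] := sm_chart_at w p; exact: (omega_tangent wc wc cp cp).
Qed.

Definition commuting (R : realType) (M : topologicalType) (w : symplectic4 R M)
    (f g : M -> R) :=
  forall c p, atlas w c -> cdom c p ->
    bl (omega w c (cmap c p)) (hamvec w c f (cmap c p)) (hamvec w c g (cmap c p)) = 0.

(** * Commutation of the flows of Poisson commuting functions *)

Section Commute.
Context {R : realType} {M : topologicalType} (w : symplectic4 R M).
Implicit Types (c d : chart R M).
Variables (f g : M -> R) (phi : R -> M -> M).
Hypotheses (Hf : ham_flow w f phi) (gs : smooth_fun w setT g) (fg : commuting w f g).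

Let fs : smooth_fun w setT f := hf_fun Hf.

Lemma dloc_bl c (h : M -> R) x v : atlas w c -> smooth_fun w setT h -> cimg c setT x ->
  'D_v (h \o cinv c) x = bl (omega w c x) (hamvec w c h x) v.
Proof.
move=> wc hs cx; rewrite (dloc_jacobian v wc openT hs cx) /bl.
by rewrite (hamvecE h wc cx).
Qed.

Lemma commuting_bracket c p : atlas w c -> cdom c p ->
  'D_(hamvec w c g (cmap c p)) (hamvec w c f) (cmap c p) =
  'D_(hamvec w c f (cmap c p)) (hamvec w c g) (cmap c p).
Proof.
move=> wc cp; have io := open_cimg wc openT.
apply: (@poisson_commute_bracket R (cimg c setT) (omega w c) (f \o cinv c) (g \o cinv c)
  (hamvec w c f) (hamvec w c g)) => //.
- exact: mem_cimg.
- exact: omega_smooth_cimg.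
- exact: fs.
- exact: gs.
- exact: (hamvec_smooth wc openT fs).
- exact: (hamvec_smooth wc openT gs).
- by move=> y; exact: omega_unit.
- by move=> _ [q [cq _] <-]; exact: omega_skew.
- by move=> _ i j k [q [cq _] <-]; exact: (omega_closed i j k wc cq).
- by move=> y v cy; exact: dloc_bl.
- by move=> y v cy; exact: dloc_bl.
- by move=> _ [q [cq _] <-]; exact: fg.
Qed.

(** The space derivative of the flow as a function of time and point together, so that it can be
    differentiated in both; it agrees with [tangent] at each time and point. *)
Let JP d (z : R * 'rV[R]_4) : 'M[R]_4 :=
  \matrix_(i, j) ('D_(0, delta_mx 0 i) (flow_rep phi d d) z) 0 j.

Let JP_smooth d : atlas w d -> smooth_on (flow_dom phi d d) (JP d).
Proof.
move=> wd; have Oo := open_flow_dom Hf wd wd.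
apply: (smooth_on_mx Oo) => i j.
apply: (smooth_on_ext Oo (f := fun z => ('D_(0, delta_mx 0 i) (flow_rep phi d d) z) 0 j)).
  by move=> z _; rewrite mxE.
apply: (smooth_on_entry Oo); apply: smooth_on_derive; exact: (flow_rep_smooth Hf wd wd).
Qed.

Let JP_tangent d t p : atlas w d -> cdom d p -> cdom d (phi t p) ->
  JP d (t, cmap d p) = tangent d d (phi t) p.
Proof.
move=> wd dp dtp; apply/matrixP => i j; rewrite mxE.
by rewrite (derive_flow_space Hf _ wd wd dp dtp) -rowE mxE.
Qed.

Let phi0 : phi 0 = id.
Proof. by apply/funext => p; exact: (hf_zero Hf). Qed.

(** At time 0 the space derivative is 1 at every point, so only the time part of the direction
    counts; exchanging the derivatives turns it into the space derivative of the velocity field. The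
    direction is the velocity at [u = s] of [(s - u, phi u q)] in the chart, as needed for [Z]. *)
Let JP_derive d p : atlas w d -> cdom d p ->
  'D_(-1, hamvec w d f (cmap d p)) (JP d) (0, cmap d p) =
  - 'J (hamvec w d f) (cmap d p).
Proof.
move=> wd dp; have Oo := open_flow_dom Hf wd wd.
have Oz : flow_dom phi d d (0, cmap d p) by apply/(flow_domP phi d 0 wd dp); rewrite phi0.
have Jd : differentiable (JP d) (0, cmap d p).
  exact: (smooth_on_differentiable Oo _ _ (JP_smooth wd) Oz).
set X := hamvec w d f (cmap d p).
have -> : (-1, X) = - (1, 0) + (0, X) :> R * 'rV[R]_4.
  by apply: injective_projections; rewrite /= ?oppr0 ?addr0 ?add0r.
rewrite derive_dirD// derive_dirN//.
have near_d (P : 'rV[R]_4 -> Prop) : (forall q, cdom d q -> P (cmap d q)) ->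
    \forall y \near cmap d p, P y.
  move=> dP; apply: filterS (nbhs_cimg wd openT dp I) => _ [q [dq _] <-]; exact: dP.
have -> : 'D_(0, X) (JP d) (0, cmap d p) = 0.
  rewrite derive_snd -(derive_cst (1%:M : 'M[R]_4) (cmap d p) X).
  apply: near_eq_derive; apply: near_d => q dq.
  by rewrite JP_tangent ?phi0// (tangent_id wd dq).
rewrite addr0; congr (- _); apply/matrixP => i j.
have io := open_cimg wd openT.
have Xs := hamvec_smooth wd openT fs.
have Xd : differentiable (hamvec w d f) (cmap d p).
  exact: (smooth_on_differentiable io _ _ Xs (mem_cimg dp I)).
rewrite -derive_entry; last exact: diff_derivable.
have Ps := flow_rep_smooth Hf wd wd.
transitivity ('D_(1, 0) ('D_(0, delta_mx 0 i) (flow_rep phi d d)) (0, cmap d p) 0 j).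
  rewrite -derive_entry; last exact: (smooth_on_derivable (smooth_on_derive _ Ps) Oz).
  have -> : (fun z => JP d z i j) = (fun z => ('D_(0, delta_mx 0 i) (flow_rep phi d d) z) 0 j).
    by apply/funext => z; rewrite /JP mxE.
  by [].
rewrite (derive_comm _ _ _ Oo Ps Oz) derive_snd.
have -> : 'D_(delta_mx 0 i) (fun y => 'D_(1, 0) (flow_rep phi d d) (0, y)) (cmap d p) =
    'D_(delta_mx 0 i) (hamvec w d f) (cmap d p).
  apply: near_eq_derive; apply: near_d => q dq.
  by rewrite (derive_flow_time Hf wd wd dq) phi0.
by rewrite -row_jacobian// mxE.
Qed.

(** At a zero of the field the direction (-1, X) of [JP_derive] is purely temporal, which gives the
    time derivative up to sign. *)
Lemma flow_linearization d p : atlas w d -> cdom d p -> hamvec w d f (cmap d p) = 0 ->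
  (forall t, phi t p = p) ->
  is_derive (0 : R) 1 (fun t => tangent d d (phi t) p) ('J (hamvec w d f) (cmap d p)).
Proof.
move=> wd dp X0 pp; have Oo := open_flow_dom Hf wd wd.
have Oz : flow_dom phi d d (0, cmap d p) by apply/(flow_domP phi d 0 wd dp); rewrite phi0.
have Jd : differentiable (JP d) (0, cmap d p).
  exact: (smooth_on_differentiable Oo _ _ (JP_smooth wd) Oz).
have zd : is_derive (0 : R) (1 : R) (fun t : R => (t, cmap d p)) (1, 0).
  exact: (is_derive_pair (is_derive_id _ _) (is_derive_cst _ _ _)).
have := is_derive_comp (@ex_derive _ _ _ _ _ _ _ zd) Jd.
rewrite (@derive_val _ _ _ _ _ _ _ zd).
have -> : 'D_(1, 0) (JP d) (0, cmap d p) = 'J (hamvec w d f) (cmap d p).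
  have E : (-1, 0) = - (1, 0) :> R * 'rV[R]_4.
    by apply: injective_projections; rewrite /= ?oppr0.
  by have := JP_derive wd dp; rewrite X0 E (derive_dirN _ Jd) => /oppr_inj.
suff -> : JP d \o (fun t : R => (t, cmap d p)) = (fun t => tangent d d (phi t) p) by [].
by apply/funext => t /=; rewrite JP_tangent ?pp.
Qed.

(** The field of [g] at [phi s q], carried back to [q] by the flow of [f]; up to sign, its
    derivative in [s] is the Lie bracket of the two fields, transported to [q]. *)
Let Z c q s := let d := chart_at w (phi s q) in
  hamvec w d g (cmap d (phi s q)) *m tangent d c (phi (- s)) (phi s q).

Let Z_chart c d q s : atlas w c -> atlas w d -> cdom c q -> cdom d (phi s q) ->
  Z c q s = hamvec w d g (cmap d (phi s q)) *m tangent d c (phi (- s)) (phi s q).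
Proof.
move=> wc wd cq dq; have [wd0 dq0] := sm_chart_at w (phi s q).
have ids := smooth_between_id w.
rewrite /Z (hamvec_comp ids (@preserves_form_id _ _ w) wd wd0 dq dq0 openT I gs) -mulmxA.
congr (_ *m _); rewrite -(tangent_comp ids (flow_between Hf (- s)) wd wd0 dq dq0 wc)//=.
by rewrite -(hf_add Hf) addNr (hf_zero Hf).
Qed.

Let Z_derive c q (s : R) : atlas w c -> cdom c q -> is_derive s 1 (Z c q) 0.
Proof.
move=> wc cq; have [wd dq] := sm_chart_at w (phi s q).
set d := chart_at w (phi s q) in wd dq; set r := phi s q in dq.
pose m u := cmap d (phi u q); pose X := hamvec w d f (cmap d r).
have [phic /(_ s d wd dq) md] := hf_curve Hf q.
rewrite -/r -/X in md.
have near_s (P : M -> Prop) : (\forall p \near r, P p) -> \forall u \near s, P (phi u q).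
  by move=> rP; exact: (phic s _ rP).
have dnear : \forall u \near s, cdom d (phi u q).
  by apply: near_s; exact: open_nbhs_nbhs (conj (sm_open wd).1 dq).
pose C := tangent d c (phi (- s)) r.
(* Writing [phi (- u)] as [phi (- s)] after [phi (s - u)] keeps all varying factors in the single
   chart [d]; the last factor [C] is constant. *)
have near_Z : \forall u \near s, hamvec w d g (m u) *m JP d (s - u, m u) *m C = Z c q u.
  apply: filterS dnear => u du.
  have rE : phi (s - u) (phi u q) = r by rewrite -(hf_add Hf) subrK.
  rewrite (Z_chart wc wd cq du) -mulmxA; congr (_ *m _).
  rewrite /m JP_tangent ?rE//.
  have -> : C = tangent d c (phi (- s)) (phi (s - u) (phi u q)) by rewrite rE.
  have du' : cdom d (phi (s - u) (phi u q)) by rewrite rE.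
  have cu : cdom c (phi (- s) (phi (s - u) (phi u q))).
    by rewrite rE /r -(hf_add Hf) addNr (hf_zero Hf).
  have <- := tangent_comp (flow_between Hf (s - u)) (flow_between Hf (- s)) wd wd du du' wc cu.
  suff -> : phi (- s) \o phi (s - u) = phi (- u) by [].
  by apply/funext => p /=; rewrite -(hf_add Hf) addrA addNr add0r.
apply: near_eq_is_derive near_Z _.
have io := open_cimg wd openT.
have Yd : differentiable (hamvec w d g) (m s).
  exact: (smooth_on_differentiable io _ _ (hamvec_smooth wd openT gs) (mem_cimg dq I)).
have Xd : differentiable (hamvec w d f) (cmap d r).
  exact: (smooth_on_differentiable io _ _ (hamvec_smooth wd openT fs) (mem_cimg dq I)).
have Oo := open_flow_dom Hf wd wd.
have Oz : flow_dom phi d d (s - s, m s).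
  by rewrite subrr; apply/(flow_domP phi d 0 wd dq); rewrite phi0.
have Jd : differentiable (JP d) (s - s, m s).
  exact: (smooth_on_differentiable Oo _ _ (JP_smooth wd) Oz).
have sd : is_derive s (1 : R) (fun u : R => s - u) (- 1).
  by have := is_deriveB (is_derive_cst s s 1) (is_derive_id s 1); rewrite sub0r.
have zd := is_derive_pair sd md.
have Y1 := is_derive_comp (@ex_derive _ _ _ _ _ _ _ md) Yd.
have J1 := is_derive_comp (@ex_derive _ _ _ _ _ _ _ zd) Jd.
rewrite (@derive_val _ _ _ _ _ _ _ md) in Y1; rewrite (@derive_val _ _ _ _ _ _ _ zd) in J1.
have N1 := derive_mulmx (@ex_derive _ _ _ _ _ _ _ Y1) (@ex_derive _ _ _ _ _ _ _ J1).
have N2 := derive_mulmx (@ex_derive _ _ _ _ _ _ _ N1) (derivable_cst C s 1).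
apply: (is_derive_eq N2).
rewrite derive_cst mulmx0 addr0 (@derive_val _ _ _ _ _ _ _ N1).
rewrite (@derive_val _ _ _ _ _ _ _ Y1) (@derive_val _ _ _ _ _ _ _ J1) /= subrr.
rewrite (JP_derive wd dq) (JP_tangent wd dq) ?phi0// (tangent_id wd dq) mulmx1 mulmxN.
rewrite -[X in _ - X](deriveEjacobian (hamvec w d g (cmap d r)) Xd).
by rewrite (commuting_bracket wd dq) subrr mul0mx.
Qed.

Lemma flow_preserves_commuting c d s q : atlas w c -> atlas w d -> cdom c q ->
  cdom d (phi s q) ->
  hamvec w c g (cmap c q) *m tangent c d (phi s) q = hamvec w d g (cmap d (phi s q)).
Proof.
move=> wc wd cq dq.
have -> : hamvec w c g (cmap c q) = Z c q s.
  have -> : Z c q s = Z c q 0.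
    by apply: (@zero_derive_cst _ _ _ _ _ _ setT) => // t _; exact: Z_derive.
  by rewrite (Z_chart wc wc cq) ?phi0// oppr0 phi0 (tangent_id wc cq) mulmx1.
have qE : phi (- s) (phi s q) = q by rewrite -(hf_add Hf) addNr (hf_zero Hf).
rewrite (Z_chart wc wd cq dq) -mulmxA -[X in tangent c d _ X]qE.
have cq' : cdom c (phi (- s) (phi s q)) by rewrite qE.
have dq' : cdom d (phi s (phi (- s) (phi s q))) by rewrite qE.
have <- := tangent_comp (flow_between Hf (- s)) (flow_between Hf s) wd wc dq cq' wd dq'.
have -> : phi s \o phi (- s) = id.
  by apply/funext => p /=; rewrite -(hf_add Hf) subrr (hf_zero Hf).
by rewrite (tangent_id wd dq) mulmx1.
Qed.

(** [phi s] carries integral curves of [g] to integral curves of [g], and these are determined by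
    their initial points. *)
Lemma flows_commute psi : ham_flow w g psi -> forall s t p,
  phi s (psi t p) = psi t (phi s p).
Proof.
move=> Hg s t p; rewrite -[in RHS](hf_zero Hg p).
apply: (@flow_unique _ _ w g psi Hg (fun u => phi s (psi u p))).
have [pc pd] := hf_curve Hg p.
split=> [u|u d wd du].
  by apply: (continuous_comp (pc u)); exact: (flow_map_continuous Hf).
have [wc cu] := sm_chart_at w (psi u p).
have := flow_curve Hf wc wd (pc u) cu du (pd u _ wc cu) (is_derive_cst s u 1).
by rewrite scale0r add0r (flow_preserves_commuting wc wd cu du).
Qed.

End Commute.

(** * Maps of finite order *)

Section FiniteOrder.
Context {R : realType} {M : topologicalType} (w : symplectic4 R M).
Variables (phi : M -> M) (k : nat).
Hypotheses (phis : smooth_between w w phi) (phik : forall p, iter k.+1 phi p = p).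
Implicit Types (c : chart R M).

Let iters i : smooth_between w w (iter i phi).
Proof.
by elim: i => [|i IH]; [exact: smooth_between_id|exact: (smooth_between_comp IH phis)].
Qed.

Let iter_fix i p : phi p = p -> iter i phi p = p.
Proof. by move=> pp; elim: i => //= i ->. Qed.

Let iter_tangent c p i : atlas w c -> cdom c p -> phi p = p -> tangent c c phi p = 1%:M ->
  tangent c c (iter i phi) p = 1%:M.
Proof.
move=> wc cp pp tp; elim: i => [|i IH]; first exact: (tangent_id wc cp).
have cip : cdom c (iter i phi p) by rewrite iter_fix.
have cpp : cdom c (phi (iter i phi p)) by rewrite iter_fix// pp.
have -> : iter i.+1 phi = phi \o iter i phi by [].
by rewrite (tangent_comp (iters i) phis wc wc cp cip wc cpp) IH iter_fix// tp mulmx1.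
Qed.

(* The average of the charts [c \o phi^i] is a [phi]-invariant local chart at the
   fixed point; its injectivity forces [phi] to be the identity nearby. *)
Lemma finite_order_near c p : atlas w c -> cdom c p -> phi p = p ->
  tangent c c phi p = 1%:M -> \forall q \near p, phi q = q.
Proof.
move=> wc cp pp tp.
pose O := [set q | forall i : 'I_k.+1, cdom c (iter i phi q)].
have Oo : open O.
  rewrite openE => q Oq; rewrite /interior; apply: filter_forall => i.
  apply: open_nbhs_nbhs; split; last exact: Oq.
  exact: (open_preimage (iters i) (sm_open wc).1).
have Op : O p by move=> i; rewrite iter_fix.
pose psi x := \sum_(i < k.+1) local_rep c c (iter i phi) x.
have io := open_cimg wc Oo.
have rep_smooth (i : 'I_k.+1) : smooth_on (cimg c O) (local_rep c c (iter i phi)).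
  apply: smooth_on_sub ((iters i).2 c c wc wc) => _ [q [cq Oq] <-].
  by exists q => //; split => //; exact: Oq.
have psis : smooth_on (cimg c O) psi by apply: smooth_on_sum.
have cO := mem_cimg cp Op.
have psiJ : 'J psi (cmap c p) = k.+1%:R%:M.
  apply: jacobian_eq; first exact: (smooth_on_differentiable io _ _ psis cO).
  move=> v.
  have di (i : 'I_k.+1) : is_derive (cmap c p) v (local_rep c c (iter i phi)) v.
    have dd : differentiable (local_rep c c (iter i phi)) (cmap c p).
      exact: (smooth_on_differentiable io _ _ (rep_smooth i) cO).
    split; first exact: diff_derivable.
    by rewrite deriveEjacobian// -/(tangent c c (iter i phi) p) iter_tangent// mulmx1.
  have -> : psi = \sum_(i < k.+1) local_rep c c (iter i phi).
    by apply/funext => x; rewrite fct_sumE.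
  have [_ ->] := is_derive_sum di.
  by rewrite sumr_const card_ord mul_mx_scalar scaler_nat.
have Ju : 'J psi (cmap c p) \in unitmx.
  by rewrite psiJ unitmxE det_scalar unitfE expf_neq0// pnatr_eq0.
have [r r0 rP] := local_injectivity io psis cO Ju.
have ballp : nbhs (cmap c p) (ball (cmap c p) r) by exact: nbhsx_ballx.
have H1 := nbhs_cmap wc cp ballp.
have H2 : \forall q \near p, cdom c (phi q) /\ ball (cmap c p) r (cmap c (phi q)).
  by have pc := phis.1 p; rewrite /continuous_at pp in pc; exact: (pc _ H1).
apply: filterS2 H1 H2 => q [cq bq] [cpq bpq].
suff /(congr1 (cinv c)) : cmap c (phi q) = cmap c q.
  by rewrite (sm_cancel wc cq) (sm_cancel wc cpq).
apply: rP => //.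
rewrite /psi /local_rep /= (sm_cancel wc cq) (sm_cancel wc cpq).
(* Precomposing with [phi] shifts the summands by one; the last of them, the chart after k+1
   iterations, is the chart itself and takes the place of the first. *)
rewrite big_ord_recr big_ord_recl /= addrC; congr (_ + _).
  by rewrite -iterSr phik.
by apply: eq_bigr => i _; rewrite -iterSr.
Qed.

(** The points near which [phi] is the identity form an open set. It is also closed: [phi] fixes a
    limit point because the space is Hausdorff, its derivative there is 1 by continuity, and the
    local statement applies again. *)
Lemma finite_order_trivial c p : connected [set: M] -> atlas w c -> cdom c p ->
  phi p = p -> tangent c c phi p = 1%:M -> forall q, phi q = q.
Proof.
move=> Mc wc cp pp tp q.
pose A : set M := [set q : M | \forall q' \near q, phi q' = q'].
suff : A = setT by move=> /seteqP[_ /(_ q I)] /nbhs_singleton.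
apply: Mc; first by exists p; exact: finite_order_near cp pp tp.
  exists A; last by rewrite setTI.
  by rewrite openE => x; exact: nbhs_interior.
exists (closure A); first exact: closed_closure.
rewrite setTI; apply/seteqP; split; first exact: subset_closure.
move=> x Ax; have [wd dx] := sm_chart_at w x; set d := chart_at w x in wd dx.
have xx : phi x = x.
  apply: (sm_hausdorff w) => U V Ux Vx.
  have Ux' : \forall y \near x, U (phi y) := phis.1 x _ Ux.
  have [y [Ay [Uy Vy]]] := Ax _ (filterI Ux' Vx).
  by exists (phi y); split => //; rewrite (nbhs_singleton Ay).
apply: (finite_order_near wd dx xx); apply: contrapT => ne.
have Oo : open (phi @^-1` cdom d) by exact: open_preimage phis (sm_open wd).1.
have io := open_cimg wd Oo.
have dpx : (phi @^-1` cdom d) x by rewrite /preimage /= xx.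
have Jc := smooth_on_continuous (smooth_on_jacobian io (phis.2 d d wd wd)) (mem_cimg dx dpx).
have opn : open (~` [set (1%:M : 'M[R]_4)]).
  exact/closed_openC/(accessible_closed_set1 (hausdorff_accessible (@norm_hausdorff _ _))).
have ne1 : \forall y \near cmap d x, 'J (local_rep d d phi) y <> 1%:M.
  exact: (Jc _ (open_nbhs_nbhs (conj opn ne))).
have [y [Ay [dy]]] := Ax _ (nbhs_cmap wd dx ne1).
apply; rewrite -(tangent_id wd dy).
have [U Uo [Uy UA]] : exists2 U : set M, open U & U y /\ forall z, U z -> phi z = z.
  exists (A); first by rewrite openE => z; exact: nbhs_interior.
  by split; [exact: Ay|move=> z Az; exact: (nbhs_singleton Az)].
have iU := open_cimg wd Uo.
have idU : smooth_on (cimg d U) (local_rep d d id).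
  apply: smooth_on_sub ((smooth_between_id w).2 d d wd wd) => _ [z [dz Uz] <-].
  exact: (ex_intro2 _ _ z (conj dz dz) erefl).
apply: (jacobian_ext iU idU (mem_cimg dy Uy)) => z /(cimg_inv wd)[_ Uz _].
by rewrite /local_rep /= UA.
Qed.

End FiniteOrder.

(** * Focus-focus linearizations *)

Section Rotation.
Context {R : realType}.
Implicit Types (s d t : R).

Lemma is_derive_scaled_arg (g : R -> R) (a t dg : R) :
  is_derive (a * t) 1 g dg -> is_derive t 1 (fun h => g (a * h)) (a * dg).
Proof.
move=> [gd <-].
have := derivable_line g 0 a t; have := derive_line g 0 a t.
rewrite add0r -[t *: a]/(t * a) [t * a]mulrC.
have [ga ->] : is_derive (a * t) a g (a *: 'D_1 g (a * t)).
  by have := is_derive_scale a gd; rewrite -[a *: 1]/(a * 1) mulr1.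
have -> : (fun h : R => g (0 + h *: a)) = (fun h => g (a * h)).
  by apply/funext => h; rewrite add0r -[h *: a]/(h * a) mulrC.
by move=> E gi; split; [exact: (gi.2 ga)|exact: E].
Qed.

(** Multiplication by [expR (- d * t)] and the inverse rotation turn (u, v) into the pair [P], [Q],
    whose derivatives vanish. *)
Lemma rotation_solution (u v : R -> R) s d :
  (forall t, is_derive t 1 u (d * u t + s * v t)) ->
  (forall t, is_derive t 1 v (- s * u t + d * v t)) -> forall t,
  u t = expR (d * t) * (u 0 * cos (s * t) + v 0 * sin (s * t)) /\
  v t = expR (d * t) * (- u 0 * sin (s * t) + v 0 * cos (s * t)).
Proof.
move=> ud vd t.
pose E t := expR (- d * t); pose C t := cos (s * t); pose S t := sin (s * t).
have Ed (r : R) : is_derive r 1 E (- d * E r) by exact: is_derive_scaled_arg.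
have Cd (r : R) : is_derive r 1 C (s * - S r) by exact: is_derive_scaled_arg.
have Sd (r : R) : is_derive r 1 S (s * C r) by exact: is_derive_scaled_arg.
have mulD (f g : R -> R) (r a b : R) : is_derive r 1 f a -> is_derive r 1 g b ->
    is_derive r 1 (fun x => f x * g x) (a * g r + f r * b).
  move=> fd gd; have := is_deriveM fd gd.
  by rewrite -[f r *: b]/(f r * b) -[g r *: a]/(g r * a) [g r * a]mulrC addrC.
pose P x := E x * (u x * C x - v x * S x); pose Q x := E x * (u x * S x + v x * C x).
have Pd (r : R) : is_derive r 1 P 0.
  have := mulD _ _ _ _ _ (Ed r) (is_deriveB (mulD _ _ _ _ _ (ud r) (Cd r)) (mulD _ _ _ _ _ (vd r) (Sd r))).
  move=> H; apply: (is_derive_eq H); rewrite -[(_ - _) r]/(u r * C r - v r * S r); ring.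
have Qd (r : R) : is_derive r 1 Q 0.
  have := mulD _ _ _ _ _ (Ed r) (is_deriveD (mulD _ _ _ _ _ (ud r) (Sd r)) (mulD _ _ _ _ _ (vd r) (Cd r))).
  move=> H; apply: (is_derive_eq H).
  rewrite -[((fun x => u x * S x) + _) r]/(u r * S r + v r * C r); ring.
have P0 : P t = P 0 by exact: is_derive_0_is_cst.
have Q0 : Q t = Q 0 by exact: is_derive_0_is_cst.
rewrite /P /Q in P0 Q0.
rewrite /E /C /S !mulr0 expR0 cos0 sin0 !mulr0 !mulr1 subr0 add0r !mul1r in P0 Q0.
rewrite -P0 -Q0.
have e1 : expR (d * t) * expR (- d * t) = 1 by rewrite -expRD -mulrDl subrr mul0r expR0.
have cs := cos2Dsin2 (s * t).
move: e1 cs; move: (expR (d * t)) (expR (- d * t)) (cos (s * t)) (sin (s * t)) (u t) (v t).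
move=> e e' c' s' a b e1 cs; split.
  transitivity ((e * e') * (c' ^+ 2 + s' ^+ 2) * a); first by rewrite e1 cs !mul1r.
  by ring.
transitivity ((e * e') * (c' ^+ 2 + s' ^+ 2) * b); first by rewrite e1 cs !mul1r.
by ring.
Qed.

(** Removing the integral part leaves [r] in [0, 1) with the same cosine. The half-angle formula
    gives sin(r pi) = 0, impossible for 0 < r < 1. *)
Lemma cos_eq1_int s : cos (s * (2 * pi)) = 1 :> R -> exists k : int, s = k%:~R.
Proof.
move=> c1; exists (Num.floor s).
pose r := s - (Num.floor s)%:~R.
have r0 : 0 <= r by rewrite subr_ge0 Num.Theory.floor_le_tmp.
have r1 : r < 1 by rewrite ltrBlDl -[X in _ + X]/(1%:~R) -rmorphD; exact: Num.Theory.floorD1_gt.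
have per (k : int) (x : R) : cos (x + k%:~R * (2 * pi)) = cos x.
  have pn (n : nat) (y : R) : cos (y + n%:R * (2 * pi)) = cos y.
    by rewrite mulr_natl [2 * pi]mulr_natl; exact: (periodicn (@cosD2pi R)).
  case: k => n; first exact: pn.
  by rewrite NegzE mulrNz mulNr -(pn n.+1 (x - _)) subrK.
have cr : cos (r * (2 * pi)) = 1.
  by rewrite /r mulrBl -mulNr -rmorphN per.
suff : r = 0 by move=> /eqP; rewrite subr_eq0 => /eqP.
apply/eqP/negPn/negP => rne; have {}r0 : 0 < r by rewrite lt0r rne.
have p0 : 0 < pi :> R := pi_gt0 R.
have : cos (r * pi) ^+ 2 = 1.
  have := cosD (r * pi) (r * pi); rewrite -mulrDr -mulr2n -mulr_natl cr.
  have := cos2Dsin2 (r * pi); move: (cos _) (sin _) => a b; rewrite !expr2; lra.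
move=> c2; have : 0 < sin (r * pi).
  by apply: sin_gt0_pi; rewrite mulr_gt0//= gtr_pMl.
have : sin (r * pi) ^+ 2 = 0 by rewrite sin2cos2 c2 subrr.
by move/eqP; rewrite sqrf_eq0 => /eqP ->; rewrite ltxx.
Qed.

Definition rot2 (a b : R) : 'M[R]_2 :=
  \matrix_(i, j) if i == j then a else if i == 0 then b else - b.

(** The element of sp(4) with quadratic form [s * ff_form1 + d * ff_form2]: it rotates the x-plane
    and the y-plane at the common speed [s] and scales them at the opposite rates [d] and [- d]. *)
Definition ff_mx s d : 'M[R]_(2 + 2) := block_mx (rot2 d s) 0 0 (rot2 (- d) s).

Definition rot4 t : 'M[R]_(2 + 2) :=
  block_mx (rot2 (cos t) (sin t)) 0 0 (rot2 (cos t) (sin t)).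

Lemma rot2_mul a b a' b' : rot2 a b *m rot2 a' b' = rot2 (a * a' - b * b') (a * b' + b * a').
Proof.
apply/matrixP => i j; rewrite !mxE big_ord_recl big_ord1 !mxE.
case: i => [[|[|//]] i2]; case: j => [[|[|//]] j2]; rewrite /eq_op /=; ring.
Qed.

Lemma rot4_mul s t : rot4 s *m rot4 t = rot4 (s + t).
Proof.
rewrite /rot4 mulmx_block !mulmx0 !mul0mx !addr0 !add0r rot2_mul -cosD.
by rewrite [cos s * _ + _]addrC -sinD.
Qed.

Lemma rot2_1 : rot2 1 0 = 1%:M.
Proof.
apply/matrixP => i j; rewrite !mxE; case: eqP => // _.
by case: ifP; rewrite ?oppr0.
Qed.

Lemma rot4_0 : rot4 0 = 1%:M.
Proof. by rewrite /rot4 cos0 sin0 rot2_1 -scalar_mx_block. Qed.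

Lemma rot2_row0 n (A : 'M[R]_(2, n)) a b j :
  (rot2 a b *m A) 0 j = a * A 0 j + b * A 1 j.
Proof.
by rewrite mxE big_ord_recl big_ord1 !mxE /=; congr (_ * A _ j + _ * A _ j); exact: val_inj.
Qed.

Lemma rot2_row1 n (A : 'M[R]_(2, n)) a b j :
  (rot2 a b *m A) 1 j = - b * A 0 j + a * A 1 j.
Proof.
by rewrite mxE big_ord_recl big_ord1 !mxE /=; congr (_ * A _ j + _ * A _ j); exact: val_inj.
Qed.

Lemma rot2_flow n (Z : R -> 'M[R]_(2, n)) s d :
  (forall t, is_derive t 1 Z (rot2 d s *m Z t)) -> forall t,
  Z t = expR (d * t) *: (rot2 (cos (s * t)) (sin (s * t)) *m Z 0).
Proof.
move=> Zd t; have Zij i j (r : R) : is_derive r 1 (fun t => Z t i j) ((rot2 d s *m Z r) i j).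
  have [d1 d2] := Zd r; split; first by move/derivable_mxP : d1; apply.
  by rewrite derive_entry// d2.
have E j : Z t 0 j = expR (d * t) * (Z 0 0 j * cos (s * t) + Z 0 1 j * sin (s * t)) /\
    Z t 1 j = expR (d * t) * (- Z 0 0 j * sin (s * t) + Z 0 1 j * cos (s * t)).
  apply: (@rotation_solution (fun t => Z t 0 j) (fun t => Z t 1 j)) => r.
    by have := Zij 0 j r; rewrite rot2_row0.
  by have := Zij 1 j r; rewrite rot2_row1.
apply/matrixP => i j; have [E0 E1] := E j; rewrite [RHS]mxE.
case: i => [[|[|//]] i2].
  rewrite (_ : Ordinal i2 = 0); last exact: val_inj.
  by rewrite rot2_row0 E0; congr (_ * _); ring.
rewrite (_ : Ordinal i2 = 1); last exact: val_inj.
by rewrite rot2_row1 E1; congr (_ * _); ring.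
Qed.

(** Over a period the upper block is [expR (d * (2 * pi))] times a rotation. Since it is the
    identity, its scale is 1, so [d = 0], and then the angle [s * (2 * pi)] must be a multiple of
    [2 * pi]. *)
Lemma ff_flow (Y : R -> 'M[R]_(2 + 2)) s d :
  (forall t, is_derive t 1 Y (ff_mx s d *m Y t)) -> Y 0 = 1%:M -> Y (2 * pi) = 1%:M ->
  (exists k : int, s = k%:~R) /\ forall t, Y t = rot4 (s * t).
Proof.
move=> Yd Y0 Y2pi.
have up t : is_derive t 1 (fun r => usubmx (Y r)) (rot2 d s *m usubmx (Y t)).
  have [d1 d2] := Yd t.
  have -> : rot2 d s *m usubmx (Y t) = usubmx ('D_1 Y t).
    by rewrite d2 -{2}(vsubmxK (Y t)) /ff_mx mul_block_col mul0mx addr0 col_mxKu.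
  apply: (@is_derive_lin _ _ _ _ Y (@usubmx R 2 2 4)) => //.
    by move=> a A B; rewrite linearP.
  move=> A; apply: differentiable_continuous.
  apply: (smooth_on_differentiable openT _ _ _ I).
  apply: (smooth_on_mx openT) => i j.
  apply: (smooth_on_ext openT (f := fun B : 'M[R]_(2 + 2) => B (lshift 2 i) j)).
    by move=> B _; rewrite mxE.
  by apply: (smooth_on_entry openT); exact: smooth_on_id openT.
have dn t : is_derive t 1 (fun r => dsubmx (Y r)) (rot2 (- d) s *m dsubmx (Y t)).
  have [d1 d2] := Yd t.
  have -> : rot2 (- d) s *m dsubmx (Y t) = dsubmx ('D_1 Y t).
    by rewrite d2 -{2}(vsubmxK (Y t)) /ff_mx mul_block_col !mul0mx add0r col_mxKd.
  apply: (@is_derive_lin _ _ _ _ Y (@dsubmx R 2 2 4)) => //.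
    by move=> a A B; rewrite linearP.
  move=> A; apply: differentiable_continuous.
  apply: (smooth_on_differentiable openT _ _ _ I).
  apply: (smooth_on_mx openT) => i j.
  apply: (smooth_on_ext openT (f := fun B : 'M[R]_(2 + 2) => B (rshift 2 i) j)).
    by move=> B _; rewrite mxE.
  by apply: (smooth_on_entry openT); exact: smooth_on_id openT.
have U := rot2_flow up; have D := rot2_flow dn.
have one : (1%:M : 'M[R]_(2 + 2)) = block_mx 1%:M 0 0 1%:M by rewrite -scalar_mx_block.
have Y0u : usubmx (Y 0) = row_mx 1%:M 0 by rewrite Y0 one /block_mx col_mxKu.
have Y0d : dsubmx (Y 0) = row_mx 0 1%:M by rewrite Y0 one /block_mx col_mxKd.
have Ut t : usubmx (Y t) = expR (d * t) *: row_mx (rot2 (cos (s * t)) (sin (s * t))) 0.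
  by rewrite U Y0u mul_mx_row mulmx1 mulmx0.
have Dt t : dsubmx (Y t) = expR (- d * t) *: row_mx 0 (rot2 (cos (s * t)) (sin (s * t))).
  by rewrite D Y0d mul_mx_row mulmx1 mulmx0.
have Yu : usubmx (Y (2 * pi)) = row_mx 1%:M 0 by rewrite Y2pi one /block_mx col_mxKu.
pose e := expR (d * (2 * pi)).
have [c1 s0] : e * cos (s * (2 * pi)) = 1 /\ e * sin (s * (2 * pi)) = 0.
  have /matrixP Yu' := Yu; rewrite Ut in Yu'; split.
    by have := Yu' 0 (lshift 2 0); rewrite [LHS]mxE !row_mxEl !mxE.
  by have := Yu' 0 (lshift 2 1); rewrite [LHS]mxE !row_mxEl !mxE.
have e0 : 0 < e by exact: expR_gt0.
have e1 : e = 1.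
  have : e ^+ 2 = 1.
    have := cos2Dsin2 (s * (2 * pi)) => /(congr1 ( *%R (e ^+ 2))).
    by rewrite mulrDr -!exprMn c1 s0 expr1n expr0n addr0 mulr1.
  by move/eqP; rewrite sqrf_eq1 => /orP[/eqP//|/eqP eN]; move: e0; rewrite eN oppr_gt0 ltr10.
have d0 : d = 0.
  have : d * (2 * pi) = 0 by apply: expR_inj; rewrite expR0.
  move/eqP; rewrite mulf_eq0 => /orP[/eqP//|]; rewrite mulf_eq0 pnatr_eq0 /=.
  by rewrite gt_eqF// pi_gt0.
split; first by apply: cos_eq1_int; move: c1; rewrite e1 mul1r.
move=> t; rewrite -[LHS]vsubmxK Ut Dt d0 oppr0 mul0r expR0 !scale1r.
by rewrite /rot4 /block_mx.
Qed.

End Rotation.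

(** * Quadratic forms and sp(2m) *)

Section QuadraticForms.
Context {R : realType}.

Lemma form_of_quadratic n (S S' : 'M[R]_n) : S^T = S -> S'^T = S' ->
  (forall u : 'rV[R]_n, (u *m S *m u^T) 0 0 = (u *m S' *m u^T) 0 0) -> S = S'.
Proof.
move=> St S't SS.
have pol (T : 'M[R]_n) i j : T^T = T ->
    let q (u : 'rV[R]_n) := (u *m T *m u^T) 0 0 in
    q (delta_mx 0 i + delta_mx 0 j) - q (delta_mx 0 i) - q (delta_mx 0 j) = T i j *+ 2.
  have ad (X Y : 'M[R]_1) : (X + Y) 0 0 = X 0 0 + Y 0 0 by rewrite mxE.
  have ent (k l : 'I_n) : ((delta_mx 0 k : 'rV[R]_n) *m T *m (delta_mx 0 l : 'rV[R]_n)^T) 0 0 = T k l.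
    by rewrite -rowE trmx_delta -colE !mxE.
  move=> Tt /=; rewrite linearD /= mulmxDr !mulmxDl !ad !ent.
  have -> : T j i = T i j by rewrite -{1}Tt mxE.
  by rewrite mulr2n; lra.
apply/matrixP => i j; have := pol S i j St; have := pol S' i j S't.
rewrite /= -!SS => -> /eqP; rewrite -subr_eq0 -mulrnBl mulrn_eq0 /= subr_eq0 => /eqP ->//.
Qed.

Lemma std_form_sq m : @std_form R m *m @std_form R m = - 1%:M.
Proof.
rewrite /std_form mulmx_block !mul0mx !mulmx0 !mulmx1 !mul1mx !addr0 !add0r.
by rewrite [in RHS]scalar_mx_block opp_block_mx !oppr0.
Qed.

Lemma std_form_tr m : (@std_form R m)^T = - @std_form R m.
Proof.
by rewrite /std_form tr_block_mx opp_block_mx !trmx0 linearN /= trmx1 !oppr0 opprK.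
Qed.

Lemma std_form_inj m : injective (fun a : 'M[R]_(m + m) => a *m @std_form R m).
Proof.
move=> a b /(congr1 (fun c => c *m @std_form R m)); rewrite -!mulmxA !std_form_sq.
by rewrite !mulmxN !mulmx1 => /oppr_inj.
Qed.

Lemma sp_symmetric m (a : 'M[R]_(m + m)) : sp a ->
  (a *m @std_form R m)^T = a *m @std_form R m.
Proof.
by move=> /eqP; rewrite addr_eq0 => /eqP E; rewrite trmx_mul std_form_tr mulNmx E.
Qed.

(** For [a] in sp(2m) the product of [a] with [std_form] is symmetric, hence recovered from its
    quadratic form by polarization: elements of sp(2m) may be compared through their forms. *)
Lemma quad_form_inj m (a b : 'M[R]_(m + m)) : sp a -> sp b ->
  quad_form a = quad_form b -> a = b.
Proof.
move=> asp bsp ab; apply: std_form_inj.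
apply: form_of_quadratic; [exact: sp_symmetric|exact: sp_symmetric|].
move=> u; have := congr1 (fun q => q u) ab; rewrite /quad_form !mulmxA.
by move=> /divIf; apply; rewrite pnatr_eq0.
Qed.

Lemma ff_mx_sp (s d : R) : sp (ff_mx s d).
Proof.
rewrite /sp /mkset /ff_mx /std_form tr_block_mx !mulmx_block !trmx0.
rewrite !mul0mx !mulmx0 !mulmx1 !mul1mx !addr0 !add0r mulmxN mulmx1 mulNmx mul1mx.
have E (a b : R) : rot2 a b + (rot2 (- a) b)^T = 0.
  apply/matrixP => i j; rewrite !mxE.
  by case: i => [[|[|//]] i2]; case: j => [[|[|//]] j2]; rewrite /eq_op /=; ring.
have E' : - rot2 (- d) s - (rot2 d s)^T = 0.
  by have := E (- d) s; rewrite opprK -opprD => ->; rewrite oppr0.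
by rewrite add_block_mx E E' !addr0 block_mx0.
Qed.

Lemma ff_mx_form (s d : R) (u : 'rV[R]_(2 + 2)) :
  quad_form (ff_mx s d) u = s * ff_form1 u + d * ff_form2 u.
Proof.
rewrite /quad_form /ff_form1 /ff_form2 /xc /yc -(hsubmxK u) !row_mxEl !row_mxEr.
move: (lsubmx u) (rsubmx u) => x y.
rewrite /ff_mx /std_form mul_row_block !mulmx0 add0r addr0.
rewrite mul_row_block !mulmx0 !mulmxN !mulmx1 add0r addr0 tr_row_mx mul_row_col !mxE.
rewrite !big_ord_recl !big_ord0 !mxE !big_ord_recl !big_ord0 !mxE /=.
rewrite (_ : lift ord0 ord0 = 1); last exact: val_inj.
by rewrite (_ : ord0 = 0 :> 'I_2); [field|exact: val_inj].
Qed.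

Lemma ff_mx_of_forms (a : 'M[R]_(2 + 2)) : sp a ->
  span2 ff_form1 ff_form2 (quad_form a) -> exists s d, a = ff_mx s d.
Proof.
move=> asp [s [d qa]]; exists s, d; apply: quad_form_inj => //; first exact: ff_mx_sp.
by rewrite qa; apply/funext => u; rewrite ff_mx_form.
Qed.

End QuadraticForms.

(** * Hamiltonian fields of functions of [Phi] *)

Section Gradient.
Context {R : realType}.

Lemma derive_scalefun (V : normedModType R) m n (b : V -> R) (X : V -> 'M[R]_(m, n)) x v :
  derivable b x v -> derivable X x v ->
  is_derive x v (fun y => b y *: X y) ('D_v b x *: X x + b x *: 'D_v X x).
Proof.
move=> bd Xd.
have Xij i j : is_derive x v (fun y => X y i j) ('D_v X x i j).
  by split; [move/derivable_mxP : Xd; apply|exact: derive_entry].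
have bi : is_derive x v b ('D_v b x) by split.
have ij i j : is_derive x v (fun y => (b y *: X y) i j)
    (('D_v b x *: X x + b x *: 'D_v X x) i j).
  have -> : (fun y => (b y *: X y) i j) = b * (fun y => X y i j).
    by apply/funext => y; rewrite mxE.
  apply: (is_derive_eq (is_deriveM bi (Xij i j))).
  rewrite -[LHS]/(b x * 'D_v X x i j + X x i j * 'D_v b x) !mxE addrC.
  by rewrite [X x i j * _]mulrC.
have bXd : derivable (fun y => b y *: X y) x v.
  by apply/derivable_mxP => i j; have [] := ij i j.
split=> //; apply/matrixP => i j; rewrite -derive_entry//.
by have [_] := ij i j.
Qed.

Context {M : topologicalType} (w : symplectic4 R M).
Implicit Types (c d : chart R M) (p : M) (O : set M).

Lemma dloc_ext c (f f' : M -> R) O p : atlas w c -> cdom c p -> open O -> O p ->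
  (forall q, O q -> f q = f' q) -> dloc c f (cmap c p) = dloc c f' (cmap c p).
Proof.
move=> wc cp Oo Op ff; apply/rowP => i; rewrite !mxE; apply: near_eq_derive.
by apply: filterS (nbhs_cimg wc Oo cp Op) => y /(cimg_inv wc)[_ /ff].
Qed.

Lemma hamvec_ext c (f f' : M -> R) O p : atlas w c -> cdom c p -> open O -> O p ->
  (forall q, O q -> f q = f' q) -> hamvec w c f (cmap c p) = hamvec w c f' (cmap c p).
Proof. by move=> wc cp Oo Op ff; rewrite /hamvec (dloc_ext wc cp Oo Op ff). Qed.

(** Differentiating df = omega(X, .) at a zero of X leaves no derivative of omega, so the product is
    the Hessian of [f]. *)
Lemma hessian_symmetric c (f : M -> R) p : atlas w c -> cdom c p -> smooth_fun w setT f ->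
  hamvec w c f (cmap c p) = 0 ->
  ('J (hamvec w c f) (cmap c p) *m omega w c (cmap c p))^T =
  'J (hamvec w c f) (cmap c p) *m omega w c (cmap c p).
Proof.
move=> wc cp fs X0; have io := open_cimg wc openT; have cx := mem_cimg cp (I : setT p).
have Xs := hamvec_smooth wc openT fs.
have Xd : differentiable (hamvec w c f) (cmap c p).
  exact: (smooth_on_differentiable io _ _ Xs cx).
have bl0 n (A : 'M[R]_n) v : bl A 0 v = 0 by rewrite /bl !mul0mx mxE.
have ent (A : 'M[R]_4) i j : A i j = ((delta_mx 0 i : 'rV[R]_4) *m A *m (delta_mx 0 j : 'rV[R]_4)^T) 0 0.
  by rewrite -rowE trmx_delta -colE !mxE.
apply/matrixP => i j; rewrite mxE [LHS]ent [RHS]ent.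
have := @hessian_bl R 4 _ (f \o cinv c) (omega w c) (hamvec w c f) (cmap c p)
  (delta_mx 0 j) (delta_mx 0 i) io cx (fs c wc) (omega_smooth_cimg (O := setT) wc) Xs
  (fun y v cy => dloc_bl (c := c) v wc fs cy).
rewrite X0 !bl0 !addr0 /bl (deriveEjacobian _ Xd) (deriveEjacobian _ Xd).
by rewrite !mulmxA.
Qed.

Variable Phi : M -> 'rV[R]_2.
Hypothesis Phis : smooth_map w Phi.

Let PhiT : smooth_fun w setT Phi.
Proof. exact/smooth_map_fun. Qed.

Lemma smooth_fun_coord k : smooth_fun w setT (fun q => Phi q 0 k).
Proof.
move=> c wc; exact: (smooth_on_entry (open_cimg wc openT) 0 k (PhiT wc)).
Qed.

Lemma Phi_continuous : continuous Phi.
Proof.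
move=> p; have [wc cp] := sm_chart_at w p; set c := chart_at w p in wc cp.
apply: (@continuous_near_eq R _ _ ((Phi \o cinv c) \o cmap c)).
  have cn : \forall q \near p, cdom c q by exact: (open_nbhs_nbhs (conj (sm_open wc).1 cp)).
  by apply: filterS cn => q cq /=; rewrite (sm_cancel wc cq).
apply: continuous_comp; first exact: (cmap_continuous wc cp).
exact: (smooth_on_continuous (PhiT wc) (mem_cimg cp I)).
Qed.

Lemma open_Phi (V : set 'rV[R]_2) : open V -> open (Phi @^-1` V).
Proof. by move: V; apply/continuousP; exact: Phi_continuous. Qed.

Lemma smooth_fun_Phi_comp (W : normedModType R) (fW : findim W) (V : set 'rV[R]_2)
    (h : 'rV[R]_2 -> W) : open V -> smooth_on V h -> smooth_fun w (Phi @^-1` V) (h \o Phi).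
Proof.
move=> Vo hV c wc; have io := open_cimg wc (open_Phi Vo).
apply: (@smooth_on_comp _ _ _ io _ _ _ _ V (Phi \o cinv c) h Vo) => //.
  by move=> x /(cimg_inv wc)[].
by apply: smooth_on_sub (PhiT wc) => _ [q [cq _] <-]; exists q.
Qed.

Lemma dloc_Phi_comp c p (V : set 'rV[R]_2) (h : 'rV[R]_2 -> R) : atlas w c -> cdom c p ->
  open V -> V (Phi p) -> smooth_on V h ->
  dloc c (h \o Phi) (cmap c p) =
  \sum_k 'D_(delta_mx 0 k) h (Phi p) *: dloc c (fun q => Phi q 0 k) (cmap c p).
Proof.
move=> wc cp Vo Vp hV; apply/rowP => i; rewrite summxE mxE.
have io := open_cimg wc openT.
have Pd : differentiable (Phi \o cinv c) (cmap c p).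
  exact: (smooth_on_differentiable io _ _ (PhiT wc) (mem_cimg cp I)).
have hd : differentiable h ((Phi \o cinv c) (cmap c p)).
  by apply: (smooth_on_differentiable Vo _ _ hV); rewrite /= (sm_cancel wc cp).
have [_] := is_derive_comp (diff_derivable (v := delta_mx 0 i) Pd) hd.
rewrite [X in 'D_X h _](row_sum_delta_dir _) derive_dir_sum// => E.
transitivity ('D_(delta_mx 0 i) (h \o (Phi \o cinv c)) (cmap c p)) => //.
rewrite E; apply: eq_bigr => k _; rewrite !mxE /= (sm_cancel wc cp).
rewrite -derive_entry; last exact: diff_derivable.
by rewrite -[LHS]/(_ * _) mulrC.
Qed.

Lemma hamvec_Phi_comp c p (V : set 'rV[R]_2) (h : 'rV[R]_2 -> R) : atlas w c -> cdom c p ->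
  open V -> V (Phi p) -> smooth_on V h ->
  hamvec w c (h \o Phi) (cmap c p) =
  \sum_k 'D_(delta_mx 0 k) h (Phi p) *: hamvec w c (fun q => Phi q 0 k) (cmap c p).
Proof.
move=> wc cp Vo Vp hV; rewrite /hamvec (dloc_Phi_comp wc cp Vo Vp hV) mulmx_suml.
by apply: eq_bigr => k _; rewrite scalemxAl.
Qed.

Lemma component_linear (xi : 'rV[R]_2) : smooth_on setT (fun z : 'rV[R]_2 => (z *m xi^T) 0 0).
Proof.
apply: (smooth_on_entry openT); apply: smooth_on_mulmx; [exact: openT|..].
  exact: (smooth_on_id openT).
exact: (smooth_on_cst openT).
Qed.

Lemma hamvec_component c p xi : atlas w c -> cdom c p ->
  hamvec w c (component Phi xi) (cmap c p) =
  \sum_k xi 0 k *: hamvec w c (fun q => Phi q 0 k) (cmap c p).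
Proof.
move=> wc cp; have := hamvec_Phi_comp wc cp openT I (component_linear xi).
rewrite -[(_ \o Phi)]/(component Phi xi) => ->; apply: eq_bigr => k _; congr (_ *: _).
rewrite (derive_entry (f := fun z : 'rV[R]_2 => z *m xi^T)).
  have [_ ->] : is_derive (Phi p) (delta_mx 0 k) (fun z : 'rV[R]_2 => z *m xi^T)
      ('D_(delta_mx 0 k) id (Phi p) *m xi^T + Phi p *m 'D_(delta_mx 0 k) (cst xi^T) (Phi p)).
    by apply: derive_mulmx; [exact: derivable_id|exact: derivable_cst].
  by rewrite derive_id derive_cst mulmx0 addr0 -rowE !mxE.
apply: (smooth_on_derivable (U := setT)) => //.
apply: smooth_on_mulmx; [exact: openT|exact: (smooth_on_id openT)|exact: (smooth_on_cst openT)].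
Qed.

(** At a common zero of the fields the derivatives of the coefficients [b k] drop out, and the
    linearization depends only on their values at [p]. *)
Lemma jacobian_hamvec_zero c p (f : M -> R) (O : set M) (b : 'I_2 -> M -> R) :
  atlas w c -> cdom c p -> open O -> O p -> (forall k, smooth_fun w O (b k)) ->
  smooth_fun w setT f ->
  (forall k, hamvec w c (fun q => Phi q 0 k) (cmap c p) = 0) ->
  (forall q, O q -> cdom c q -> hamvec w c f (cmap c q) =
     \sum_k b k q *: hamvec w c (fun q => Phi q 0 k) (cmap c q)) ->
  'J (hamvec w c f) (cmap c p) =
  \sum_k b k p *: 'J (hamvec w c (fun q => Phi q 0 k)) (cmap c p).
Proof.
move=> wc cp Oo Op bO fs X0 fX; have io := open_cimg wc openT.
have cx := mem_cimg cp (I : setT p); have iO := open_cimg wc Oo; have cO := mem_cimg cp Op.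
have Xs k := hamvec_smooth wc openT (smooth_fun_coord k).
have Xd k v : derivable (hamvec w c (fun q => Phi q 0 k)) (cmap c p) v.
  exact: (smooth_on_derivable (Xs k) cx).
apply: jacobian_eq.
  exact: (smooth_on_differentiable io _ _ (hamvec_smooth wc openT fs) cx).
move=> v.
have near_E : \forall y \near cmap c p,
    hamvec w c f y = \sum_k (b k \o cinv c) y *: hamvec w c (fun q => Phi q 0 k) y.
  apply: filterS (nbhs_cimg wc Oo cp Op) => _ [q [cq Oq] <-].
  by rewrite fX//=; apply: eq_bigr => k _; rewrite (sm_cancel wc cq).
rewrite (near_eq_derive _ near_E).
have kd k : is_derive (cmap c p) v
    (fun y => (b k \o cinv c) y *: hamvec w c (fun q => Phi q 0 k) y)
    (b k p *: (v *m 'J (hamvec w c (fun q => Phi q 0 k)) (cmap c p))).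
  have bd := smooth_on_derivable (v := v) (bO k c wc) cO.
  apply: (is_derive_eq (derive_scalefun bd (Xd k v))).
  rewrite X0 scaler0 add0r /= (sm_cancel wc cp) deriveEjacobian//.
  exact: (smooth_on_differentiable io _ _ (Xs k) cx).
have -> : (fun y => \sum_k (b k \o cinv c) y *: hamvec w c (fun q => Phi q 0 k) y) =
    \sum_k (fun y => (b k \o cinv c) y *: hamvec w c (fun q => Phi q 0 k) y).
  by apply/funext => y; rewrite fct_sumE.
have [_ ->] := is_derive_sum kd.
by rewrite mulmx_sumr; apply: eq_bigr => k _; rewrite -scalemxAr.
Qed.

End Gradient.

Lemma ord2_cases (k : 'I_2) : k = 0 \/ k = 1.
Proof. by case: k => [[|[|//]] ik]; [left|right]; exact: val_inj. Qed.

Section FocusFocusLinear.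
Context {R : realType} {M : topologicalType} (w : symplectic4 R M) (Phi : M -> 'rV[R]_2).
Hypothesis Phis : smooth_map w Phi.

(** [poisson] is evaluated in the chart [chart_at] only; naturality of the fields extends the
    vanishing to every chart, and skewness to every pair of components. *)
Lemma commuting_components : (forall p, poisson w (Defs.J Phi) (H Phi) p = 0) ->
  forall k l, commuting w (fun q => Phi q 0 k) (fun q => Phi q 0 l).
Proof.
move=> JH.
have skew01 : commuting w (fun q => Phi q 0 0) (fun q => Phi q 0 1).
  move=> c p wc cp; have [wd dp] := sm_chart_at w p; set d := chart_at w p in wd dp.
  have Hc k := hamvec_comp (smooth_between_id w) (preserves_form_id w) wd wc dp cp openT I
    (smooth_fun_coord Phis k).
  have := JH p; rewrite /poisson -/d (omega_tangent wd wc dp cp) => <-.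
  rewrite /bl !(Hc _) /= trmx_mul !mulmxA.
  by congr (_ 0 0); rewrite -!mulmxA.
move=> k l c p wc cp; have sk := omega_skew wc cp.
have kl : bl (omega w c (cmap c p)) (hamvec w c (fun q => Phi q 0 1) (cmap c p))
    (hamvec w c (fun q => Phi q 0 0) (cmap c p)) = 0.
  by rewrite (bl_skew _ _ sk) (skew01 c p wc cp) oppr0.
have self u : bl (omega w c (cmap c p)) u u = 0.
  have : bl (omega w c (cmap c p)) u u *+ 2 = 0.
    by rewrite mulr2n {1}(bl_skew _ _ sk) addNr.
  by move/eqP; rewrite mulrn_eq0 => /eqP.
have [->|->] := ord2_cases k; have [->|->] := ord2_cases l; rewrite ?self ?kl//.
exact: (skew01 c p wc cp).
Qed.

Lemma commuting_Phi_comp (f g : M -> R) : (forall p, poisson w (Defs.J Phi) (H Phi) p = 0) ->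
  (forall p, exists (V : set 'rV[R]_2) (h : 'rV[R]_2 -> R),
     [/\ open V, V (Phi p), smooth_on V h & forall q, V (Phi q) -> f q = h (Phi q)]) ->
  (forall p, exists (V : set 'rV[R]_2) (h : 'rV[R]_2 -> R),
     [/\ open V, V (Phi p), smooth_on V h & forall q, V (Phi q) -> g q = h (Phi q)]) ->
  commuting w f g.
Proof.
move=> JH fP gP c p wc cp.
have [V [h [Vo Vp hV fh]]] := fP p; have [V' [h' [Vo' Vp' hV' gh]]] := gP p.
rewrite (hamvec_ext wc cp (open_Phi Phis Vo) Vp fh).
rewrite (hamvec_ext wc cp (open_Phi Phis Vo') Vp' gh).
rewrite (hamvec_Phi_comp Phis wc cp Vo Vp hV) (hamvec_Phi_comp Phis wc cp Vo' Vp' hV').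
rewrite /bl mulmx_suml mulmx_suml summxE big1// => k _.
rewrite linear_sum mulmx_sumr summxE big1// => l _.
rewrite linearZ /= -scalemxAr -!scalemxAl mxE mxE.
by have /= := commuting_components JH k l wc cp; rewrite /bl => ->; rewrite !mulr0.
Qed.

Lemma rk0_hamvec p k : rk w Phi p = 0%N ->
  hamvec w (chart_at w p) (fun q => Phi q 0 k) (cmap (chart_at w p) p) = 0.
Proof.
have [wc cp] := sm_chart_at w p; set c := chart_at w p in wc cp *.
move=> /eqP; rewrite mxrank_eq0 => /eqP D0; rewrite /hamvec.
suff -> : dloc c (fun q => Phi q 0 k) (cmap c p) = 0 by rewrite mul0mx.
apply/rowP => i; rewrite !mxE.
have Pd : differentiable (Phi \o cinv c) (cmap c p).
  exact: (smooth_on_differentiable (open_cimg wc openT) _ _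
    ((smooth_map_fun _ _).1 Phis c wc) (mem_cimg cp I)).
rewrite (derive_entry (f := Phi \o cinv c)); last exact: (diff_derivable Pd).
by rewrite (deriveEjacobian _ Pd) -/(dPhi w Phi p) D0 mulmx0 mxE.
Qed.

Lemma slice_frame_unit p (E : 'M[R]_(2 + 2, 4)) :
  E *m omega w (chart_at w p) (cmap (chart_at w p) p) *m E^T = @std_form R 2 -> (E : 'M[R]_4) \in unitmx.
Proof.
move=> EE; have : @std_form R 2 \in unitmx.
  apply: (@mulmx1_unit _ _ _ (- @std_form R 2) _).1.
  by rewrite mulmxN std_form_sq opprK.
rewrite -EE => U; have := U; rewrite unitmxE !det_mulmx unitrM => /andP[]; rewrite unitrM.
by move=> /andP[+ _] _; rewrite unitmxE.
Qed.

(** Near [p] the function [f] is [h] of [Phi], so its linearization is that of the linear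
    combination [component Phi xi], with [xi] the gradient of [h] at [Phi p]. The latter lies in the
    slice algebra, whose quadratic forms are known. *)
Lemma focus_focus_linearization p (E : 'M[R]_(2 + 2, 4)) (V : set 'rV[R]_2)
    (h : 'rV[R]_2 -> R) (f : M -> R) :
  let c := chart_at w p in
  rk w Phi p = 0%N -> E *m omega w c (cmap c p) *m E^T = @std_form R 2 ->
  slice_forms w Phi p E = span2 ff_form1 ff_form2 ->
  open V -> V (Phi p) -> smooth_on V h -> smooth_fun w setT f ->
  (forall q, V (Phi q) -> f q = h (Phi q)) ->
  exists s d, E *m 'J (hamvec w c f) (cmap c p) = ff_mx s d *m E.
Proof.
move=> c r0 EE sf Vo Vp hV fs fh; have [wc cp] := sm_chart_at w p; rewrite -/c in wc cp.
have Eu := slice_frame_unit EE.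
have X0 k : hamvec w c (fun q => Phi q 0 k) (cmap c p) = 0 by exact: rk0_hamvec.
have fX q : Phi q \in V -> cdom c q -> hamvec w c f (cmap c q) =
    \sum_k 'D_(delta_mx 0 k) h (Phi q) *: hamvec w c (fun q => Phi q 0 k) (cmap c q).
  move=> /set_mem Vq cq; rewrite (hamvec_ext wc cq (open_Phi Phis Vo) Vq fh).
  exact: (hamvec_Phi_comp Phis wc cq Vo Vq hV).
pose xi : 'rV[R]_2 := \row_k 'D_(delta_mx 0 k) h (Phi p).
have fJ : 'J (hamvec w c f) (cmap c p) =
    \sum_k xi 0 k *: 'J (hamvec w c (fun q => Phi q 0 k)) (cmap c p).
  rewrite (jacobian_hamvec_zero Phis (b := fun k q => 'D_(delta_mx 0 k) h (Phi q))
    wc cp (open_Phi Phis Vo) Vp _ fs X0).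
  - by apply: eq_bigr => k _; rewrite mxE.
  - by move=> k; exact: (smooth_fun_Phi_comp Phis _ Vo (smooth_on_derive (delta_mx 0 k : 'rV[R]_2) hV)).
  - by move=> q Vq cq; apply: fX => //; exact/mem_set.
have xs : smooth_fun w setT (component Phi xi).
  exact: (smooth_fun_Phi_comp Phis _ openT (component_linear xi)).
have xJ : 'J (hamvec w c (component Phi xi)) (cmap c p) =
    \sum_k xi 0 k *: 'J (hamvec w c (fun q => Phi q 0 k)) (cmap c p).
  apply: (jacobian_hamvec_zero Phis (b := fun k _ => xi 0 k) wc cp openT I _ xs X0).
    by move=> k d wd; exact: (smooth_on_cst (open_cimg wd openT)).
  by move=> q _ cq; exact: (hamvec_component Phis).
have x0 : hamvec w c (component Phi xi) (cmap c p) = 0.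
  by rewrite (hamvec_component Phis)// big1// => k _; rewrite X0 scaler0.
set A := 'J (hamvec w c f) (cmap c p) in fJ *.
have AE : 'J (hamvec w c (component Phi xi)) (cmap c p) = A by rewrite xJ fJ.
have Asym := hessian_symmetric wc cp xs x0; rewrite AE in Asym.
(* Symmetry of the Hessian says that [A] preserves omega infinitesimally; in the symplectic frame
   [E] this becomes membership in sp(4). *)
have As : A *m omega w c (cmap c p) + omega w c (cmap c p) *m A^T = 0.
  by rewrite -[in LHS]Asym trmx_mul (omega_skew wc cp) mulNmx addNr.
pose a := E *m A *m invmx E.
have aE : a *m E = E *m A by exact: (mulmxKV Eu (E *m A)).
have aS : slice_algebra w Phi p E a.
  exists xi; split.
    have := x0; rewrite /hamvec -/c => /(congr1 (mulmx^~ (omega w c (cmap c p)))).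
    by rewrite mul0mx (mulmxKV (omega_nondegenerate wc cp)).
  by rewrite -/c AE aE subrr sub0mx.
have asp : sp a.
  rewrite /sp /= -EE.
  have -> : a *m (E *m omega w c (cmap c p) *m E^T) = E *m (A *m omega w c (cmap c p)) *m E^T.
    by rewrite !mulmxA aE.
  have -> : E *m omega w c (cmap c p) *m E^T *m a^T = E *m (omega w c (cmap c p) *m A^T) *m E^T.
    by rewrite -mulmxA -trmx_mul aE trmx_mul !mulmxA.
  by rewrite -mulmxDl -mulmxDr As mulmx0 mul0mx.
have [s [d ad]] : exists s d, a = ff_mx s d.
  by apply: (ff_mx_of_forms asp); rewrite -sf; exists a.
by exists s, d; rewrite -ad aE.
Qed.

End FocusFocusLinear.

(** * Effective circle actions near a fixed point *)

Section CircleFlow.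
Context {R : realType} {M : topologicalType} (w : symplectic4 R M).

Lemma circle_flow (f : M -> R) rho : smooth_fun w setT f ->
  effective_torus_action w setT (fun p => const_mx (f p) : 'rV[R]_1) rho ->
  ham_flow w f (fun t => rho (t *: const_mx 1)).
Proof.
move=> fs act; pose e : 'rV[R]_1 := const_mx 1.
have rc (z : R * M) : {for z, continuous (fun z : R * M => rho (z.1 *: e) z.2)}.
  have c1 : {for z, continuous (fun z : R * M => z.1 *: e)}.
    by apply: (@continuous_comp _ _ _ fst (fun t : R => t *: e));
      [exact: cvg_fst|exact: scalel_continuous].
  have c2 : {for z, continuous (fun z : R * M => z.2)} by exact: cvg_snd.
  apply: (@continuous_comp _ _ _ (fun z : R * M => (z.1 *: e, z.2)) (fun z => rho z.1 z.2)).
    exact: (continuous_pair c1 c2).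
  exact: (ta_continuous act).
split.
- exact: fs.
- by move=> p; rewrite scale0r (ta_zero act).
- by move=> s t p; rewrite scalerDl (ta_add act).
- exact: rc.
- move=> c d wc wd; set U := (X in smooth_on X).
  have Uo : open U.
    have := open_action_dom (rho := fun t : R => rho (t *: e)) openT (sm_open wd).1
      (fun t p _ => rc (t, p)) wc.
    by congr open; apply/seteqP; split=> z [p]; [case=> _ *; exists p|case=> *; exists p].
  have Vo := open_action_dom openT (sm_open wd).1 (ta_continuous act) wc.
  apply: (@smooth_on_comp _ _ _ Uo _ _ _ _ _ (fun z : R * 'rV[R]_4 => (z.1 *: e, z.2))
    (fun z => cmap d (rho z.1 (cinv c z.2))) Vo).
  + by move=> z [p [cp zE dp]]; exists p.
  + exact: (ta_smooth act wc wd).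
  + apply: (smooth_on_pair Uo).
      apply: (smooth_on_lin Uo (L := fun z : R * 'rV[R]_4 => z.1 *: e) (f := id)).
      * by move=> a x y; rewrite /= scalerDl scalerA.
      * move=> z; apply: (@continuous_comp _ _ _ fst (fun t : R => t *: e));
          [exact: cvg_fst|exact: scalel_continuous].
      * exact: (smooth_on_id Uo).
    apply: (smooth_on_lin Uo (L := fun z : R * 'rV[R]_4 => z.2) (f := id)).
    * by [].
    * by move=> z; exact: cvg_snd.
    * exact: (smooth_on_id Uo).
- move=> p; have := ta_moment act e (I : setT p).
  have -> // : component (fun p => const_mx (f p) : 'rV[R]_1) e = f.
  by apply/funext => q; rewrite /component mxE big_ord1 !mxE mulr1.
Qed.

Lemma circle_period (f : M -> R) rho t :
  effective_torus_action w setT (fun p => const_mx (f p) : 'rV[R]_1) rho ->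
  (forall p, rho (t *: const_mx 1) p = p) <-> exists k : int, t = k%:~R * (2 * pi).
Proof.
move=> act; have [H1 H2] := ta_effective act (t *: const_mx 1); split=> [tp|[k tk] p].
  by have [k] := H1 (fun p _ => tp p) 0; rewrite !mxE mulr1; exists k.
by apply: H2 => // i; exists k; rewrite !mxE mulr1.
Qed.

Lemma circle_fixed_points (rho : 'rV[R]_1 -> M -> M) :
  fixed_points rho = [set p | forall t : R, rho (t *: const_mx 1) p = p].
Proof.
apply/seteqP; split=> p pf t //.
have -> : t = t 0 0 *: const_mx 1 by apply/rowP => i; rewrite !mxE mulr1 ord1.
exact: pf.
Qed.

Context (f : M -> R) (phi : R -> M -> M).
Hypothesis Hf : ham_flow w f phi.

Lemma flow_fixed c p : atlas w c -> cdom c p -> hamvec w c f (cmap c p) = 0 ->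
  forall t, phi t p = p.
Proof.
move=> wc cp X0 t; apply/esym.
apply: (flow_unique Hf (g := fun=> p)); split; first by move=> s; exact: cvg_cst.
move=> s d wd dp.
have -> : hamvec w d f (cmap d p) = 0.
  rewrite (hamvec_comp (smooth_between_id w) (preserves_form_id w) wd wc dp cp openT I (hf_fun Hf)) in X0.
  have Tu := tangent_unit (smooth_between_id w) (preserves_form_id w) wd wc dp cp.
  by rewrite -[LHS](mulmxK Tu) X0 mul0mx.
exact: is_derive_cst.
Qed.

Lemma iter_flow n t p : iter n (phi t) p = phi (n%:R * t) p.
Proof.
elim: n => [|n IH] /=; first by rewrite mul0r (hf_zero Hf).
by rewrite IH -(hf_add Hf) -natr1 mulrDl mul1r addrC.
Qed.

Lemma is_derive_mulmx_cst (V : normedModType R) m n r s (X : V -> 'M[R]_(n, r)) X' (x v : V)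
    (B : 'M[R]_(m, n)) (C : 'M[R]_(r, s)) :
  is_derive x v X X' -> is_derive x v (fun y => B *m X y *m C) (B *m X' *m C).
Proof.
move=> [Xd <-].
have [BXd E1] := derive_mulmx (A := fun=> B) (derivable_cst B x v) Xd.
have [BXCd E2] := derive_mulmx (B := fun=> C) BXd (derivable_cst C x v).
split=> //; rewrite E2 E1 !derive_cst mul0mx add0r.
by rewrite mulmx0 addr0.
Qed.

Hypothesis period : forall t, (forall p, phi t p = p) <-> exists k : int, t = k%:~R * (2 * pi).
Hypothesis Mc : connected [set: M].

(** The map at time [2 * pi / m.+1] has finite order; with derivative 1 at a fixed point it is the
    identity, and by effectiveness this time is then a multiple of [2 * pi]. *)
Lemma flow_finite_order m c p : atlas w c -> cdom c p ->
  phi (2 * pi / m.+1%:R) p = p -> tangent c c (phi (2 * pi / m.+1%:R)) p = 1%:M -> m = 0.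
Proof.
move=> wc cp fp T1.
have ph q : iter m.+1 (phi (2 * pi / m.+1%:R)) q = q.
  rewrite iter_flow mulrC divfK ?pnatr_eq0//; apply: (period _).2; exists 1.
  by rewrite mul1r.
have tr := finite_order_trivial (flow_between Hf _) ph Mc wc cp fp T1.
have [k kE] := (period _).1 tr.
have : (m.+1%:Z * k)%:~R = 1 :> R.
  have pi2 : 2 * pi != 0 :> R by rewrite mulf_neq0 ?pnatr_eq0// gt_eqF// pi_gt0.
  by apply: (mulIf pi2); rewrite intrM -mulrA -kE mulrC divfK ?mul1r// pnatr_eq0.
move/eqP; rewrite -[1 in X in X -> _]/(1%:~R) eqr_int => /eqP mk.
have /(congr1 absz) := mk.
by rewrite abszM /= => /eqP; rewrite muln_eq1 => /andP[/eqP[]].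
Qed.

Lemma rot4_2pi : rot4 (2 * pi : R) = 1%:M.
Proof.
by rewrite -rot4_0 /rot4 mulr_natl cos2pi cos0 (_ : sin (pi *+ 2) = sin 0)// sin2pi sin0.
Qed.

(* Periodicity makes s an integer and d zero; if s were not 1 or -1, the flow at time
   2 pi / |s| (at time pi if s = 0) would be a nontrivial map of finite order whose
   derivative at the fixed point p is 1. *)
Lemma circle_linearization c p (E : 'M[R]_(2 + 2, 4)) s d : atlas w c -> cdom c p ->
  hamvec w c f (cmap c p) = 0 -> (E : 'M[R]_4) \in unitmx ->
  E *m 'J (hamvec w c f) (cmap c p) = ff_mx s d *m E ->
  is_sign s /\ forall t, E *m tangent c c (phi t) p = rot4 (s * t) *m E.
Proof.
move=> wc cp X0 Eu EJ; have fp := flow_fixed wc cp X0.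
pose L t := tangent c c (phi t) p; pose A := 'J (hamvec w c f) (cmap c p).
have LD s' t' : L (s' + t') = L s' *m L t'.
  have -> : L (s' + t') = tangent c c (phi t' \o phi s') p.
    rewrite /L; have -> // : phi (s' + t') = phi t' \o phi s'.
    by apply/funext => q; rewrite addrC (hf_add Hf).
  rewrite (tangent_comp (flow_between Hf s') (flow_between Hf t') wc wc cp) ?fp//.
have L0 : L 0 = 1%:M.
  rewrite /L; have -> : phi 0 = id by apply/funext => q; rewrite (hf_zero Hf).
  exact: (tangent_id wc cp).
(* The group law [L (s' - t) *m L t = L s'] moves the derivative from time 0 to time [t]. *)
have Ld (t : R) : is_derive t 1 L (A *m L t).
  have D0 : is_derive (0 : R) 1 L A by exact: (flow_linearization Hf wc cp X0 fp).
  have D0' : derivable L (t - t) 1 by rewrite subrr; case: D0.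
  have Dt : is_derive t 1 (fun s' => L (s' - t)) A.
    split; first exact: (derivable_translate D0').
    by rewrite derive_translate subrr; case: D0.
  have LE : L = fun s' => 1%:M *m L (s' - t) *m L t.
    by apply/funext => s'; rewrite mul1mx -LD subrK.
  have := is_derive_mulmx_cst 1%:M (L t) Dt.
  by rewrite [X in is_derive _ _ X _ -> _](esym LE) mul1mx.
pose F : 'M[R]_4 := E; have Fu : F \in unitmx by [].
pose Y t : 'M[R]_(2 + 2) := F *m L t *m invmx F.
have Yd (t : R) : is_derive t 1 Y (ff_mx s d *m Y t).
  have := is_derive_mulmx_cst F (invmx F) (Ld t).
  suff -> : F *m (A *m L t) *m invmx F = ff_mx s d *m Y t by [].
  rewrite /Y !mulmxA; congr (_ *m _ *m _); exact: EJ.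
have Y0 : Y 0 = 1%:M by rewrite /Y L0 mulmx1 (mulmxV Fu).
have L2 : L (2 * pi) = 1%:M.
  rewrite /L; have -> : phi (2 * pi) = id.
    by apply/funext; apply: (period _).2; exists 1; rewrite mul1r.
  exact: (tangent_id wc cp).
have Y2 : Y (2 * pi) = 1%:M by rewrite /Y L2 mulmx1 (mulmxV Fu).
have [[k sk] YE] := ff_flow Yd Y0 Y2.
have LE t : F *m L t = rot4 (s * t) *m F.
  by rewrite -YE /Y (mulmxKV Fu).
split=> //.
(* The time here is [2 * pi / m.+1]: the case [k = 0] is refuted with [m = 1], that is at time pi,
   and [|k| = m.+1] leaves only [m = 0]. *)
have trivial_order m : rot4 (s * (2 * pi / m.+1%:R)) = 1%:M -> m = 0%N.
  move=> r1; apply: (flow_finite_order wc cp (fp _)).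
  rewrite -/(L _) -[LHS](mulKmx Fu) LE r1.
  by rewrite -[X in _ *m X]/((1%:M : 'M[R]_4) *m F) mul1mx (mulVmx Fu).
have k1 : (`|k| = 1)%N.
  case kE : `|k|%N => [|m].
    have k0 : k = 0 by apply/eqP; rewrite -absz_eq0 kE.
    by have := trivial_order 1%N; rewrite sk k0 mul0r => /(_ rot4_0).
  suff : m = 0%N by move=> ->.
  apply: trivial_order; rewrite sk [k]intEsign kE.
  have m0 : m.+1%:R != 0 :> R by rewrite pnatr_eq0.
  have mE : (m.+1 : int)%:~R * (2 * pi / m.+1%:R) = 2 * pi :> R by rewrite mulrC divfK.
  rewrite intrM -[X in rot4 X]mulrA mE.
  case: (k < 0); last by rewrite expr0 mul1r rot4_2pi.
  have := rot4_mul (- (2 * pi)) (2 * pi : R).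
  by rewrite rot4_2pi addNr rot4_0 mulmx1 expr1 mulN1r.
by case: (k) k1 sk => -[|[|]]// _ ->; [left|right].
Qed.

End CircleFlow.

(** * Two commuting circle actions *)

Section TwoFlows.
Context {R : realType} {M : topologicalType} (w : symplectic4 R M).
Hypothesis Mc : connected [set: M].

Lemma proportional_hamvec (f g : M -> R) (a : R) :
  smooth_fun w setT f -> smooth_fun w setT g ->
  (forall c p, atlas w c -> cdom c p ->
     hamvec w c g (cmap c p) = a *: hamvec w c f (cmap c p)) ->
  forall p q, g p - a * f p = g q - a * f q.
Proof.
move=> fs gs gf; pose k p := g p - a * f p.
suff loc p : \forall q \near p, k q = k p by move=> p q; exact: (locally_constant_connected Mc loc).
have [wc cp] := sm_chart_at w p; set c := chart_at w p in wc cp.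
have io := open_cimg wc openT; have cx := mem_cimg cp (I : setT p).
have kd y v : cimg c setT y -> derivable (k \o cinv c) y v /\ 'D_v (k \o cinv c) y = 0.
  move=> cy; have [cz _ zE] := cimg_inv wc cy.
  have gd := smooth_on_derivable (v := v) (gs c wc) cy.
  have fd := smooth_on_derivable (v := v) (fs c wc) cy.
  have fi : is_derive y v (f \o cinv c) ('D_v (f \o cinv c) y) by exact: (DeriveDef fd erefl).
  have gi : is_derive y v (g \o cinv c) ('D_v (g \o cinv c) y) by exact: (DeriveDef gd erefl).
  have [D E] := is_deriveB gi (is_deriveZ a fi).
  split; first exact: D.
  transitivity ('D_v (g \o cinv c - a *: (f \o cinv c)) y) => //.
  rewrite E (dloc_bl v wc gs cy) (dloc_bl v wc fs cy) -[y in hamvec _ _ g y]zE (gf _ _ wc cz) zE.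
  by rewrite /bl -!scalemxAl mxE subrr.
have [e e0 be] : exists2 e : R, 0 < e & ball (cmap c p) e `<=` cimg c setT.
  by have /nbhs_ballP[e e0 be] := open_nbhs_nbhs (conj io cx); exists e.
have nb : \forall q \near p, ball (cmap c p) e (cmap c q).
  exact: (cmap_continuous wc cp (nbhsx_ballx _ _ e0)).
have nc : \forall q \near p, cdom c q by exact: (open_nbhs_nbhs (conj (sm_open wc).1 cp)).
apply: filterS2 nb nc => q bq cq.
have seg (s : R) : 0 <= s <= 1 -> cimg c setT (cmap c p + s *: (cmap c q - cmap c p)).
  move=> /andP[s0 s1]; apply: be; move: bq.
  rewrite -!ball_normE /= => bq; rewrite opprD addrA subrr add0r normrN normrZ ger0_norm//.
  by rewrite distrC (le_lt_trans _ bq)// ler_piMl.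
have [s s01] := line_MVT (fun s s01 => (kd _ (cmap c q - cmap c p) (seg s s01)).1).
rewrite (kd _ _ (seg s s01)).2 [cmap c p + _]addrC subrK /= (sm_cancel wc cq) (sm_cancel wc cp).
by move/eqP; rewrite subr_eq0 => /eqP.
Qed.

Context (f g : M -> R) (phi psi : R -> M -> M).
Hypotheses (Hf : ham_flow w f phi) (Hg : ham_flow w g psi).
Hypothesis phiP : forall t, (forall p, phi t p = p) <-> exists k : int, t = k%:~R * (2 * pi).
Hypothesis psiP : forall t, (forall p, psi t p = p) <-> exists k : int, t = k%:~R * (2 * pi).
Hypothesis fg : commuting w f g.

Lemma is_sign_sqr (s : R) : is_sign s -> s * s = 1.
Proof. by case=> ->; rewrite ?mulr1// mulrNN mulr1. Qed.

Lemma two_circles c p (E : 'M[R]_(2 + 2, 4)) s d s' d' : atlas w c -> cdom c p ->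
  hamvec w c f (cmap c p) = 0 -> hamvec w c g (cmap c p) = 0 -> (E : 'M[R]_4) \in unitmx ->
  E *m 'J (hamvec w c f) (cmap c p) = ff_mx s d *m E ->
  E *m 'J (hamvec w c g) (cmap c p) = ff_mx s' d' *m E ->
  exists2 eta, is_sign eta & forall q q', g q - eta * f q = g q' - eta * f q'.
Proof.
move=> wc cp Xf Xg Eu Ef Eg.
have [ss Lf] := circle_linearization Hf phiP Mc wc cp Xf Eu Ef.
have [ss' Lg] := circle_linearization Hg psiP Mc wc cp Xg Eu Eg.
have fp := flow_fixed Hf wc cp Xf; have gp := flow_fixed Hg wc cp Xg.
(* At [p], [psi t] rotates by [s' * t] and [phi (eta * t)] by [s * eta * t]; the angles agree
   because [s * s = 1]. *)
pose eta := s * s'; have es : is_sign eta.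
  by rewrite /eta; case: ss => ->; case: ss' => ->; rewrite ?mulN1r ?mul1r ?opprK; [left|right|right|left].
exists eta => //; apply: (proportional_hamvec (hf_fun Hf) (hf_fun Hg)).
pose tau t := psi t \o phi (- (eta * t)).
have comm u v q : phi u (psi v q) = psi v (phi u q) by exact: (flows_commute Hf (hf_fun Hg) fg Hg).
have tau_s t : smooth_between w w (tau t).
  exact: (smooth_between_comp (flow_between Hf _) (flow_between Hg t)).
have tau_iter n t q : iter n (tau t) q = psi (n%:R * t) (phi (- (eta * (n%:R * t))) q).
  elim: n => [|n IH]; first by rewrite /= mul0r mulr0 oppr0 (hf_zero Hf) (hf_zero Hg).
  rewrite iterS IH /tau /= comm -(hf_add Hg) -(hf_add Hf); congr (psi _ (phi _ _)).
    by rewrite -natr1; ring.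
  by rewrite -natr1; ring.
have tau_p t : tau t p = p by rewrite /tau /= fp gp.
pose F : 'M[R]_4 := E; have Fu : F \in unitmx by [].
have tau_T t : tangent c c (tau t) p = 1%:M.
  rewrite /tau (tangent_comp (flow_between Hf _) (flow_between Hg _) wc wc cp) ?fp ?gp//.
  set T1 := tangent _ _ _ p; set T2 := tangent _ _ _ _.
  have FT : F *m (T1 *m T2) = F.
    rewrite mulmxA; have -> : F *m T1 = rot4 (s * - (eta * t)) *m F by exact: Lf.
    rewrite -(mulmxA (rot4 _)); have -> : F *m T2 = rot4 (s' * t) *m F by exact: Lg.
    rewrite mulmxA rot4_mul; have -> : s * - (eta * t) + s' * t = 0.
      by rewrite mulrN mulrA [s * eta]mulrA (is_sign_sqr ss) mul1r addNr.
    by rewrite rot4_0; exact: mul1mx.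
  by rewrite -[LHS](mulKmx Fu) FT (mulVmx Fu).
pose t_ n : R := 2 * pi / n.+1%:R.
have t_n n : n.+1%:R * t_ n = 2 * pi by rewrite /t_ mulrC divfK// pnatr_eq0.
have tau_id n q : psi (t_ n) q = phi (eta * t_ n) q.
  have ti : forall q, iter n.+1 (tau (t_ n)) q = q.
    move=> q'; rewrite tau_iter t_n (phiP _).2; last first.
      by case: es => ->; [exists (-1)|exists 1]; rewrite ?mulN1r ?mul1r// opprK.
    by apply: (psiP _).2; exists 1; rewrite mul1r.
  have := finite_order_trivial (tau_s _) ti Mc wc cp (tau_p _) (tau_T _) (phi (eta * t_ n) q).
  by rewrite /tau /= -(hf_add Hf) addNr (hf_zero Hf).
move=> e q we eq.
pose u (t : R) := cmap e (psi t q); pose v (t : R) := cmap e (phi (eta * t) q).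
have u0 : u 0 = cmap e q by rewrite /u (hf_zero Hg).
have v0 : v 0 = cmap e q by rewrite /v mulr0 (hf_zero Hf).
have ud : is_derive (0 : R) 1 u (hamvec w e g (cmap e q)).
  have [_ H0] := hf_curve Hg q; have := H0 0 e we; rewrite (hf_zero Hg); exact.
have vd : is_derive (0 : R) 1 v (eta *: hamvec w e f (cmap e q)).
  have al : is_derive (0 : R) 1 (fun t : R => eta * t) eta.
    have := is_derive_scaled_arg (a := eta) (t := 0) (g := id) (dg := 1).
    by rewrite mulr1; apply; exact: is_derive_id.
  have cq : cdom e (phi (eta * 0) q) by rewrite mulr0 (hf_zero Hf).
  have cc : is_derive (0 : R) 1 (cmap e \o (fun=> q)) 0 by exact: is_derive_cst.
  have qc : {for (0 : R), continuous (fun=> q)} by exact: cvg_cst.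
  have := flow_curve Hf we we qc eq cq cc al.
  by rewrite mulr0 (hf_zero Hf) mul0mx addr0.
(* At the times [t_ n] the curves [u] and [v] coincide, so their velocities at 0 are limits of the
   same difference quotients. *)
have t0 : t_ @ \oo --> (0 : R)^'.
  have tc : t_ @ \oo --> (0 : R).
    have hc : (fun n => n.+1%:R^-1 : R) @ \oo --> (0 : R) by exact: cvg_harmonic.
    by rewrite -[X in _ --> X](mulr0 (2 * pi)); exact: (cvgMl_tmp hc).
  move=> A A0; have A0' : \forall y \near (0 : R), y != 0 -> A y by exact: A0.
  have H : \forall n \near \oo, t_ n != 0 -> A (t_ n) := tc _ A0'.
  apply: filterS H => n; apply.
  by rewrite mulf_neq0// ?invr_eq0 ?pnatr_eq0// mulf_neq0 ?pnatr_eq0// gt_eqF// pi_gt0.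
have quot (h : R -> 'rV[R]_4) X : is_derive (0 : R) 1 h X ->
    (fun n => (t_ n)^-1 *: (h (t_ n) - h 0)) @ \oo --> X.
  move=> [hd <-].
  have -> : (fun n => (t_ n)^-1 *: (h (t_ n) - h 0)) =
      (fun y : R => y^-1 *: ((h \o shift 0) (y *: (1 : R)) - h 0)) \o t_.
    by apply/funext => n; rewrite /= [_ *: 1]mulr1 addr0.
  exact: (cvg_comp _ _ t0 hd).
have Q1 := quot _ _ ud; have Q2 := quot _ _ vd.
rewrite (_ : (fun n => _) = (fun n => (t_ n)^-1 *: (v (t_ n) - v 0))) in Q1.
  exact: (cvg_unique _ Q1 Q2).
by apply/funext => n; rewrite u0 v0 /u /v tau_id.
Qed.

End TwoFlows.

(** * Transport along a symplectomorphism *)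

Section Symplecto.
Context {R : realType} {M1 M2 : topologicalType}.
Variables (w1 : symplectic4 R M1) (w2 : symplectic4 R M2) (F : M1 -> M2) (G : M2 -> M1).
Hypotheses (Fs : smooth_between w1 w2 F) (Gs : smooth_between w2 w1 G).
Hypotheses (FG : cancel F G) (GF : cancel G F) (Ff : preserves_form w1 w2 F).

Lemma tangent_inverse c d p : atlas w1 c -> atlas w2 d -> cdom c p -> cdom d (F p) ->
  tangent c d F p *m tangent d c G (F p) = 1%:M.
Proof.
move=> wc wd cp dp; rewrite -(tangent_comp Fs Gs wc wd cp dp wc) ?FG//.
by rewrite (_ : G \o F = id) ?(tangent_id wc cp)//; apply/funext => q; exact: FG.
Qed.

Lemma preserves_form_inverse : preserves_form w2 w1 G.
Proof.
move=> q; have [wd dq] := sm_chart_at w2 q; set d := chart_at w2 q in wd dq *.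
have [wc cq] := sm_chart_at w1 (G q); set c := chart_at w1 (G q) in wc cq *.
have dq' : cdom d (F (G q)) by rewrite GF.
pose T := tangent d c G q.
change (omega w2 d (cmap d q) = T *m omega w1 c (cmap c (G q)) *m T^T).
have Ti := tangent_inverse wc wd cq dq'.
rewrite (preserves_form_charts Fs Ff wc wd cq dq') -/c !GF in Ti *.
have Ti' := mulmx1C Ti; rewrite -/T in Ti'.
have -> : T *m (tangent c d F (G q) *m omega w2 d (cmap d q) *m (tangent c d F (G q))^T) *m T^T =
    (T *m tangent c d F (G q)) *m omega w2 d (cmap d q) *m (T *m tangent c d F (G q))^T.
  by rewrite trmx_mul !mulmxA.
have -> : T *m tangent c d F (G q) = 1%:M by exact: Ti'.
by rewrite mul1mx trmx1 mulmx1.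
Qed.

(** Formulated over an open set [W] because the moment map of an affine chart is smooth only over
    the domain of that chart. *)
Lemma integral_curve_inverse (f : M2 -> R) (W : set M2) (g : R -> M2) : open W ->
  smooth_fun w2 W f -> (forall t, W (g t)) -> integral_curve w2 f g ->
  integral_curve w1 (f \o F) (G \o g).
Proof.
move=> Wo fs Wg [gc gd]; split.
  by move=> t; apply: continuous_comp; [exact: gc|exact: Gs.1].
move=> t c wc cg; have [wd dg] := sm_chart_at w2 (g t).
set d := chart_at w2 (g t) in wd dg.
have oF : open (F @^-1` W) by move: (W) Wo; apply/continuousP; exact: Fs.1.
have fF : smooth_fun w1 (F @^-1` W) (f \o F) by exact: (smooth_fun_comp Fs _ Wo fs).
have WGg : (F @^-1` W) (G (g t)) by rewrite /= GF.
rewrite (hamvec_comp Gs preserves_form_inverse wd wc dg cg oF WGg fF).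
have -> : (f \o F) \o G = f by apply/funext => q; rewrite /= GF.
have [D E] := gd t d wd dg.
have Ld := local_rep_differentiable Gs wd wc dg cg.
have near_t : \forall s \near t, (local_rep d c G \o (cmap d \o g)) s = (cmap c \o (G \o g)) s.
  have nd : \forall s \near t, cdom d (g s).
    exact: (gc t _ (open_nbhs_nbhs (conj (sm_open wd).1 dg))).
  by apply: filterS nd => s ds; rewrite /local_rep /= (sm_cancel wd ds).
have [D' E'] := is_derive_comp D Ld.
split; first exact: (near_eq_derivable near_t D').
rewrite -(near_eq_derive _ near_t) E' (deriveEjacobian _ Ld).
by rewrite -/(tangent d c G (g t)) E.
Qed.

Lemma transport_action n (W : set M2) (mu : M2 -> 'rV[R]_n.+1) rho : open W ->
  smooth_fun w2 W mu -> effective_torus_action w2 W mu rho ->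
  effective_torus_action w1 (F @^-1` W) (mu \o F) (fun t p => G (rho t (F p))).
Proof.
move=> Wo ms act; have Fc := Fs.1; have Gc := Gs.1.
have oF (O : set M2) : open O -> open (F @^-1` O).
  by move: O; apply/continuousP; exact: Fc.
have oG (O : set M1) : open O -> open (G @^-1` O).
  by move: O; apply/continuousP; exact: Gc.
have rc t p : W (F p) -> {for (t, p), continuous (fun z : 'rV[R]_n.+1 * M1 => rho z.1 (F z.2))}.
  move=> Wp; have c1 : {for (t, p), continuous (fun z : 'rV[R]_n.+1 * M1 => z.1)} by exact: cvg_fst.
  have c2 : {for (t, p), continuous (fun z : 'rV[R]_n.+1 * M1 => F z.2)}.
    by apply: (@continuous_comp _ _ _ snd F); [exact: cvg_snd|exact: Fc].
  apply: (@continuous_comp _ _ _ (fun z : 'rV[R]_n.+1 * M1 => (z.1, F z.2))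
    (fun z => rho z.1 z.2)); first exact: (continuous_pair c1 c2).
  exact: (ta_continuous act).
split.
- by move=> t p Wp; rewrite /= GF; exact: (ta_stable act).
- by move=> p Wp; rewrite (ta_zero act)// FG.
- by move=> s t p Wp; rewrite GF (ta_add act).
- move=> t p Wp; apply: (@continuous_comp _ _ _ (fun z : 'rV[R]_n.+1 * M1 => rho z.1 (F z.2)) G).
    exact: rc.
  exact: Gc.
(* Near a given point the conjugated action factors into the representative of [F], the old action
   from the chart [e] at [F p] to the chart [e'] at its image, and the representative of [G]. *)
- move=> c d wc wd; apply: smooth_on_local => -[t0 x0] [p [/= Wp cp -> dp]].
  have [we ep] := sm_chart_at w2 (F p); set e := chart_at w2 (F p) in we ep.
  have [we' ep'] := sm_chart_at w2 (rho t0 (F p)).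
  set e' := chart_at w2 (rho t0 (F p)) in we' ep'.
  have eo := (sm_open we).1; have eo' := (sm_open we').1; have do_ := (sm_open wd).1.
  have Q_o : open (cdom e' `&` G @^-1` cdom d) by apply: openI => //; exact: oG.
  have W_o : open (F @^-1` (W `&` cdom e)) by apply: oF; exact: openI.
  have U_o := open_action_dom (rho := fun t q => rho t (F q)) W_o Q_o
    (fun t q Wq => rc t q Wq.1) wc.
  have A_o := open_action_dom Wo eo' (ta_continuous act) we.
  have B_o := open_cimg we' (oG _ do_).
  have C_o := open_cimg wc (oF _ eo).
  set U := (X in open X) in U_o.
  exists U; first by exists p.
  pose P4 : normedModType R := ('rV[R]_n.+1 * 'rV[R]_4)%type.
  have U_o' : @open P4 U by exact: U_o.
  set A := (X in open X) in A_o.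
  pose a1 (z : P4) : P4 := (z.1, local_rep c e F z.2).
  pose a2 (z : P4) : 'rV[R]_4 := cmap e' (rho z.1 (cinv e z.2)).
  have FX : findim 'rV[R]_4 by exact: findim_mx.
  have FP : findim P4 by exact: findim_prod.
  have sid : smooth_on U (id : P4 -> P4) by exact: (smooth_on_id U_o').
  have s1 : smooth_on U (fun z : P4 => z.1).
    exact: (smooth_on_lin U_o' (L := fst) (f := id) (fun _ _ _ => erefl) (fun _ => cvg_fst) sid).
  have s2 : smooth_on U (fun z : P4 => z.2).
    exact: (smooth_on_lin U_o' (L := snd) (f := id) (fun _ _ _ => erefl) (fun _ => cvg_snd) sid).
  have s3 : smooth_on U (fun z : P4 => local_rep c e F z.2).
    have m3 (z : P4) : U z -> cimg c (F @^-1` cdom e) z.2.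
      by move=> [q [[Wq eq] cq zE _]]; exists q.
    exact: (smooth_on_comp U_o' FX FX C_o m3 (Fs.2 _ _ wc we) s2).
  have sa1 : smooth_on U a1 by exact: (smooth_on_pair U_o' s1 s3).
  have sa2 : smooth_on U (a2 \o a1).
    have m4 (z : P4) : U z -> A (a1 z).
      move=> [q [[Wq eq] cq zE [eq' dq]]].
      by exists (F q); rewrite /a1 /local_rep /= zE (sm_cancel wc cq).
    exact: (smooth_on_comp U_o' FP FX A_o m4 (ta_smooth act we we') sa1).
  have sa3 : smooth_on U (local_rep e' d G \o (a2 \o a1)).
    have m5 (z : P4) : U z -> cimg e' (G @^-1` cdom d) ((a2 \o a1) z).
      move=> [q [[Wq eq] cq zE [eq' dq]]]; exists (rho z.1 (F q)) => //.
      by rewrite /a2 /a1 /local_rep /= zE (sm_cancel wc cq) (sm_cancel we eq).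
    exact: (smooth_on_comp U_o' FX FX B_o m5 (Gs.2 _ _ we' wd) sa2).
  apply: (smooth_on_ext U_o' _ sa3) => z [q [[Wq eq] cq zE [eq' dq]]].
  by rewrite /a2 /a1 /local_rep /= zE (sm_cancel wc cq) (sm_cancel we eq) (sm_cancel we' eq').
- move=> xi p Wp.
  have cs : smooth_fun w2 W (component mu xi).
    move=> d wd; have io := open_cimg wd Wo.
    apply: (smooth_on_entry io (f := fun y => (mu \o cinv d) y *m xi^T)).
    by apply: (smooth_on_mulmx io); [exact: (ms d wd)|exact: (smooth_on_cst io)].
  exact: (integral_curve_inverse Wo cs (fun t => ta_stable act _ Wp) (ta_moment act xi Wp)).
- by move=> t p Wp; rewrite /= GF (ta_invariant act).
- move=> t; rewrite -(ta_effective act t); split=> [H q Wq|H p Wp].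
    by rewrite -[RHS]GF -(H (G q)) /= ?GF.
  by rewrite H ?FG.
Qed.

End Symplecto.

(** * Focus-focus points under an isomorphism *)

Section FocusFocusTransport.
Context {R : realType}.

Lemma mulmx_row_ext m n (A B : 'M[R]_(m, n)) :
  (forall v : 'rV_m, v *m A = v *m B) -> A = B.
Proof. by move=> AB; apply/row_matrixP => i; rewrite !rowE. Qed.

Lemma intertwine m n (E : 'M[R]_(m, n)) a (T J1 J2 : 'M[R]_n) : T \in unitmx ->
  T *m J2 = J1 *m T -> E *m T *m J2 - a *m (E *m T) = 0 -> E *m J1 = a *m E.
Proof.
move=> Tu JT /eqP; rewrite subr_eq0 => /eqP aE.
have E1 : E *m J1 *m T = a *m E *m T by rewrite -mulmxA -JT mulmxA aE mulmxA.
by rewrite -[LHS](mulmxK Tu) E1 (mulmxK Tu).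
Qed.

(** Obtained by differentiating the naturality of the field at [p]; the term with the derivative of
    the tangent map carries the field as a factor, which is 0 there. *)
Lemma jacobian_hamvec_comp (M1 M2 : topologicalType) (w1 : symplectic4 R M1)
    (w2 : symplectic4 R M2) (F : M1 -> M2) (f : M2 -> R) c d p :
  smooth_between w1 w2 F -> preserves_form w1 w2 F -> smooth_fun w2 setT f ->
  atlas w1 c -> atlas w2 d -> cdom c p -> cdom d (F p) ->
  hamvec w1 c (f \o F) (cmap c p) = 0 ->
  tangent c d F p *m 'J (hamvec w2 d f) (cmap d (F p)) =
  'J (hamvec w1 c (f \o F)) (cmap c p) *m tangent c d F p.
Proof.
move=> Fs Ff fs wc wd cp dp X0.
have fFs : smooth_fun w1 setT (f \o F) by exact: (smooth_fun_comp Fs _ openT fs).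
have ic := open_cimg wc openT; have id_ := open_cimg wd openT.
have oU : open (F @^-1` cdom d).
  by have /continuousP := Fs.1; apply; exact: (sm_open wd).1.
have iU := open_cimg wc oU; have xU : cimg c (F @^-1` cdom d) (cmap c p) by exists p.
have X2d : differentiable (hamvec w2 d f) (cmap d (F p)).
  exact: (smooth_on_differentiable id_ _ _ (hamvec_smooth wd openT fs) (mem_cimg dp I)).
have X1d : differentiable (hamvec w1 c (f \o F)) (cmap c p).
  exact: (smooth_on_differentiable ic _ _ (hamvec_smooth wc openT fFs) (mem_cimg cp I)).
have Ld := local_rep_differentiable Fs wc wd cp dp.
have lx : local_rep c d F (cmap c p) = cmap d (F p) by rewrite /local_rep /= (sm_cancel wc cp).
have Js := smooth_on_jacobian iU (Fs.2 c d wc wd).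
apply: mulmx_row_ext => v.
have X2d' : differentiable (hamvec w2 d f) (local_rep c d F (cmap c p)) by rewrite lx.
have [_ E1] := is_derive_comp (diff_derivable (v := v) Ld) X2d'.
have [_ E2] := derive_mulmx (diff_derivable (v := v) X1d) (smooth_on_derivable (v := v) Js xU).
rewrite X0 mul0mx addr0 (deriveEjacobian v X1d) in E2.
rewrite (deriveEjacobian v Ld) lx (deriveEjacobian _ X2d) in E1.
apply: etrans (mulmxA _ _ _) _; apply: etrans (esym E1) _.
apply: etrans (esym (mulmxA _ _ _)); apply: etrans E2; apply: near_eq_derive.
apply: filterS (nbhs_cimg wc oU cp dp) => y [q [cq dq] <-].
rewrite /= /local_rep /= (sm_cancel wc cq).
exact: (hamvec_comp Fs Ff wc wd cq dq openT I fs).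
Qed.

End FocusFocusTransport.

Section Linear.
Context {R : realType} {M1 M2 : topologicalType}.
Variables (w1 : symplectic4 R M1) (w2 : symplectic4 R M2) (F : M1 -> M2).
Hypotheses (Fs : smooth_between w1 w2 F) (Ff : preserves_form w1 w2 F).
Variables (Phi1 : M1 -> 'rV[R]_2) (Phi2 : M2 -> 'rV[R]_2).
Hypotheses (Ps1 : smooth_map w1 Phi1) (Ps2 : smooth_map w2 Phi2).
Variables (p : M1) (V : set 'rV[R]_2) (h : 'rV[R]_2 -> 'rV[R]_2).
Hypotheses (Vo : open V) (Vp : V (Phi1 p)) (hV : smooth_on V h).
Hypothesis Phi21 : forall q, V (Phi1 q) -> Phi2 (F q) = h (Phi1 q).
Hypothesis r0 : rk w1 Phi1 p = 0%N.
Let c := chart_at w1 p.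
Let d := chart_at w2 (F p).

Let wc : atlas w1 c. Proof. exact: (sm_chart_at w1 p).1. Qed.
Let cp : cdom c p. Proof. exact: (sm_chart_at w1 p).2. Qed.
Let wd : atlas w2 d. Proof. exact: (sm_chart_at w2 (F p)).1. Qed.
Let dp : cdom d (F p). Proof. exact: (sm_chart_at w2 (F p)).2. Qed.

Let hx (xi : 'rV[R]_2) : smooth_on V (fun z => (h z *m xi^T) 0 0).
Proof.
apply: (smooth_on_entry Vo); apply: (smooth_on_mulmx Vo) => //; exact: (smooth_on_cst Vo).
Qed.

Let hamvec_pull (xi : 'rV[R]_2) q : cdom c q -> V (Phi1 q) ->
  hamvec w1 c (component Phi2 xi \o F) (cmap c q) =
  \sum_k 'D_(delta_mx 0 k) (fun z => (h z *m xi^T) 0 0) (Phi1 q) *: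
    hamvec w1 c (fun q => Phi1 q 0 k) (cmap c q).
Proof.
move=> cq Vq; rewrite -(hamvec_Phi_comp Ps1 wc cq Vo Vq (hx xi)).
apply: (hamvec_ext wc cq (open_Phi Ps1 Vo) Vq) => q' Vq'.
by rewrite /= /component Phi21.
Qed.

Let comp_smooth (xi : 'rV[R]_2) : smooth_fun w2 setT (component Phi2 xi).
Proof. exact: (smooth_fun_Phi_comp Ps2 _ openT (component_linear xi)). Qed.

Lemma rk0_component (xi : 'rV[R]_2) : hamvec w2 d (component Phi2 xi) (cmap d (F p)) = 0.
Proof.
rewrite (hamvec_comp Fs Ff wc wd cp dp openT I (comp_smooth xi)) hamvec_pull//.
by rewrite big1 ?mul0mx// => k _; rewrite (rk0_hamvec Ps1 k r0) scaler0.
Qed.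

Lemma rk0_orbit_tangent : orbit_tangent w2 Phi2 (F p) = 0.
Proof. by apply/row_matrixP => i; rewrite row0 rowK; exact: rk0_component. Qed.

Lemma transport_rk0 : rk w2 Phi2 (F p) = 0%N.
Proof.
apply/eqP; rewrite mxrank_eq0; apply/eqP/matrixP => i k; rewrite mxE.
have dl : dloc d (component Phi2 (delta_mx 0 k)) (cmap d (F p)) = 0.
  have := rk0_component (delta_mx 0 k).
  move=> /(congr1 (mulmx^~ (omega w2 d (cmap d (F p))))).
  by rewrite mul0mx /hamvec (mulmxKV (omega_nondegenerate wd dp)).
have := congr1 (fun A : 'rV_4 => A 0 i) dl; rewrite !mxE /= => <-.
have Pd : differentiable (Phi2 \o cinv d) (cmap d (F p)).
  exact: (smooth_on_differentiable (open_cimg wd openT) _ _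
    ((smooth_map_fun _ _).1 Ps2 d wd) (mem_cimg dp I)).
have -> : component Phi2 (delta_mx 0 k) \o cinv d = fun y => (Phi2 \o cinv d) y 0 k.
  by apply/funext => y; rewrite /= /component trmx_delta -colE mxE.
by rewrite (derive_entry 0 k (diff_derivable Pd)) (deriveE _ Pd).
Qed.

(** The pull-back of [component Phi2 xi] is locally the function [h z *m xi^T] of [Phi1], so its
    linearization is that of [component Phi1 b], with [b] the gradient of this function. The reverse
    inclusion will come from the inverse isomorphism. *)
Lemma transport_slice_algebra (E : 'M[R]_(2 + 2, 4)) :
  slice_algebra w2 Phi2 (F p) (E *m tangent c d F p) `<=` slice_algebra w1 Phi1 p E.
Proof.
move=> a [xi [_]]; rewrite rk0_orbit_tangent => /submx0null; rewrite -/d => aE.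
pose b : 'rV[R]_2 := \row_k 'D_(delta_mx 0 k) (fun z => (h z *m xi^T) 0 0) (Phi1 p).
have T_unit : tangent c d F p \in unitmx by exact: (tangent_unit Fs Ff wc wd cp dp).
have X0 k : hamvec w1 c (fun q => Phi1 q 0 k) (cmap c p) = 0 by exact: (rk0_hamvec Ps1 k r0).
have fs : smooth_fun w1 setT (component Phi2 xi \o F).
  exact: (smooth_fun_comp Fs _ openT (comp_smooth xi)).
have Y0 : hamvec w1 c (component Phi2 xi \o F) (cmap c p) = 0.
  by rewrite hamvec_pull// big1// => k _; rewrite X0 scaler0.
have JE : 'J (hamvec w1 c (component Phi2 xi \o F)) (cmap c p) =
    \sum_k b 0 k *: 'J (hamvec w1 c (fun q => Phi1 q 0 k)) (cmap c p).
  rewrite (jacobian_hamvec_zero Ps1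
    (b := fun k q => 'D_(delta_mx 0 k) (fun z => (h z *m xi^T) 0 0) (Phi1 q))
    wc cp (open_Phi Ps1 Vo) Vp _ fs X0).
  - by apply: eq_bigr => k _; rewrite mxE.
  - move=> k.
    exact: (smooth_fun_Phi_comp Ps1 _ Vo (smooth_on_derive (delta_mx 0 k : 'rV[R]_2) (hx xi))).
  - by move=> q Vq cq; exact: hamvec_pull.
have bJ : 'J (hamvec w1 c (component Phi1 b)) (cmap c p) =
    \sum_k b 0 k *: 'J (hamvec w1 c (fun q => Phi1 q 0 k)) (cmap c p).
  apply: (jacobian_hamvec_zero Ps1 (b := fun k _ => b 0 k) wc cp openT I _ _ X0).
  - by move=> k e we; exact: (smooth_on_cst (open_cimg we openT)).
  - exact: (smooth_fun_Phi_comp Ps1 _ openT (component_linear b)).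
  - by move=> q _ cq; exact: (hamvec_component Ps1).
exists b; split.
  have : hamvec w1 c (component Phi1 b) (cmap c p) = 0.
    by rewrite (hamvec_component Ps1)// big1// => k _; rewrite X0 scaler0.
  move=> /(congr1 (mulmx^~ (omega w1 c (cmap c p)))).
  by rewrite mul0mx /hamvec (mulmxKV (omega_nondegenerate wc cp)).
rewrite -/c bJ -JE; suff -> : E *m 'J (hamvec w1 c (component Phi2 xi \o F)) (cmap c p) = a *m E.
  by rewrite subrr sub0mx.
have JT := jacobian_hamvec_comp Fs Ff (comp_smooth xi) wc wd cp dp Y0.
exact: (intertwine T_unit JT aE).
Qed.

End Linear.

Section SystemIso.
Context {R : realType} {M1 M2 : topologicalType}.

(** A two-sided form of an isomorphism, with [phi] inverse to [psi] on the base, so that every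
    statement about [F] and [psi] also applies to [G] and [phi]. *)
Record system_iso (w1 : symplectic4 R M1) (w2 : symplectic4 R M2)
    (Phi1 : M1 -> 'rV[R]_2) (Phi2 : M2 -> 'rV[R]_2) (F : M1 -> M2) (G : M2 -> M1)
    (psi phi : 'rV[R]_2 -> 'rV[R]_2) : Prop := {
  si_F : smooth_between w1 w2 F;
  si_G : smooth_between w2 w1 G;
  si_FG : cancel F G;
  si_GF : cancel G F;
  si_form : preserves_form w1 w2 F;
  si_psi : smooth_sub (base Phi1) psi;
  si_phi : smooth_sub (base Phi2) phi;
  si_psiK : forall p, phi (psi (Phi1 p)) = Phi1 p;
  si_Phi : forall p, Phi2 (F p) = psi (Phi1 p) }.

End SystemIso.

Lemma system_iso_sym (R : realType) (M1 M2 : topologicalType) (w1 : symplectic4 R M1)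
    (w2 : symplectic4 R M2) Phi1 Phi2 F G psi phi :
  system_iso w1 w2 Phi1 Phi2 F G psi phi -> system_iso w2 w1 Phi2 Phi1 G F phi psi.
Proof.
move=> S; have [Fs Gs FG GF Ff Ps Hs PK PF] := S.
have E q : Phi1 (G q) = phi (Phi2 q) by rewrite -{2}(GF q) PF PK.
split => //; first exact: (preserves_form_inverse Fs Gs FG GF Ff).
by move=> q; rewrite -E -PF GF.
Qed.

Lemma isomorphic_system_iso (R : realType) (M1 M2 : topologicalType) (w1 : symplectic4 R M1)
    (w2 : symplectic4 R M2) Phi1 Phi2 : isomorphic_systems w1 w2 Phi1 Phi2 ->
  exists F G psi phi, system_iso w1 w2 Phi1 Phi2 F G psi phi.
Proof.
move=> [F [psi [[Fs Ff [G [FG GF Gs]]] [Ps [phi [PK Hs]]] im PF]]].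
exists F, G, psi, phi; split => //; first by rewrite -im.
by move=> p; apply: PK; exists p.
Qed.

Section IsoConsequences.
Context {R : realType} {M1 M2 : topologicalType}.
Variables (w1 : symplectic4 R M1) (w2 : symplectic4 R M2).
Variables (Phi1 : M1 -> 'rV[R]_2) (Phi2 : M2 -> 'rV[R]_2).
Variables (F : M1 -> M2) (G : M2 -> M1) (psi phi : 'rV[R]_2 -> 'rV[R]_2).
Hypothesis S : system_iso w1 w2 Phi1 Phi2 F G psi phi.
Hypotheses (Ps1 : smooth_map w1 Phi1) (Ps2 : smooth_map w2 Phi2).

Lemma local_psi p : exists (V : set 'rV[R]_2) (h : 'rV[R]_2 -> 'rV[R]_2),
  [/\ open V, V (Phi1 p), smooth_on V h & forall q, V (Phi1 q) -> Phi2 (F q) = h (Phi1 q)].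
Proof.
have [V [h [Vo Vp hV hp]]] := si_psi S (ex_intro2 _ _ p I erefl : base Phi1 (Phi1 p)).
exists V, h; split => // q Vq; rewrite (si_Phi S) hp//; by exists q.
Qed.

End IsoConsequences.

(** The frame is pushed forward by the tangent map; the slice algebras then coincide, by one
    inclusion for the isomorphism and one for its inverse. Compactness and nondegeneracy of the
    image orbit come from the hypothesis on the second system. *)
Lemma focus_focus_transport (R : realType) (M1 M2 : topologicalType) (w1 : symplectic4 R M1)
    (w2 : symplectic4 R M2) Phi1 Phi2 F G psi phi p :
  system_iso w1 w2 Phi1 Phi2 F G psi phi -> smooth_map w1 Phi1 -> smooth_map w2 Phi2 ->
  (forall q, singular w2 Phi2 q -> almost_toric w2 Phi2 q) ->
  focus_focus w1 Phi1 p -> focus_focus w2 Phi2 (F p).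
Proof.
move=> S Ps1 Ps2 at2 [_ _ [r0 [E [[_ EE] sf]]]].
have [V [h [Vo Vp hV Fh]]] := local_psi S p.
have S' := system_iso_sym S; have FGp : G (F p) = p := si_FG S p.
have [V' [h' [Vo' Vp' hV' Fh']]] := local_psi S' (F p).
have r0' := transport_rk0 (si_F S) (si_form S) Ps1 Ps2 Vo Vp hV Fh r0.
have sub1 := transport_slice_algebra (si_F S) (si_form S) Ps1 Ps2 Vo Vp hV Fh r0.
have sub2 := transport_slice_algebra (si_F S') (si_form S') Ps2 Ps1 Vo' Vp' hV' Fh' r0'.
have OT0 := rk0_orbit_tangent (si_F S) (si_form S) Ps1 Ps2 Vo Vp hV Fh r0.
have [wc cp] := sm_chart_at w1 p; set c := chart_at w1 p in wc cp sub1 sub2 EE *.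
have [wd dp] := sm_chart_at w2 (F p); set d := chart_at w2 (F p) in wd dp sub1 sub2 *.
have sing : singular w2 Phi2 (F p) by rewrite /singular r0'.
split; [exact: sing|exact: (at2 _ sing)|split; first exact: r0'].
exists (E *m tangent c d F p); split.
  split; first by rewrite OT0 trmx0 mulmx0.
  rewrite -EE (preserves_form_charts (si_F S) (si_form S) wc wd cp dp) -/d trmx_mul.
  by rewrite !mulmxA.
rewrite -sf /slice_forms; congr (_ @` _); apply/seteqP; split; first exact: sub1.
have := sub2 (E *m tangent c d F p); rewrite FGp -/c -mulmxA.
by rewrite (tangent_inverse (si_F S) (si_G S) (si_FG S) wc wd cp dp) mulmx1.
Qed.

Lemma smooth_on_coordinate (R : realType) (V : set 'rV[R]_2) (h : 'rV[R]_2 -> 'rV[R]_2) k :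
  open V -> smooth_on V h -> smooth_on V (fun z => h z 0 k).
Proof. by move=> Vo; exact: smooth_on_entry. Qed.

Lemma iso_first_coordinate (R : realType) (M1 M2 : topologicalType) (w1 : symplectic4 R M1)
    (w2 : symplectic4 R M2) Phi1 Phi2 F G psi phi :
  system_iso w1 w2 Phi1 Phi2 F G psi phi ->
  faithful_semitoric w1 Phi1 -> faithful_semitoric w2 Phi2 ->
  (exists p, focus_focus w1 Phi1 p) ->
  exists eta c, is_sign eta /\ forall z, base Phi1 z -> psi z 0 0 = eta * z 0 0 + c.
Proof.
move=> S fs1 fs2 [p [_ _ [r0 [E [[_ EE] sf]]]]].
have [Ps1 JH1 _ _] := fs_integrable fs1; have [Ps2 _ _ _] := fs_integrable fs2.
have [V [h [Vo Vp hV Fh]]] := local_psi S p.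
pose f := Defs.J Phi1; pose g := Defs.J Phi2 \o F.
have sJ1 : smooth_fun w1 setT f by exact: (smooth_fun_coord Ps1).
have sJ2 : smooth_fun w2 setT (Defs.J Phi2) by exact: (smooth_fun_coord Ps2).
have sg : smooth_fun w1 setT g by exact: (smooth_fun_comp (si_F S) _ openT sJ2).
have hid : smooth_on setT (fun z : 'rV[R]_2 => z 0 0).
  exact: (smooth_on_coordinate 0 openT (smooth_on_id openT)).
have hV0 := smooth_on_coordinate 0 Vo hV.
have gh q : V (Phi1 q) -> g q = h (Phi1 q) 0 0 by move=> Vq; rewrite /g /Defs.J /= Fh.
have [wc cp] := sm_chart_at w1 p; set c := chart_at w1 p in wc cp EE.
have Xf : hamvec w1 c f (cmap c p) = 0 by exact: (rk0_hamvec Ps1 0 r0).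
have Xg : hamvec w1 c g (cmap c p) = 0.
  rewrite (hamvec_ext wc cp (open_Phi Ps1 Vo) Vp gh).
  have := hamvec_Phi_comp Ps1 wc cp Vo Vp hV0; rewrite -[(_ \o Phi1)]/(fun q => h (Phi1 q) 0 0) => ->.
  by rewrite big1// => k _; rewrite (rk0_hamvec Ps1 k r0) scaler0.
(* The linearizations of [f] and [g] are expressed in the same frame [E], so that their rotation
   parts can be compared. *)
have [s [d Ef]] := focus_focus_linearization Ps1 r0 EE sf openT I hid sJ1 (fun q _ => erefl).
have [s' [d' Eg]] := focus_focus_linearization Ps1 r0 EE sf Vo Vp hV0 sg gh.
have [rho1 [act1 _]] := fs_circle fs1; have [rho2 [act2 _]] := fs_circle fs2.
have mu2 : smooth_fun w2 setT (fun p => const_mx (Defs.J Phi2 p) : 'rV[R]_1).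
  move=> e we; apply: (smooth_on_mx (open_cimg we openT)) => i j.
  by apply: (smooth_on_ext (open_cimg we openT) _ (sJ2 e we)) => x _; rewrite mxE.
(* The circle action of the second system, conjugated by [F], has [g] as its moment map on [M1]. *)
have act3 : effective_torus_action w1 setT (fun p => const_mx (g p) : 'rV[R]_1)
    (fun t p => G (rho2 t (F p))).
  exact: (transport_action (si_F S) (si_G S) (si_FG S) (si_GF S) (si_form S) openT mu2 act2).
have fg : commuting w1 f g.
  apply: (commuting_Phi_comp Ps1 JH1) => q.
    by exists setT, (fun z => z 0 0); split; [exact: openT|exact: I|exact: hid|by []].
  have [V' [h' [Vo' Vq' hV' Fh']]] := local_psi S q.
  exists V', (fun z => h' z 0 0).
  split; [exact: Vo'|exact: Vq'|exact: (smooth_on_coordinate 0 Vo' hV')|move=> q' Vq].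
  by rewrite /g /Defs.J /= Fh'.
have [eta es ge] := two_circles (fs_connected fs1) (circle_flow sJ1 act1) (circle_flow sg act3)
  (fun t => circle_period t act1) (fun t => circle_period t act3) fg wc cp Xf Xg
  (slice_frame_unit EE) Ef Eg.
exists eta, (g p - eta * f p); split => // _ [q _ <-].
have := ge q p; rewrite /g /f /Defs.J /= -(si_Phi S) => <-.
by rewrite addrC subrK.
Qed.

(** * Derivatives on the base *)

Section SmoothSub.
Context {R : realType}.

Lemma withinP (X Y : topologicalType) (A : set X) (f : X -> Y) :
  {within A, continuous f} <->
  forall x N, A x -> nbhs (f x) N -> \forall y \near x, A y -> N (f y).
Proof.
split=> [/subspace_continuousP fc x N Ax Nx|H]; first exact: (fc x Ax N Nx).
by apply/subspace_continuousP => x Ax N Nx; exact: (H x N Ax Nx).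
Qed.

Lemma within_comp (X Y Z : topologicalType) (A : set X) (B : set Y) (f : X -> Y) (g : Y -> Z) :
  {within A, continuous f} -> (forall x, A x -> B (f x)) -> {within B, continuous g} ->
  {within A, continuous (g \o f)}.
Proof.
move=> /withinP fc AB /withinP gc; apply/withinP => x N Ax Nx.
have := fc x _ Ax (gc _ _ (AB x Ax) Nx).
by apply: filterS => y fN Ay; apply: (fN Ay); exact: AB.
Qed.

Lemma within_open (X Y : topologicalType) (A : set X) (f : X -> Y) (O : set Y) :
  {within A, continuous f} -> open O ->
  exists O' : set X, open O' /\ forall x, A x -> O (f x) <-> O' x.
Proof.
move=> fc Oo; exists [set x | \forall y \near x, A y -> O (f y)]°; split.
  exact: open_interior.
move=> x Ax; split=> [Ofx|/interior_subset/nbhs_singleton]; last exact.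
rewrite /interior; apply: (nbhs_interior ((withinP _ _).1 fc _ _ Ax _)).
exact: (open_nbhs_nbhs (conj Oo Ofx)).
Qed.

Lemma smooth_sub_within (V W : normedModType R) (A : set V) (f : V -> W) :
  smooth_sub A f -> {within A, continuous f}.
Proof.
move=> fs; apply/withinP => x N Ax; have [U [g [Uo Ux gU gf]]] := fs x Ax.
rewrite -(gf x Ax Ux) => /(smooth_on_continuous gU Ux) gN.
apply: filterS2 (open_nbhs_nbhs (conj Uo Ux)) gN => y Uy /= gNy Ay.
by rewrite -(gf y Ay Uy).
Qed.

Lemma smooth_sub_subset (V W : normedModType R) (A B : set V) (f : V -> W) :
  B `<=` A -> smooth_sub A f -> smooth_sub B f.
Proof.
move=> BA fs x Bx; have [U [g [Uo Ux gU gf]]] := fs x (BA x Bx).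
by exists U, g; split => // y By; apply: gf; exact: BA.
Qed.

Lemma smooth_sub_comp (V V' W : normedModType R) (fV' : findim V') (fW : findim W)
    (A : set V) (B : set V') (f : V -> V') (g : V' -> W) :
  smooth_sub A f -> (forall x, A x -> B (f x)) -> smooth_sub B g -> smooth_sub A (g \o f).
Proof.
move=> fs AB gs x Ax; have [U [f' [Uo Ux fU ff]]] := fs x Ax.
have [U' [g' [Uo' Ux' gU gg]]] := gs _ (AB x Ax).
pose N := U `&` f' @^-1` U'; have No : open N.
  rewrite openE => y [Uy Uy']; rewrite /interior.
  have H : \forall z \near y, U' (f' z).
    exact: (smooth_on_continuous fU Uy (open_nbhs_nbhs (conj Uo' Uy'))).
  by apply: filterS2 (open_nbhs_nbhs (conj Uo Uy)) H => z; split.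
exists N, (g' \o f'); split; first exact: No.
- by split => //; rewrite /= ff.
- have fN : smooth_on N f' by apply: smooth_on_sub fU => y [].
  by apply: (smooth_on_comp No fV' fW Uo' _ gU fN) => y [].
- by move=> y Ay [Uy Uy']; rewrite /= gg ff//; [exact: AB|rewrite -ff].
Qed.

Lemma smooth_sub_on (V W : normedModType R) (A : set V) (f : V -> W) :
  smooth_on setT f -> smooth_sub A f.
Proof. by move=> fs x Ax; exists setT, f; split => //; exact: openT. Qed.

(* For rigid A, Dsub A f does not depend on the choice of a local extension of f. *)
Definition rigid (A : set 'rV[R]_2) : Prop :=
  forall z (U U' : set 'rV[R]_2) (g g' : 'rV[R]_2 -> 'rV[R]_2),
  A z -> open U -> U z -> open U' -> U' z -> smooth_on U g -> smooth_on U' g' ->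
  (forall y, A y -> U y -> U' y -> g y = g' y) -> 'J g z = 'J g' z.

Lemma rigidT : rigid setT.
Proof.
move=> z U U' g g' _ Uo Uz Uo' Uz' gU gU' gg.
have No : open (U `&` U') by exact: openI.
apply: (jacobian_ext No _ (conj Uz Uz')) => [|y [Uy Uy']]; first exact: smooth_on_sub gU'.
by rewrite gg.
Qed.

Lemma DsubE (A U : set 'rV[R]_2) (f g : 'rV[R]_2 -> 'rV[R]_2) z :
  rigid A -> A z -> open U -> U z -> smooth_on U g ->
  (forall y, A y -> U y -> g y = f y) -> Dsub A f z = ('J g z)^T.
Proof.
move=> Ar Az Uo Uz gU gf; rewrite /Dsub; set P := (X in xget _ X).
have [U' [g' [Uo' Uz' gU' gf' ->]]] : P (xget 0 P).
  by apply: xgetPex; exists ('J g z)^T, U, g.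
apply: (congr1 (@trmx R 2 2)); apply: (Ar z U' U g' g Az Uo' Uz' Uo Uz gU' gU) => y Ay Uy' Uy.
by rewrite gf// gf'.
Qed.

Lemma Dsub_comp (A B : set 'rV[R]_2) (f g : 'rV[R]_2 -> 'rV[R]_2) z :
  rigid A -> rigid B -> smooth_sub A f -> (forall x, A x -> B (f x)) -> smooth_sub B g ->
  A z -> Dsub A (g \o f) z = Dsub B g (f z) *m Dsub A f z.
Proof.
move=> Ar Br fs AB gs Az; have [U [f' [Uo Uz fU ff]]] := fs z Az.
have [U' [g' [Uo' Uz' gU gg]]] := gs _ (AB z Az).
rewrite (DsubE Ar Az Uo Uz fU ff) (DsubE Br (AB z Az) Uo' Uz' gU gg).
pose N := U `&` f' @^-1` U'; have Nz : nbhs z N.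
  apply: filterI; first exact: (open_nbhs_nbhs (conj Uo Uz)).
  apply: (smooth_on_continuous fU Uz); rewrite ff//.
  exact: (open_nbhs_nbhs (conj Uo' Uz')).
have Nz' : (N°) z by [].
have No : open N° by exact: open_interior.
have fz : f' z = f z by rewrite ff.
have fN : smooth_on N° f' by apply: smooth_on_sub fU => y /interior_subset[].
have gfN : smooth_on N° (g' \o f').
  by apply: (smooth_on_comp No _ _ Uo' _ gU fN) => y /interior_subset[].
have fd : differentiable f' z by exact: (smooth_on_differentiable Uo _ _ fU Uz).
have gd : differentiable g' (f' z).
  by rewrite fz; exact: (smooth_on_differentiable Uo' _ _ gU Uz').
have gfE y : A y -> N° y -> (g' \o f') y = (g \o f) y.
  move=> Ay /interior_subset[Uy Uy'] /=.
  by rewrite -(ff y Ay Uy) gg// ff//; exact: AB.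
rewrite (DsubE Ar Az No Nz' gfN gfE) (jacobian_comp fd gd) trmx_mul.
by rewrite fz.
Qed.

Lemma Dsub_id (A : set 'rV[R]_2) f z : rigid A -> A z -> (forall y, A y -> f y = y) ->
  Dsub A f z = 1%:M.
Proof.
move=> Ar Az fE.
rewrite (DsubE (g := id) Ar Az openT I (smooth_on_id openT)) ?jacobian_id ?trmx1//.
by move=> y Ay _; rewrite fE.
Qed.

Definition affine (L : 'M[R]_2) (b z : 'rV[R]_2) : 'rV[R]_2 := z *m L + b.

Lemma smooth_affine (L : 'M[R]_2) (b : 'rV[R]_2) : smooth_on setT (affine L b).
Proof.
apply: (smooth_on_add openT); last exact: (smooth_on_cst openT).
by apply: (smooth_on_mulmx openT); [exact: (smooth_on_id openT)|exact: (smooth_on_cst openT)].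
Qed.

Lemma jacobian_affine (L : 'M[R]_2) (b z : 'rV[R]_2) : 'J (affine L b) z = L.
Proof.
have d : differentiable (affine L b) z.
  exact: (smooth_on_differentiable openT _ _ (smooth_affine L b) (I : setT z)).
apply: (jacobian_eq d) => v.
have vd : derivable (id : 'rV[R]_2 -> 'rV[R]_2) z v by exact: derivable_id.
have [D E] := derive_mulmx vd (derivable_cst L z v).
have H1 : is_derive z v (fun y : 'rV[R]_2 => y *m L) (v *m L).
  by split; [exact: D|rewrite E derive_id derive_cst mulmx0 addr0].
have [_] := is_deriveD H1 (is_derive_cst b z v); rewrite addr0; exact.
Qed.

Lemma Dsub_affine (A : set 'rV[R]_2) (f : 'rV[R]_2 -> 'rV[R]_2) L b z :
  rigid A -> smooth_sub A f -> A z -> Dsub A (affine L b \o f) z = L^T *m Dsub A f z.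
Proof.
move=> Ar fs Az.
rewrite (Dsub_comp Ar rigidT fs (fun _ _ => I) (smooth_sub_on (smooth_affine L b)) Az).
rewrite (DsubE (g := affine L b) rigidT (I : setT (f z)) openT I (smooth_affine L b)) ?jacobian_affine//.
Qed.

End SmoothSub.

Section Base.
Context {R : realType} {M : topologicalType} (w : symplectic4 R M) (Phi : M -> 'rV[R]_2).
Hypothesis Phii : integrable_system w Phi.

Let Phis : smooth_map w Phi. Proof. by case: Phii. Qed.

(* Where dPhi is onto, the chain rule for g \o Phi = g' \o Phi determines the
   derivatives; such points are dense. *)
Lemma base_jacobian p (O V V' : set 'rV[R]_2) (g g' : 'rV[R]_2 -> 'rV[R]_2) :
  open O -> O (Phi p) -> open V -> V (Phi p) -> open V' -> V' (Phi p) ->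
  smooth_on V g -> smooth_on V' g' ->
  (forall q, O (Phi q) -> V (Phi q) -> V' (Phi q) -> g (Phi q) = g' (Phi q)) ->
  'J g (Phi p) = 'J g' (Phi p).
Proof.
move=> Oo Op Vo Vp Vo' Vp' gV gV' gg; have [_ _ [D [Do Dd D2]] _] := Phii.
pose N := O `&` V `&` V'; have No : open N by do 2?apply: openI.
have NM := open_Phi Phis No.
have JE q : rk w Phi q = 2%N -> N (Phi q) -> 'J g (Phi q) = 'J g' (Phi q).
  move=> r2 Nq; have [wc cq] := sm_chart_at w q; set c := chart_at w q in wc cq.
  have Pd : differentiable (Phi \o cinv c) (cmap c q).
    exact: (smooth_on_differentiable (open_cimg wc openT) _ _
      ((smooth_map_fun _ _).1 Phis c wc) (mem_cimg cq I)).
  have Pq : (Phi \o cinv c) (cmap c q) = Phi q by rewrite /= (sm_cancel wc cq).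
  have [[_ Vq] Vq'] := Nq.
  have gd : differentiable g ((Phi \o cinv c) (cmap c q)).
    rewrite Pq; exact: (smooth_on_differentiable Vo _ _ gV Vq).
  have gd' : differentiable g' ((Phi \o cinv c) (cmap c q)).
    rewrite Pq; exact: (smooth_on_differentiable Vo' _ _ gV' Vq').
  have gPd : differentiable (g \o (Phi \o cinv c)) (cmap c q) by exact: differentiable_comp.
  have EJ : 'J (g \o (Phi \o cinv c)) (cmap c q) = 'J (g' \o (Phi \o cinv c)) (cmap c q).
    apply: (jacobian_eq gPd) => v.
    rewrite -(deriveEjacobian v (differentiable_comp Pd gd')); apply: near_eq_derive.
    by apply: filterS (nbhs_cimg wc NM cq Nq) => y /(cimg_inv wc)[_ [[Oy Vy] Vy'] _]; exact: gg.
  have Dfull : row_full (dPhi w Phi q) by rewrite /row_full; apply/eqP.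
  move: EJ; rewrite (jacobian_comp Pd gd) (jacobian_comp Pd gd') Pq.
  exact (@row_full_inj _ _ _ _ _ Dfull _ _).
have cont (k : 'rV[R]_2 -> 'rV[R]_2) (K : set 'rV[R]_2) : open K -> K (Phi p) -> smooth_on K k ->
    {for p, continuous (jacobian k \o Phi)}.
  move=> Ko Kp kK; apply: continuous_comp; first exact: (Phi_continuous Phis).
  exact: (smooth_on_continuous (smooth_on_jacobian Ko kK) Kp).
apply: contrapT => ne; pose Z := fun q => 'J g (Phi q) - 'J g' (Phi q).
have Zc : {for p, continuous Z}.
  exact: (cvgB (cont _ _ Vo Vp gV) (cont _ _ Vo' Vp' gV')).
have Zp : nbhs (Z p) [set A | A != 0].
  have Z0 : 0 < `|Z p| by rewrite normr_gt0; apply/eqP => /subr0_eq.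
  apply: filterS (nbhsx_ballx (Z p) _ Z0) => A; rewrite -ball_normE /=.
  by apply: contraTneq => ->; rewrite subr0 ltxx.
have ZN : nbhs p (Z @^-1` [set A | A != 0] `&` Phi @^-1` N).
  by apply: filterI; [exact: (Zc _ Zp)|exact: (open_nbhs_nbhs (conj NM (conj (conj Op Vp) Vp')))].
set K := (X in nbhs p X) in ZN.
have [q [/interior_subset[Zq Nq] Dq]] := Dd K° (ex_intro _ p ZN) (@open_interior _ K).
by move: Zq; rewrite /Z /= (JE q (D2 q Dq) Nq) subrr eqxx.
Qed.

(** Serves for the whole base and for the sets [S_], which are relatively open in it. *)
Lemma rigid_base (O : set 'rV[R]_2) : open O -> rigid (base Phi `&` O).
Proof.
move=> Oo _ U U' g g' [[p _ <-] Op] Uo Up Uo' Up' gU gU' gg.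
apply: (base_jacobian Oo Op Uo Up Uo' Up' gU gU') => q Oq; apply: gg.
by split => //; exists q.
Qed.

End Base.

(** * Local finiteness of the focus-focus values *)

Section FocusFocusIsolated.
Context {R : realType} {M : topologicalType} (w : symplectic4 R M) (Phi : M -> 'rV[R]_2).
Hypothesis fs : faithful_semitoric w Phi.

Let Phis : smooth_map w Phi. Proof. by case: (fs_integrable fs). Qed.

(** Each block times its conjugate is the scalar [d ^+ 2 + s ^+ 2], which is [d ^+ 2 + 1] for [s] a
    sign; hence [B] is the inverse up to this positive factor. *)
Lemma ff_mx_unit (s d : R) : is_sign s -> ff_mx s d \in unitmx.
Proof.
move=> ss; pose B : 'M[R]_(2 + 2) := block_mx (rot2 d (- s)) 0 0 (rot2 (- d) (- s)).
have sd : d ^+ 2 + 1 != 0 :> R by rewrite gt_eqF// ltr_wpDl// sqr_ge0.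
have E : ff_mx s d *m ((d ^+ 2 + 1)^-1 *: B) = 1%:M.
  rewrite -scalemxAr /ff_mx /B mulmx_block !(mulmx0, mul0mx, addr0, add0r) !rot2_mul.
  have r0 : rot2 (d ^+ 2 + 1) 0 = (d ^+ 2 + 1)%:M :> 'M[R]_2.
    by apply/matrixP => i j; rewrite !mxE; have [->|->] := ord2_cases i;
       have [->|->] := ord2_cases j; rewrite ?mulr1n ?mulr0n ?oppr0.
  have -> : rot2 (d * d - s * - s) (d * - s + s * d) = rot2 (d ^+ 2 + 1) 0.
    by congr rot2; [rewrite -(is_sign_sqr ss)|]; ring.
  have -> : rot2 (- d * - d - s * - s) (- d * - s + s * - d) = rot2 (d ^+ 2 + 1) 0.
    by congr rot2; [rewrite -(is_sign_sqr ss)|]; ring.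
  by rewrite r0 -scalar_mx_block scale_scalar_mx mulVf.
by have [] := mulmx1_unit E.
Qed.

(** The field of J has invertible linearization at [p], so in a chart it is injective near [p] and
    vanishes only there; fixed points of the action are zeros of this field. *)
Lemma focus_focus_isolated p (rho : 'rV[R]_1 -> M -> M) : focus_focus w Phi p ->
  effective_torus_action w setT (fun p => const_mx (Defs.J Phi p)) rho ->
  isolated (fixed_points rho) p.
Proof.
move=> [_ _ [r0 [E [[_ EE] sf]]]] act.
have sJ : smooth_fun w setT (Defs.J Phi) by exact: (smooth_fun_coord Phis).
have Hf := circle_flow sJ act; have period t := circle_period t act.
have [wc cp] := sm_chart_at w p; set c := chart_at w p in wc cp EE.
have X0 : hamvec w c (Defs.J Phi) (cmap c p) = 0 by exact: (rk0_hamvec Phis 0 r0).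
have hid : smooth_on setT (fun z : 'rV[R]_2 => z 0 0).
  exact: (smooth_on_coordinate 0 openT (smooth_on_id openT)).
have [s [d EJ]] := focus_focus_linearization Phis r0 EE sf openT I hid sJ (fun q _ => erefl).
have Eu := slice_frame_unit EE.
have [ss _] := circle_linearization Hf period (fs_connected fs) wc cp X0 Eu EJ.
have Ju : 'J (hamvec w c (Defs.J Phi)) (cmap c p) \in unitmx.
  have U : (ff_mx s d : 'M[R]_4) *m (E : 'M[R]_4) \in unitmx.
    by rewrite unitmx_mul; apply/andP; split; [exact: ff_mx_unit|exact: Eu].
  have := U; rewrite -[X in X \in _](EJ : (E : 'M[R]_4) *m _ = _) unitmx_mul.
  by case/andP.
have io := open_cimg wc openT; have cx := mem_cimg cp (I : setT p).
have [r r0' inj] := local_injectivity io (hamvec_smooth wc openT sJ) cx Ju.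
rewrite circle_fixed_points; split; first by apply/mem_set; exact: (flow_fixed Hf wc cp X0).
exists [set q | cdom c q /\ ball (cmap c p) r (cmap c q)].
  apply: filterI; first exact: (open_nbhs_nbhs (conj (sm_open wc).1 cp)).
  exact: (cmap_continuous wc cp (nbhsx_ballx _ _ r0')).
apply/seteqP; split=> q; last first.
  move=> ->; split; first by split => //; exact: ballxx.
  exact: (flow_fixed Hf wc cp X0).
move=> [[cq bq] fq].
have Xq : hamvec w c (Defs.J Phi) (cmap c q) = 0.
  have [_ H0] := hf_curve Hf q; have := H0 0 c wc; rewrite (hf_zero Hf) => /(_ cq)[_ <-].
  have -> : cmap c \o (fun t => rho (t *: const_mx 1) q) = cst (cmap c q).
    by apply/funext => t; rewrite /= fq.
  by rewrite derive_cst.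
have E2 : cmap c q = cmap c p by apply: inj => //; [exact: ballxx|rewrite Xq X0].
by rewrite /= -(sm_cancel wc cq) E2 (sm_cancel wc cp).
Qed.

Lemma focus_focus_critical p : focus_focus w Phi p ->
  critical_values_J w Phi (Defs.J Phi p).
Proof.
move=> [_ _ [r0 _]]; exists p => //=.
have [wc cp] := sm_chart_at w p; set c := chart_at w p in wc cp *.
have := rk0_hamvec Phis 0 r0; rewrite -/c /hamvec.
move=> /(congr1 (mulmx^~ (omega w c (cmap c p)))).
by rewrite mul0mx (mulmxKV (omega_nondegenerate wc cp)).
Qed.

(* Focus-focus points are critical for J and isolated fixed points of the circle action,
   so by (F5) and (F6) their values are locally finite in the base. *)
Lemma near_Bwt p : Bwt w Phi (Phi p) -> \forall q \near p, Bwt w Phi (Phi q).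
Proof.
move=> [_ nff].
suff H : \forall q \near p, ~ Bff w Phi (Phi q).
  by apply: filterS H => q; split => //; exists q.
have [rho [act fin]] := fs_circle fs.
have Pc := Phi_continuous Phis (x := p).
have nlim : ~ limit_point (critical_values_J w Phi) (Defs.J Phi p).
  move=> lp; have : (limit_point (critical_values_J w Phi) `&` range (Defs.J Phi)) (Defs.J Phi p).
    by split => //; exists p.
  by rewrite (fs_crit_discrete fs).
move: nlim; rewrite not_limit_pointE => -[U Ux UJ].
(* A finite set by (F6). It contains the focus-focus values with the same first coordinate as
   [Phi p], and (F5) excludes those with other first coordinates near [p]. *)
pose T := Phi @` (Defs.J Phi @^-1` [set Defs.J Phi p] `&` isolated (fixed_points rho)).
have Tf : finite_set T by apply: finite_image; exact: fin.
have Tc : closed (T `\ Phi p).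
  exact: (accessible_finite_set_closed.1 (hausdorff_accessible (@norm_hausdorff _ _)) _ (finite_setD _ Tf)).
have Jc : {for p, continuous (Defs.J Phi)}.
  apply: (@continuous_comp _ _ _ Phi (fun z : 'rV[R]_2 => z 0 0)); first exact: Pc.
  exact: coord_continuous.
have H1 : \forall q \near p, U (Defs.J Phi q) := Jc _ Ux.
have H2 : \forall q \near p, ~ (T `\ Phi p) (Phi q).
  have nT : nbhs (Phi p) (~` (T `\ Phi p)).
    by apply: open_nbhs_nbhs; split; [exact: closed_openC|by case=> _; apply].
  exact: (Pc _ nT).
apply: filterS2 H1 H2 => q Uq nTq [r rff rq]; apply: nTq.
have rJ : Defs.J Phi r = Defs.J Phi p.
  by apply: UJ; split; [exact: (focus_focus_critical rff)|rewrite /Defs.J rq].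
split; last by move=> qp; apply: nff; exists r => //; rewrite rq.
exists r => //; split=> //.
exact: (focus_focus_isolated rff act).
Qed.

(** [U] is open only relative to [Bwt]; its preimage is open because that of [Bwt] is, the
    focus-focus values being locally finite. *)
Lemma open_affine_chart U chi : affine_chart w Phi U chi -> open (Phi @^-1` U).
Proof.
move=> [[V [Vo UE]] _ _ _]; rewrite openE => p Up; rewrite /interior.
have [Op Bp] : V (Phi p) /\ Bwt w Phi (Phi p) by move: Up; rewrite /= UE.
apply: filterS2 (open_nbhs_nbhs (conj (open_Phi Phis Vo) Op)) (near_Bwt Bp) => q Oq Bq.
by rewrite /= UE.
Qed.

End FocusFocusIsolated.

Lemma sum_ord2 (V : nmodType) (F : 'I_2 -> V) : \sum_i F i = F 0 + F 1.
Proof. by rewrite big_ord_recl big_ord1; congr (_ + F _); exact: val_inj. Qed.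

Lemma mulmx_ord2 (V : pzSemiRingType) m n (A : 'M[V]_(m, 2)) (B : 'M[V]_(2, n)) i j :
  (A *m B) i j = A i 0 * B 0 j + A i 1 * B 1 j.
Proof. by rewrite mxE sum_ord2. Qed.

Lemma inverse_entry11 (V : pzRingType) (A B : 'M[V]_2) :
  A *m B = 1%:M -> B 0 1 = 0 -> A 1 1 * B 1 1 = 1.
Proof.
move=> /(congr1 (fun C : 'M[V]_2 => C 1 1)); rewrite mulmx_ord2 => E B0.
by move: E; rewrite B0 mulr0 add0r mxE.
Qed.

Lemma mulr1_neq0 (V : nzRingType) (x y : V) : x * y = 1 -> y != 0.
Proof. by move=> xy; apply/eqP => y0; move/eqP: xy; rewrite y0 mulr0 eq_sym oner_eq0. Qed.

Lemma sgr_ball (K : realFieldType) (x y : K) : ball x `|x| y -> x != 0 -> Num.sg y = Num.sg x.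
Proof.
rewrite /ball /= => bq; case: (ltgtP x 0) => // x0 _.
  by rewrite !ltr0_sg//; move: bq; rewrite (ltr0_norm x0) ltr_norml => /andP[]; lra.
by rewrite !gtr0_sg//; move: bq; rewrite (gtr0_norm x0) ltr_norml => /andP[]; lra.
Qed.

(** * The vertical derivative of [psi] *)

Section Monotonicity.
Context {R : realType}.

(** Composed with the projection to the first axis, [f] agrees on [A] with an affine map; by
    rigidity both have the same derivative. *)
Lemma Dsub_first_row (A : set 'rV[R]_2) (f : 'rV[R]_2 -> 'rV[R]_2) e a z :
  rigid A -> smooth_sub A f -> A z -> (forall y, A y -> f y 0 0 = e * y 0 0 + a) ->
  Dsub A f z 0 0 = e /\ Dsub A f z 0 1 = 0.
Proof.
move=> Ar fs Az fE; pose P : 'M[R]_2 := delta_mx 0 0; pose b : 'rV[R]_2 := a *: delta_mx 0 0.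
have E : P^T *m Dsub A f z = (e *: P)^T.
  rewrite -(Dsub_affine P 0 Ar fs Az) -(jacobian_affine (e *: P) b z).
  apply: (DsubE Ar Az openT I (smooth_affine _ _)) => y Ay _.
  apply/rowP => j; rewrite !mxE !sum_ord2 !mxE fE//.
  by have [->|->] := ord2_cases j; rewrite /=; ring.
have Ej j := congr1 (fun B : 'M[R]_2 => B 0 j) E.
by split; [have := Ej 0|have := Ej 1];
  rewrite !mxE sum_ord2 !mxE /= !(mul1r, mul0r, addr0, mulr1, mulr0).
Qed.

End Monotonicity.

Section VerticalSign.
Context {R : realType} {M1 M2 : topologicalType}.
Variables (w1 : symplectic4 R M1) (w2 : symplectic4 R M2).
Variables (Phi1 : M1 -> 'rV[R]_2) (Phi2 : M2 -> 'rV[R]_2).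
Variables (F : M1 -> M2) (G : M2 -> M1) (psi phi : 'rV[R]_2 -> 'rV[R]_2).
Hypothesis S : system_iso w1 w2 Phi1 Phi2 F G psi phi.
Hypotheses (fs1 : faithful_semitoric w1 Phi1) (fs2 : faithful_semitoric w2 Phi2).
Variables (eta a : R).
Hypothesis psi0 : forall z, base Phi1 z -> psi z 0 0 = eta * z 0 0 + a.

Let B1 := base Phi1.
Let B2 := base Phi2.
Let r1 : rigid B1.
Proof. by have := rigid_base (fs_integrable fs1) openT; rewrite setIT. Qed.
Let r2 : rigid B2.
Proof. by have := rigid_base (fs_integrable fs2) openT; rewrite setIT. Qed.

Lemma psi_base z : B1 z -> B2 (psi z).
Proof. by move=> [p _ <-]; exists (F p) => //; rewrite (si_Phi S). Qed.

Lemma psiK z : B1 z -> phi (psi z) = z.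
Proof. by move=> [p _ <-]; exact: (si_psiK S). Qed.

Lemma Dsub_inverse z : B1 z -> Dsub B2 phi (psi z) *m Dsub B1 psi z = 1%:M.
Proof.
move=> Bz; rewrite -(Dsub_comp r1 r2 (si_psi S) psi_base (si_phi S) Bz).
exact: (Dsub_id r1 Bz psiK).
Qed.

Lemma vertical_inverse z : B1 z -> Dsub B2 phi (psi z) 1 1 * Dsub B1 psi z 1 1 = 1.
Proof.
move=> Bz; have [_ D01] := Dsub_first_row r1 (si_psi S) Bz psi0.
exact: (inverse_entry11 (Dsub_inverse Bz) D01).
Qed.

Lemma vertical_neq0 z : B1 z -> Dsub B1 psi z 1 1 != 0.
Proof.
by move=> Bz; exact: (mulr1_neq0 (vertical_inverse Bz)).
Qed.

(** The derivative of [psi] is lower triangular and invertible, so its last entry never vanishes;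
    the sign of this entry, seen as a function on [M1], is locally constant, and [M1] is
    connected. *)
Lemma vertical_sign : exists2 sigma : R, is_sign sigma &
  forall z, B1 z -> Num.sg (Dsub B1 psi z 1 1) = sigma.
Proof.
pose s p := Num.sg (Dsub B1 psi (Phi1 p) 1 1).
have Bp p : B1 (Phi1 p) by exists p.
have P1 : smooth_map w1 Phi1 by case: (fs_integrable fs1).
have loc p : \forall q \near p, s q = s p.
  have [U [h [Uo Up hU hE]]] := si_psi S (Bp p).
  have DE q : U (Phi1 q) -> Dsub B1 psi (Phi1 q) 1 1 = 'J h (Phi1 q) 1 1.
    by move=> Uq; rewrite (DsubE r1 (Bp q) Uo Uq hU hE) mxE.
  have c : {for p, continuous (fun q => 'J h (Phi1 q) 1 1)}.
    apply: (@continuous_comp _ _ _ Phi1 (fun z => 'J h z 1 1)).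
      exact: (Phi_continuous P1).
    exact: (smooth_on_continuous (smooth_on_entry Uo 1 1 (smooth_on_jacobian Uo hU)) Up).
  have n0 : 'J h (Phi1 p) 1 1 != 0 by rewrite -(DE p Up) vertical_neq0.
  have n0' : 0 < `|'J h (Phi1 p) 1 1| by rewrite normr_gt0.
  have nb : \forall q \near p, ball ('J h (Phi1 p) 1 1) `|'J h (Phi1 p) 1 1| ('J h (Phi1 q) 1 1).
    exact: (c _ (nbhsx_ballx _ _ n0')).
  have nU : \forall q \near p, U (Phi1 q).
    exact: (open_nbhs_nbhs (conj (open_Phi P1 Uo) Up)).
  have sE q : U (Phi1 q) -> s q = Num.sg ('J h (Phi1 q) 1 1).
    by move=> Uq; exact: (congr1 Num.sg (DE q Uq)).
  apply: filterS2 nb nU => q bq Uq.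
  exact: etrans (sE q Uq) (etrans (sgr_ball bq n0) (esym (sE p Up))).
have [[p0]|emp] := pselect (exists p : M1, True).
  move=> _; exists (s p0); last first.
    by move=> _ [q _ <-]; exact: (locally_constant_connected (fs_connected fs1) loc).
  by rewrite /s; have := vertical_neq0 (Bp p0); case: sgrP => //; [left|right].
(* Here [M1] is empty and so is its base, hence the value 1 is only a default. *)
exists 1; first by left.
by move=> z [p]; case: emp; exists p.
Qed.

(* Vertical slices of the base are intervals because the fibers of J are connected. *)
Lemma vertical_monotone sigma y z : (forall z, B1 z -> Num.sg (Dsub B1 psi z 1 1) = sigma) ->
  B1 y -> B1 z -> y 0 0 = z 0 0 -> y 0 1 < z 0 1 -> 0 < sigma * (psi z 0 1 - psi y 0 1).
Proof.
move=> sg By Bz yz0 yz1; have P1 : smooth_map w1 Phi1 by case: (fs_integrable fs1).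
pose e k : 'rV[R]_2 := delta_mx 0 k; pose pt (t : R) : 'rV[R]_2 := y 0 0 *: e 0 + t *: e 1.
have ptE (x : 'rV[R]_2) : x 0 0 = y 0 0 -> x = pt (x 0 1).
  move=> x0; rewrite /pt -x0; apply/rowP => i; rewrite !mxE.
  by have [->|->] := ord2_cases i; rewrite /=; ring.
have Bpt t : y 0 1 <= t <= z 0 1 -> B1 (pt t).
  move=> /andP[yt tz]; have Cc := @fs_J_connected _ _ _ _ fs1 (y 0 0); set C := _ @^-1` _ in Cc.
  have Hc : {within C, continuous (fun p => Phi1 p 0 1)}.
    apply: continuous_subspaceT => p.
    apply: (@continuous_comp _ _ _ Phi1 (fun z : 'rV[R]_2 => z 0 1)).
      exact: (Phi_continuous P1).
    exact: coord_continuous.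
  have /connected_intervalP Ii := connected_continuous_connected Cc Hc.
  have [py _ pyE] := By; have [pz _ pzE] := Bz.
  have Iy : [set Phi1 x 0 1 | x in C] (y 0 1) by exists py; rewrite ?pyE// /C /= /Defs.J pyE.
  have Iz : [set Phi1 x 0 1 | x in C] (z 0 1) by exists pz; rewrite ?pzE// /C /= /Defs.J pzE.
  have [p Cp pE] := Ii _ _ Iy Iz t (introT andP (conj yt tz)).
  by exists p => //; rewrite (ptE (Phi1 p) Cp) pE.
pose g t := psi (pt t) 0 1.
have yE : psi y 0 1 = g (y 0 1) by rewrite /g -ptE.
have zE : psi z 0 1 = g (z 0 1) by rewrite /g -ptE.
have gc : {within `[y 0 1, z 0 1], continuous g}.
  apply: (@within_comp _ _ _ _ B1 pt (fun z => psi z 0 1)).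
  - apply: continuous_subspaceT => t.
    apply: cvgD; [exact: cvg_cst|exact: scalel_continuous].
  - by move=> t; rewrite /= in_itv; exact: Bpt.
  - apply: (@within_comp _ _ _ _ setT psi (fun z : 'rV[R]_2 => z 0 1)) => //.
      exact: (smooth_sub_within (si_psi S)).
    by apply: continuous_subspaceT; exact: coord_continuous.
have gd t : t \in `]y 0 1, z 0 1[ -> is_derive t 1 g (Dsub B1 psi (pt t) 1 1).
  rewrite in_itv /= => /andP[yt tz].
  have Bt : B1 (pt t) by apply: Bpt; rewrite !ltW.
  have [U [h [Uo Ut hU hE]]] := si_psi S Bt.
  have pc : {for t, continuous pt} by apply: cvgD; [exact: cvg_cst|exact: scalel_continuous].
  have nU : \forall s \near t, U (pt s) := pc _ (open_nbhs_nbhs (conj Uo Ut)).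
  have nI : \forall s \near t, s \in `]y 0 1, z 0 1[.
    by apply: near_in_itvoo; rewrite in_itv /= yt tz.
  have near_t : \forall s \near t, h (pt s) 0 1 = g s.
    apply: filterS2 nU nI => s Us; rewrite in_itv /= => /andP[ys sz].
    by rewrite /g hE//; apply: Bpt; rewrite !ltW.
  have hs := smooth_on_entry Uo 0 1 hU.
  have hd : derivable (fun s : R => h (pt s) 0 1) t 1.
    apply: (derivable_line (fun z => h z 0 1) (y 0 0 *: e 0) (e 1) t).2.
    exact: (smooth_on_derivable hs Ut).
  split; first exact: (near_eq_derivable near_t hd).
  rewrite -(near_eq_derive _ near_t) (derive_line (fun z => h z 0 1)).
  have hdf : differentiable h (pt t) by exact: (smooth_on_differentiable Uo _ _ hU Ut).
  rewrite (derive_entry 0 1 (diff_derivable hdf)) (deriveEjacobian _ hdf).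
  by rewrite -rowE (DsubE r1 Bt Uo Ut hU hE) !mxE.
have [t tI tE] := MVT yz1 gd gc; rewrite yE zE tE mulrA pmulr_lgt0 ?subr_gt0//.
have Bt : B1 (pt t) by move: tI; rewrite in_itv /= => /andP[yt tz]; apply: Bpt; rewrite !ltW.
by rewrite -(sg _ Bt) -normrEsg normr_gt0 vertical_neq0.
Qed.

End VerticalSign.

(** * Transport of cartographic pairs *)

Section CutTransport.
Context {R : realType} {M1 M2 : topologicalType}.
Variables (w1 : symplectic4 R M1) (w2 : symplectic4 R M2).
Variables (Phi1 : M1 -> 'rV[R]_2) (Phi2 : M2 -> 'rV[R]_2).
Variables (F : M1 -> M2) (G : M2 -> M1) (psi phi : 'rV[R]_2 -> 'rV[R]_2).
Hypothesis S : system_iso w1 w2 Phi1 Phi2 F G psi phi.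
Hypotheses (fs1 : faithful_semitoric w1 Phi1) (fs2 : faithful_semitoric w2 Phi2).
Variables (eta a sigma : R).
Hypotheses (es : is_sign eta) (ss : is_sign sigma).
Hypothesis psi0 : forall z, base Phi1 z -> psi z 0 0 = eta * z 0 0 + a.
Hypothesis psi_sg : forall z, base Phi1 z -> Num.sg (Dsub (base Phi1) psi z 1 1) = sigma.
Variable eps : 'rV[R]_2 -> R.
Hypothesis sc : sign_choice w1 Phi1 eps.

Let eps2 c := sigma * eps (phi c).

Lemma Bff_psi z : base Phi1 z -> Bff w1 Phi1 z <-> Bff w2 Phi2 (psi z).
Proof.
have [Ps1 _ _ _] := fs_integrable fs1; have [Ps2 _ _ _] := fs_integrable fs2.
move=> Bz; split=> -[p pf pz].
  exists (F p); last by rewrite (si_Phi S) pz.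
  exact: (focus_focus_transport S Ps1 Ps2 (fs_almost_toric fs2) pf).
exists (G p); last by rewrite (si_Phi (system_iso_sym S)) pz (psiK S).
exact: (focus_focus_transport (system_iso_sym S) Ps2 Ps1 (fs_almost_toric fs1) pf).
Qed.

Lemma sign_choice_transport : sign_choice w2 Phi2 eps2.
Proof.
move=> c cf; have [q _ qc] := cf; have Bc : base Phi2 c by exists q.
have Sc := system_iso_sym S; have Bp := psi_base Sc Bc.
have [||] := sc (c := phi c); first by apply/(Bff_psi Bp); rewrite (psiK Sc).
  by rewrite /eps2 => ->; rewrite mulr1.
rewrite /eps2 => ->; rewrite mulrN1; case: ss => ->; first by right.
by rewrite opprK; left.
Qed.

Lemma vertical_le y z : base Phi1 y -> base Phi1 z -> y 0 0 = z 0 0 ->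
  (sigma * psi y 0 1 <= sigma * psi z 0 1) = (y 0 1 <= z 0 1).
Proof.
move=> By Bz yz.
have lt u v : base Phi1 u -> base Phi1 v -> u 0 0 = v 0 0 -> u 0 1 < v 0 1 ->
    sigma * psi u 0 1 < sigma * psi v 0 1.
  move=> Bu Bv uv0 uv1; have := vertical_monotone S fs1 fs2 psi0 psi_sg Bu Bv uv0 uv1.
  by rewrite mulrBr subr_gt0.
case: (ltgtP (y 0 1) (z 0 1)) => [yz1|zy1|yz1].
- by rewrite ltW// lt.
- by apply/negbTE; rewrite -ltNge lt.
- suff -> : y = z by rewrite lexx.
  by apply/rowP => i; have [->|->] := ord2_cases i.
Qed.

(** Vertical lines correspond because the first coordinate of [psi] is affine with nonzero slope. On
    such a line [sigma] times the second coordinate is increasing, and the factor [sigma] in [eps2]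
    absorbs the orientation. *)
Lemma cut_psi c z : Bff w1 Phi1 c -> base Phi1 c -> base Phi1 z ->
  Defs.cut Phi2 eps2 (psi c) (psi z) <-> Defs.cut Phi1 eps c z.
Proof.
move=> cf Bc Bz.
have x0 : z 0 0 = c 0 0 <-> psi z 0 0 = psi c 0 0.
  rewrite !psi0//; split=> [->//|/addIr]; apply: mulfI.
  by case: es => ->; rewrite ?oppr_eq0 oner_eq0.
have eE : eps2 (psi c) = sigma * eps c by rewrite /eps2 (psiK S).
have le : z 0 0 = c 0 0 -> (sigma * eps c * psi c 0 1 <= sigma * eps c * psi z 0 1) =
    (eps c * c 0 1 <= eps c * z 0 1).
  move=> zc; have [->|->] := sc cf; first by rewrite !mulr1 !mul1r vertical_le.
  by rewrite !mulrN1 !mulNr !lerN2 !mul1r vertical_le.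
split=> -[_ xz]; rewrite /= ?eE => yz.
  by have zc := x0.2 xz; split => //; rewrite -le.
split; [exact: (psi_base S)|exact: x0.1|by rewrite /= eE le].
Qed.

Lemma S_psi z : base Phi1 z -> S_ w2 Phi2 eps2 (psi z) <-> S_ w1 Phi1 eps z.
Proof.
move=> Bz; split=> -[_ nc]; split=> //.
- move=> [c cf cz]; apply: nc; have Bc : base Phi1 c by case: cf => p _ <-; exists p.
  by exists (psi c); [exact/(Bff_psi Bc)|exact/cut_psi].
- exact: (psi_base S).
- move=> [c2 cf2 cz]; apply: nc; have Bc2 : base Phi2 c2 by case: cf2 => p _ <-; exists p.
  have Bc := psi_base (system_iso_sym S) Bc2; have cK := psiK (system_iso_sym S) Bc2.
  rewrite -cK in cf2 cz; have cf := (Bff_psi Bc).2 cf2.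
  by exists (phi c2) => //; exact/cut_psi.
Qed.

(** The sums run over the cuts through corresponding points; [psi] matches the cuts and each sign
    acquires the factor [sigma]. *)
Lemma j_psi z : base Phi1 z -> j_ w2 Phi2 eps2 (psi z) = sigma * j_ w1 Phi1 eps z.
Proof.
move=> Bz; rewrite /j_ mulr_fsumr.
rewrite (@reindex_fsbig _ _ _ _ _ psi [set c | Bff w1 Phi1 c /\ Defs.cut Phi1 eps c z]).
  apply: eq_fsbigr => c /set_mem[cf _].
  by rewrite /eps2 (psiK S)//; case: cf => p _ <-; exists p.
have Bb c : Bff w1 Phi1 c -> base Phi1 c by move=> [p _ <-]; exists p.
split.
- move=> c [cf cz]; split; first exact/(Bff_psi (Bb _ cf)).
  exact/(cut_psi cf (Bb _ cf) Bz).
- move=> c c' /set_mem[cf _] /set_mem[cf' _] cc.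
  by rewrite -(psiK S (Bb _ cf)) cc (psiK S (Bb _ cf')).
- move=> c2 [cf2 cz]; have Bc2 : base Phi2 c2 by case: cf2 => p _ <-; exists p.
  have Bc := psi_base (system_iso_sym S) Bc2; have cK := psiK (system_iso_sym S) Bc2.
  rewrite -cK in cf2 cz *; have cf := (Bff_psi Bc).2 cf2.
  by exists (phi c2); rewrite ?cK//; split => //; exact/(cut_psi cf Bc Bz).
Qed.

End CutTransport.

(** * Limits of derivatives, and the reflection of the first axis *)

Section DsubContinuity.
Context {R : realType}.

Lemma Dsub_restrict (A B : set 'rV[R]_2) (f : 'rV[R]_2 -> 'rV[R]_2) z :
  rigid A -> rigid B -> A `<=` B -> smooth_sub B f -> A z -> Dsub A f z = Dsub B f z.
Proof.
move=> Ar Br AB fs Az; have [U [h [Uo Uz hU hE]]] := fs z (AB z Az).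
rewrite (DsubE Br (AB z Az) Uo Uz hU hE); apply: (DsubE Ar Az Uo Uz hU) => y Ay.
by apply: hE; exact: AB.
Qed.

Lemma Dsub_within (A : set 'rV[R]_2) (f : 'rV[R]_2 -> 'rV[R]_2) :
  rigid A -> smooth_sub A f -> {within A, continuous (Dsub A f)}.
Proof.
move=> Ar fs; apply/withinP => z N Az; have [U [h [Uo Uz hU hE]]] := fs z Az.
rewrite (DsubE Ar Az Uo Uz hU hE) => Nz.
have c : {for z, continuous (fun y => ('J h y)^T)}.
  exact: (smooth_on_continuous (smooth_on_trmx Uo (smooth_on_jacobian Uo hU)) Uz).
apply: filterS2 (open_nbhs_nbhs (conj Uo Uz)) (c _ Nz) => y Uy Ny Ay.
by rewrite (DsubE Ar Ay Uo Uy hU hE).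
Qed.

Lemma cvg_mulmx2 (T : Type) (FF : set_system T) (FFF : Filter FF) (X Y : T -> 'M[R]_2)
    (A B : 'M[R]_2) :
  X @ FF --> A -> Y @ FF --> B -> (fun t => X t *m Y t) @ FF --> A *m B.
Proof.
move=> XA YB; pose m (z : 'M[R]_2 * 'M[R]_2) : 'M[R]_2 := z.1 *m z.2.
have oT : open [set: 'M[R]_2 * 'M[R]_2] by exact: openT.
have sid : smooth_on setT (id : 'M[R]_2 * 'M[R]_2 -> _) by exact: (smooth_on_id oT).
have s1 : smooth_on setT (fun z : 'M[R]_2 * 'M[R]_2 => z.1).
  exact: (smooth_on_lin oT (L := fst) (f := id) (fun _ _ _ => erefl) (fun _ => cvg_fst) sid).
have s2 : smooth_on setT (fun z : 'M[R]_2 * 'M[R]_2 => z.2).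
  exact: (smooth_on_lin oT (L := snd) (f := id) (fun _ _ _ => erefl) (fun _ => cvg_snd) sid).
have mc : {for (A, B), continuous m}.
  exact: (smooth_on_continuous (smooth_on_mulmx oT s1 s2) (I : setT (A, B))).
exact: (cvg_comp _ _ (cvg_pair XA YB) mc).
Qed.

Lemma shear_mul (s t : R) : shear s *m shear t = shear (s + t).
Proof.
apply/matrixP => i j; rewrite mulmx_ord2 !mxE.
by have [->|->] := ord2_cases i; have [->|->] := ord2_cases j; rewrite /=; ring.
Qed.

(** The map x |-> eta x on the first coordinate. Followed by a translation it compensates the first
    coordinate of [psi], so that the transported map again preserves the first coordinate. *)
Definition flip (eta : R) : 'M[R]_2 := diag_mx (\row_i if i == 0 then eta else 1).

(** For [eta = -1] conjugation by the reflection inverts the shear; this is what lets (C2) survive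
    the exchange of left and right. *)
Lemma flip_shear (eta s : R) : is_sign eta ->
  (flip eta)^T *m shear s = shear (eta * s) *m (flip eta)^T.
Proof.
move=> es; apply/matrixP => i j; rewrite !mulmx_ord2 !mxE.
have [->|->] := ord2_cases i; have [->|->] := ord2_cases j; rewrite /= ?mulr1n ?mulr0n; try ring.
by rewrite mulrAC (is_sign_sqr es); ring.
Qed.

Lemma flipE (eta a : R) (z : 'rV[R]_2) :
  (affine (flip eta) (a *: delta_mx 0 0) z 0 0 = eta * z 0 0 + a) *
  (affine (flip eta) (a *: delta_mx 0 0) z 0 1 = z 0 1).
Proof. by split; rewrite !mxE sum_ord2 !mxE /= ?mulr1n ?mulr0n; ring. Qed.

Lemma flipK (eta a : R) : is_sign eta ->
  cancel (affine (flip eta) (a *: delta_mx 0 0)) (affine (flip eta) (- (eta * a) *: delta_mx 0 0)).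
Proof.
move=> es z; apply/rowP => i; have [->|->] := ord2_cases i; rewrite !flipE//.
by rewrite mulrDr mulrA (is_sign_sqr es) mul1r addrK.
Qed.

Lemma flip_entry11 (eta : R) (A B : 'M[R]_2) : B 0 1 = 0 ->
  ((flip eta)^T *m A *m B) 1 1 = A 1 1 * B 1 1.
Proof. by move=> B0; rewrite mulmx_ord2 B0 !mulmx_ord2 !mxE /= mulr1n mulr0n; ring. Qed.

Lemma flip_AGL (eta : R) b (g : 'rV[R]_2 -> 'rV[R]_2) : is_sign eta ->
  AGL2Z g -> AGL2Z (affine (flip eta) b \o g).
Proof.
move=> es [A [v [Au ->]]].
have [e [e2 eE]] : exists e : int, e * e = 1 /\ e%:~R = eta.
  by case: es => ->; [exists 1|exists (-1)].
pose L : 'M[int]_2 := diag_mx (\row_i if i == 0 then e else 1).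
have LE : map_mx intr L = flip eta.
  by apply/matrixP => i j; rewrite !mxE rmorphMn /=; case: ifP => _; rewrite ?eE ?rmorph1.
have Lu : L \in unitmx.
  suff /mulmx1_unit[] : L *m L = 1%:M by [].
  rewrite mulmx_diag -diag_const_mx; congr diag_mx; apply/rowP => i; rewrite !mxE.
  by case: ifP.
exists (A *m L), (v *m flip eta + b); split; first by rewrite unitmx_mul Au.
apply/funext => z; rewrite /= /affine map_mxM LE mulmxDl addrA.
by rewrite mulmxA.
Qed.

End DsubContinuity.

Lemma smooth_fun_sub (R : realType) (M : topologicalType) (w : symplectic4 R M)
    (Phi : M -> 'rV[R]_2) (U : set 'rV[R]_2) (f : 'rV[R]_2 -> 'rV[R]_2) :
  smooth_map w Phi -> open (Phi @^-1` U) -> smooth_sub U f ->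
  smooth_fun w (Phi @^-1` U) (f \o Phi).
Proof.
move=> Ps Uo fs c wc; apply: smooth_on_local => x [p [cp Up] <-].
have [V [h [Vo Vp hV hE]]] := fs _ Up.
have No : open (Phi @^-1` U `&` Phi @^-1` V) by apply: openI => //; exact: (open_Phi Ps).
exists (cimg c (Phi @^-1` U `&` Phi @^-1` V)); first exact: mem_cimg.
apply: (smooth_on_ext (open_cimg wc No) (f := (h \o Phi) \o cinv c)).
  by move=> y /(cimg_inv wc)[_ [Uy Vy] _]; exact: hE.
apply: smooth_on_sub (smooth_fun_Phi_comp Ps _ Vo hV wc).
by move=> _ [q [cq [_ Vq]] <-]; exists q.
Qed.

Lemma shear0 (R : realType) : shear 0 = 1%:M :> 'M[R]_2.
Proof. by apply/matrixP => i j; rewrite !mxE; case: eqP => //; rewrite if_same. Qed.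

Lemma is_sign_mul (R : realType) (s t : R) : is_sign s -> is_sign t -> is_sign (s * t).
Proof. by case=> ->; case=> ->; rewrite ?mulN1r ?mul1r ?opprK; [left|right|right|left]. Qed.

Lemma sgr_inverse (R : realType) (x y s : R) : is_sign s -> x * y = 1 -> Num.sg y = s -> Num.sg x = s.
Proof.
move=> ss /(congr1 Num.sg); rewrite sgrM sgr1 => + ys; rewrite ys => H.
by rewrite -[LHS]mulr1 -(is_sign_sqr ss) mulrA H mul1r.
Qed.

(** * Transport of a semitoric pair along the isomorphism *)

Section PairTransport.
Context {R : realType} {M1 M2 : topologicalType}.
Variables (w1 : symplectic4 R M1) (w2 : symplectic4 R M2).
Variables (Phi1 : M1 -> 'rV[R]_2) (Phi2 : M2 -> 'rV[R]_2).
Variables (F : M1 -> M2) (G : M2 -> M1) (psi phi : 'rV[R]_2 -> 'rV[R]_2).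
Hypothesis S : system_iso w1 w2 Phi1 Phi2 F G psi phi.
Hypotheses (fs1 : faithful_semitoric w1 Phi1) (fs2 : faithful_semitoric w2 Phi2).

Let Ps1 : smooth_map w1 Phi1. Proof. by case: (fs_integrable fs1). Qed.
Let Ps2 : smooth_map w2 Phi2. Proof. by case: (fs_integrable fs2). Qed.

Lemma Bwt_psi z : base Phi1 z -> Bwt w1 Phi1 z <-> Bwt w2 Phi2 (psi z).
Proof.
move=> Bz; have := Bff_psi S fs1 fs2 Bz; have := psi_base S Bz.
by move=> B2z BE; split=> -[_ nf]; split=> // /BE.
Qed.

(** Reduces the test of the transported map against charts of the second system to a property of
    [f]. The torus action is conjugated by [F], and the domain is connected as the image of [U]
    under [phi]. *)
Lemma affine_chart_pull U chi : affine_chart w2 Phi2 U chi ->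
  affine_chart w1 Phi1 [set z | base Phi1 z /\ U (psi z)] (chi \o psi).
Proof.
move=> Uchi; have Uo := open_affine_chart fs2 Uchi.
have [[V [Vo UE]] Uc [cs [g [gK gs]]] [rho act]] := Uchi; have S' := system_iso_sym S.
have UB z : U z -> base Phi2 z by rewrite UE => -[_ []].
set U1 := [set z | _ /\ _].
have U1U z : U1 z -> U (psi z) by case.
have UU1 z : U z -> U1 (phi z).
  by move=> Uz; split; [exact: (psi_base S' (UB z Uz))|rewrite (psiK S' (UB z Uz))].
split.
- have [V1 [Vo1 V1E]] := within_open (smooth_sub_within (si_psi S)) Vo.
  exists V1; split => //; apply/seteqP; split=> z.
    by move=> [Bz]; rewrite UE => -[Vz Wz]; split; [exact/V1E|exact/Bwt_psi].
  move=> [V1z Wz]; have Bz : base Phi1 z by case: Wz.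
  by split => //; rewrite UE; split; [exact/V1E|exact/Bwt_psi].
- have -> : U1 = phi @` U.
    apply/seteqP; split=> z; last by move=> [y Uy <-]; exact: UU1.
    by move=> [Bz Uz]; exists (psi z) => //; rewrite (psiK S).
  apply: (connected_continuous_connected Uc).
  by apply: smooth_sub_within; exact: (smooth_sub_subset UB (si_phi S)).
- have U1s : smooth_sub U1 psi by apply: (smooth_sub_subset _ (si_psi S)) => z [].
  split; first exact: (smooth_sub_comp _ _ U1s U1U cs).
  exists (phi \o g); split.
    by move=> z [Bz Uz]; rewrite /= gK// (psiK S).
  have gB z : (chi @` U) z -> base Phi2 (g z) by move=> [y Uy <-]; rewrite gK//; exact: UB.
  have imE : (chi \o psi) @` U1 `<=` chi @` U.
    by move=> _ [z Uz <-]; exists (psi z) => //; exact: U1U.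
  exact: (smooth_sub_subset imE (smooth_sub_comp _ _ gs gB (si_phi S))).
- exists (fun t p => G (rho t (F p))).
  have mu := smooth_fun_sub Ps2 Uo cs.
  have := transport_action (si_F S) (si_G S) (si_FG S) (si_GF S) (si_form S) Uo mu act.
  have -> : F @^-1` (Phi2 @^-1` U) = Phi1 @^-1` U1.
    apply/seteqP; split=> p /=; rewrite (si_Phi S); last by case.
    by split => //; exists p.
  have -> // : (chi \o Phi2) \o F = (chi \o psi) \o Phi1.
  by apply/funext => p; rewrite /= (si_Phi S).
Qed.

Variables (eta a sigma : R).
Hypotheses (es : is_sign eta) (ss : is_sign sigma).
Hypothesis psi0 : forall z, base Phi1 z -> psi z 0 0 = eta * z 0 0 + a.
Hypothesis psi_sg : forall z, base Phi1 z -> Num.sg (Dsub (base Phi1) psi z 1 1) = sigma.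
Variables (f : 'rV[R]_2 -> 'rV[R]_2) (eps : 'rV[R]_2 -> R).
Hypothesis fp : semitoric_pair w1 Phi1 f eps.

Let b : 'rV[R]_2 := a *: delta_mx 0 0.
Let l := affine (flip eta) b.
Let l' := affine (flip eta) (- (eta * a) *: delta_mx 0 0).
Let f2 := l \o (f \o phi).
Let eps2 c := sigma * eps (phi c).
Let S1 := S_ w1 Phi1 eps.
Let S2 := S_ w2 Phi2 eps2.

Let sc : sign_choice w1 Phi1 eps. Proof. by case: fp. Qed.
Let fc : cartographic_pair w1 Phi1 f S1. Proof. by case: fp. Qed.

Lemma phi_S z : S2 z -> S1 (phi z).
Proof.
move=> S2z; have Bz : base Phi2 z by case: S2z.
have S' := system_iso_sym S; apply/(S_psi S fs1 fs2 es psi0 psi_sg sc (psi_base S' Bz)).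
by rewrite (psiK S').
Qed.

Lemma psi_S z : S1 z -> S2 (psi z).
Proof.
move=> S1z; have Bz : base Phi1 z by case: S1z.
exact/(S_psi S fs1 fs2 es psi0 psi_sg sc Bz).
Qed.

Let lK : cancel l l'. Proof. exact: flipK. Qed.

Lemma image_within_inverse (A B : set 'rV[R]_2) : 
  (forall z, A z -> B (phi z)) -> forall z, (f2 @` A) z -> (f @` B) (l' z).
Proof. by move=> AB _ [z Az <-]; exists (phi z); [exact: AB|rewrite /f2 /= lK]. Qed.

Lemma open_S2 : exists V : set 'rV[R]_2, open V /\ S2 = V `&` base Phi2.
Proof.
have [_ _ [[V [Vo VE]] _] _ _] := fc; have S' := system_iso_sym S.
have [V2 [Vo2 V2E]] := within_open (smooth_sub_within (si_phi S)) Vo.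
exists V2; split=> //; apply/seteqP; split=> z.
  move=> S2z; have Bz : base Phi2 z by case: S2z.
  by split=> //; apply/(V2E z Bz); have := phi_S S2z; rewrite VE => -[].
move=> [V2z Bz]; rewrite -(psiK S' Bz); apply: psi_S; rewrite VE.
by split; [exact/(V2E z Bz)|exact: (psi_base S')].
Qed.

Lemma cartographic_transport : cartographic_pair w2 Phi2 f2 S2.
Proof.
have [[fcont [g [gK gc]]] _ [_ S1d] [fsm [g' [gK' gs']]] fZ] := fc.
have S' := system_iso_sym S; have ls := smooth_sub_on (smooth_affine (flip eta) b).
have ls' := smooth_sub_on (smooth_affine (flip eta) (- (eta * a) *: delta_mx 0 0)).
have phB := psi_base S'; have phK := psiK S'.
split.
- split.
    have fpc := within_comp (smooth_sub_within (si_phi S)) phB fcont.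
    exact: (within_comp fpc (fun _ _ => I) (smooth_sub_within (ls setT))).
  exists (psi \o (g \o l')); split.
    by move=> z Bz; rewrite /f2 /= lK gK ?phK//; exact: phB.
  have im := image_within_inverse phB.
  have glB z : (f2 @` base Phi2) z -> base Phi1 ((g \o l') z).
    by move=> /im[y By /= <-]; rewrite gK.
  have glc := within_comp (smooth_sub_within (ls' _)) im gc.
  exact: (within_comp glc glB (smooth_sub_within (si_psi S))).
- move=> z [Bz nc]; split=> // zf; apply: nc; exists z => //.
- split; first exact: open_S2.
  (* Density: a neighbourhood of [z] is pulled back by [psi] to one of [phi z], where a point of
     [S1] is available. *)
  move=> z Bz N Nz; have := smooth_sub_within (si_psi S); move/withinP.
  move=> /(_ (phi z) N (phB z Bz)); rewrite (phK z Bz) => /(_ Nz) pN.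
  have [y [S1y Ny]] := S1d _ (phB z Bz) _ pN.
  by exists (psi y); split; [exact: psi_S|apply: Ny; case: S1y].
- have S2B : S2 `<=` base Phi2 by move=> z [].
  have phs := smooth_sub_subset S2B (si_phi S).
  split.
    have fps : smooth_sub S2 (f \o phi) by exact: (smooth_sub_comp _ _ phs phi_S fsm).
    exact: (smooth_sub_comp _ _ fps (fun _ _ => I) (ls setT)).
  exists (psi \o (g' \o l')); split.
    by move=> z Sz; rewrite /f2 /= lK gK' ?phK//; [exact: S2B|exact: phi_S].
  have im := image_within_inverse phi_S.
  have glB z : (f2 @` S2) z -> base Phi1 ((g' \o l') z).
    by move=> /im[y By /= <-]; rewrite gK'//; case: By.
  have gls : smooth_sub (f2 @` S2) (g' \o l') by exact: (smooth_sub_comp _ _ (ls' _) im gs').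
  exact: (smooth_sub_comp _ _ gls glB (si_psi S)).
- move=> U chi Uchi q [z [Uz Sz] zq].
  have UB y : U y -> base Phi2 y by have [[V [_ ->]] _ _ _] := Uchi; case=> _ [].
  have UP y : U y -> [set z | base Phi1 z /\ U (psi z)] (phi y).
    by move=> Uy; split; [exact: (phB y (UB y Uy))|rewrite (phK y (UB y Uy))].
  have [|N [h [Nq hA hE]]] := fZ _ _ (affine_chart_pull Uchi) q.
    exists (phi z); first by split; [exact: UP|exact: phi_S].
    by rewrite /= (phK z (UB z Uz)).
  exists N, (l \o h); split=> //; first exact: flip_AGL.
  move=> y Uy Sy Ny; rewrite /f2 /=; congr l.
  rewrite hE ?phK ?UB//; [|exact: UP|exact: phi_S|].
  all: by rewrite /= (phK y (UB y Uy)).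
Qed.

Let B1 := base Phi1.
Let B2 := base Phi2.

Let rB2 : rigid B2.
Proof. by have := rigid_base (fs_integrable fs2) openT; rewrite setIT. Qed.

Let rS1 : rigid S1.
Proof.
have [_ _ [[V [Vo ->]] _] _ _] := fc; rewrite setIC.
exact: (rigid_base (fs_integrable fs1) Vo).
Qed.

Let rS2 : rigid S2.
Proof. by have [V [Vo ->]] := open_S2; rewrite setIC; exact: (rigid_base (fs_integrable fs2) Vo). Qed.

Let S2B : S2 `<=` B2. Proof. by move=> z []. Qed.

Lemma Dsub_transport z : S2 z ->
  Dsub S2 f2 z = (flip eta)^T *m Dsub S1 f (phi z) *m Dsub B2 phi z.
Proof.
move=> Sz; have [_ _ _ [fsm _] _] := fc.
have phs := smooth_sub_subset S2B (si_phi S).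
have fps : smooth_sub S2 (f \o phi) by exact: (smooth_sub_comp _ _ phs phi_S fsm).
rewrite (Dsub_affine (flip eta) b rS2 fps Sz) -mulmxA; congr (_ *m _).
rewrite (Dsub_comp rS2 rS1 phs phi_S fsm Sz); congr (_ *m _).
exact: (Dsub_restrict rS2 rB2 S2B (si_phi S) Sz).
Qed.

Lemma phi0 z : B2 z -> phi z 0 0 = eta * z 0 0 + - (eta * a).
Proof.
move=> Bz; have := psi0 (psi_base (system_iso_sym S) Bz).
rewrite (psiK (system_iso_sym S) Bz) => ->.
by rewrite mulrDr mulrA (is_sign_sqr es) mul1r addrK.
Qed.

Lemma phi_sg z : B2 z -> Num.sg (Dsub B2 phi z 1 1) = sigma.
Proof.
move=> Bz; have Bp := psi_base (system_iso_sym S) Bz.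
have := vertical_inverse S fs1 fs2 psi0 Bp; rewrite (psiK (system_iso_sym S) Bz) => H.
exact: (sgr_inverse ss H (psi_sg Bp)).
Qed.

(** [P1] and [P2] stand for the half-planes on either side of a vertical line, so that one statement
    covers both signs of [eta]. The derivative factors by [Dsub_transport], and the factor coming
    from [phi] converges because it is continuous on the whole base. *)
Lemma limit_transport z (P1 P2 : set 'rV[R]_2) D : B2 z ->
  (forall u, B2 u -> P2 u -> P1 (phi u)) ->
  Dsub S1 f @ within [set u | S1 u /\ P1 u] (nbhs (phi z)) --> D ->
  Dsub S2 f2 @ within [set u | S2 u /\ P2 u] (nbhs z) --> (flip eta)^T *m D *m Dsub B2 phi z.
Proof.
move=> Bz P21 fD; set FF := within _ (nbhs z).
have phc : phi @ FF --> within [set u | S1 u /\ P1 u] (nbhs (phi z)).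
  move=> N /= Nz; have := (withinP _ _).1 (smooth_sub_within (si_phi S)) z _ Bz Nz.
  apply: filterS => u H [S2u P2u]; apply: (H (S2B S2u)).
  by split; [exact: phi_S|exact: (P21 _ (S2B S2u) P2u)].
have Dphi : Dsub B2 phi @ FF --> Dsub B2 phi z.
  move=> N /= Nz; have := (withinP _ _).1 (Dsub_within rB2 (si_phi S)) z _ Bz Nz.
  by apply: filterS => u H [S2u _]; exact: (H (S2B S2u)).
have Df := cvg_comp _ _ phc fD.
have cL : (fun=> (flip eta)^T) @ FF --> (flip eta)^T by exact: cvg_cst.
have FFF : Filter FF by exact: within_filter.
have H := cvg_mulmx2 FFF (cvg_mulmx2 FFF cL Df) Dphi.
move=> N Nz; have HN : \forall u \near z, S2 u /\ P2 u ->
    N ((flip eta)^T *m Dsub S1 f (phi u) *m Dsub B2 phi u) by exact: (H N Nz).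
have HG : \forall u \near z, S2 u /\ P2 u -> N (Dsub S2 f2 u).
  by apply: filterS HN => u Hu Au; rewrite (Dsub_transport Au.1); exact: Hu.
exact: HG.
Qed.

Lemma closure_transport z (P1 P2 : set 'rV[R]_2) : B2 z ->
  (forall u, B2 u -> P2 u -> P1 (phi u)) -> closure (B2 `&` P2) z -> closure (B1 `&` P1) (phi z).
Proof.
move=> Bz P21 cz N Nz; have := (withinP _ _).1 (smooth_sub_within (si_phi S)) z _ Bz Nz.
move=> /cz[u [[Bu P2u] H]]; exists (phi u); split; last exact: H.
by split; [exact: (psi_base (system_iso_sym S))|exact: P21].
Qed.

Lemma semitoric_transport : semitoric_pair w2 Phi2 f2 eps2.
Proof.
have [_ _ f0 [sgn fsg fw]] := fp; have S' := system_iso_sym S.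
split.
- exact: (sign_choice_transport S fs1 fs2 ss sc).
- exact: cartographic_transport.
- move=> z Bz; have Bp := psi_base S' Bz.
  by rewrite /f2 /= /l /b flipE f0// -psi0// (psiK S').
(* The vertical derivative of the new map is the product of those of [f] and [phi]; that of [phi]
   has sign [sigma] again, being the inverse of that of [psi]. *)
exists (sgn * sigma).
  move=> z Sz; rewrite -/S2 (Dsub_transport Sz).
  have [_ p01] := Dsub_first_row rB2 (si_phi S) (S2B Sz) phi0.
  have E := congr1 Num.sg (flip_entry11 eta (Dsub S1 f (phi z)) p01).
  apply: (etrans E); apply: (etrans (sgrM _ _)).
  exact: (congr2 *%R (fsg _ (phi_S Sz)) (phi_sg (S2B Sz))).
move=> z Wz cl cr; have Bz : B2 z by case: Wz.
have Bp := psi_base S' Bz; have W1 : Bwt w1 Phi1 (phi z).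
  by apply/(Bwt_psi Bp); rewrite (psiK S').
(* The sign of the map and [j_] both acquire a factor [sigma], so the slope of the shear is
   unchanged. *)
have jE : sgn * sigma * j_ w2 Phi2 eps2 z = sgn * j_ w1 Phi1 eps (phi z).
  have := j_psi S fs1 fs2 es psi0 psi_sg sc Bp; rewrite (psiK S') => // ->.
  by rewrite -mulrA (mulrA sigma) (is_sign_sqr ss) mul1r.
rewrite /wall_crossing jE.
case: (es) => eE.
- have sl u : B2 u -> u 0 0 < z 0 0 -> phi u 0 0 < phi z 0 0.
    by move=> Bu; rewrite !phi0// eE !mul1r ltrD2r.
  have sr u : B2 u -> z 0 0 < u 0 0 -> phi z 0 0 < phi u 0 0.
    by move=> Bu; rewrite !phi0// eE !mul1r ltrD2r.
  have [Dl [Dr [HDl HDr E]]] := fw _ W1 (closure_transport Bz sl cl) (closure_transport Bz sr cr).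
  exists ((flip eta)^T *m Dl *m Dsub B2 phi z), ((flip eta)^T *m Dr *m Dsub B2 phi z).
  split; [exact: (limit_transport Bz sl HDl)|exact: (limit_transport Bz sr HDr)|].
  by rewrite E mulmxA (flip_shear _ es) eE mul1r -!mulmxA.
have sl u : B2 u -> u 0 0 < z 0 0 -> phi z 0 0 < phi u 0 0.
  by move=> Bu; rewrite !phi0// eE !mulN1r ltrD2r ltrN2.
have sr u : B2 u -> z 0 0 < u 0 0 -> phi u 0 0 < phi z 0 0.
  by move=> Bu; rewrite !phi0// eE !mulN1r ltrD2r ltrN2.
have [Dl [Dr [HDl HDr E]]] := fw _ W1 (closure_transport Bz sr cr) (closure_transport Bz sl cl).
exists ((flip eta)^T *m Dr *m Dsub B2 phi z), ((flip eta)^T *m Dl *m Dsub B2 phi z).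
split; [exact: (limit_transport Bz sl HDr)|exact: (limit_transport Bz sr HDl)|].
(* For [eta = -1] the new left limit comes from the old right one: the relation is solved for [Dr],
   which gives [shear (- s)], and the reflection turns this back into [shear s]. *)
set s := sgn * _ in E *.
have -> : Dr = shear (- s) *m Dl.
  by rewrite E mulmxA shear_mul addNr shear0 mul1mx.
by rewrite mulmxA (flip_shear _ es) eE mulN1r opprK -!mulmxA.
Qed.

(** The same subset of the plane is the image of the base under the new map followed by [l0 \o l'],
    where [l'] undoes the reflection and translation; this composition stays in L because L contains
    the reflections and translations of the first axis. *)
Lemma complexity_one_image_transport l0 : L_group l0 ->
  complexity_one_images w2 Phi2 ((l0 \o f) @` base Phi1).
Proof.
move=> [eta1 [eta2 [k [c [d [e1 e2 l0E]]]]]].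
exists ((l0 \o l') \o f2); last first.
  apply/seteqP; split=> _ [z Bz <-].
    exists (phi z); first exact: (psi_base (system_iso_sym S)).
    by rewrite /f2 /= lK.
  by exists (psi z); [exact: (psi_base S)|rewrite /f2 /= lK (psiK S)].
exists S2, (l0 \o l'), f2, eps2; split => //; last exact: semitoric_transport.
have [e eE] : exists e : int, e%:~R = eta by case: es => ->; [exists 1|exists (-1)].
exists (eta1 * eta), eta2, (k * e), (c - eta1 * (eta * a)), (d - k%:~R * (eta * a)).
split=> //; first exact: is_sign_mul.
apply/funext => z; rewrite l0E; apply/rowP => i; rewrite [LHS]mxE [RHS]mxE !flipE intrM eE.
by case: ifP => _; ring.
Qed.

End PairTransport.

Lemma complexity_one_images_sub (R : realType) (M1 M2 : topologicalType)
    (w1 : symplectic4 R M1) (w2 : symplectic4 R M2) Phi1 Phi2 F G psi phi :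
  system_iso w1 w2 Phi1 Phi2 F G psi phi ->
  faithful_semitoric w1 Phi1 -> faithful_semitoric w2 Phi2 ->
  (exists p, focus_focus w1 Phi1 p) ->
  complexity_one_images w1 Phi1 `<=` complexity_one_images w2 Phi2.
Proof.
move=> S fs1 fs2 ff _ [_ [S0 [l0 [f [eps [Ll fp -> _]]]]] <-].
have [eta [a [es psi0]]] := iso_first_coordinate S fs1 fs2 ff.
have [sigma ss psi_sg] := vertical_sign S fs1 fs2 psi0.
exact: (complexity_one_image_transport S fs1 fs2 es ss psi0 psi_sg fp Ll).
Qed.

Theorem lemma5p26 (R : realType) (M1 M2 : topologicalType)
    (w1 : symplectic4 R M1) (w2 : symplectic4 R M2)
    (Phi1 : M1 -> 'rV[R]_2) (Phi2 : M2 -> 'rV[R]_2)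
    (fs1 : faithful_semitoric w1 Phi1) (fs2 : faithful_semitoric w2 Phi2)
    (simple1 : one_focus_focus_per_fiber w1 Phi1)
    (simple2 : one_focus_focus_per_fiber w2 Phi2)
    (iso : isomorphic_systems w1 w2 Phi1 Phi2)
    (has_ff : exists p, focus_focus w1 Phi1 p) :
  complexity_one_images w1 Phi1 = complexity_one_images w2 Phi2.
Proof.
have [F [G [psi [phi S]]]] := isomorphic_system_iso iso.
have [p pf] := has_ff; have [Ps1 _ _ _] := fs_integrable fs1; have [Ps2 _ _ _] := fs_integrable fs2.
apply/seteqP; split; first exact: (complexity_one_images_sub S fs1 fs2 has_ff).
(* The reverse inclusion uses the inverse isomorphism, for which [F p] is the required focus-focus
   point. *)
apply: (complexity_one_images_sub (system_iso_sym S) fs2 fs1); exists (F p).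
exact: (focus_focus_transport S Ps1 Ps2 (fs_almost_toric fs2) pf).
Qed.
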